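(* Let $\sigma>0$, $\mu\in\mathbb{R}^n$, $y=\mu+\varepsilon$ with $\varepsilon\sim N(0,\sigma^2I_n)$. Let $\hat\mu:\mathbb{R}^n\to\mathbb{R}^n$ be such that each component of $x\mapsto\hat\mu(\mu+\sigma x)$ belongs to $W^{1,2}(\gamma_n)$, write $\hat\mu=\hat\mu(y)$, and let $\widehat{\mathsf{SURE}}=\|y-\hat\mu\|^2+2\sigma^2\operatorname{div}\hat\mu-\sigma^2n$. Then $$\mathbb{E}\Big[\big(\widehat{\mathsf{SURE}}-\|\mu-\hat\mu\|^2-\|\varepsilon\|^2+\sigma^2n\big)^2\Big]=4\sigma^2\mathbb{E}\big[\|\hat\mu-\mu\|^2\big]+4\sigma^4\mathbb{E}\big[\operatorname{trace}((\nabla\hat\mu)^2)\big].$$ If the right-hand side of this identity is at most $2\sigma^4v_0^2\,n\,\epsilon_n$ for some constant $v_0>0$ and some $\epsilon_n\ge0$, then for all $\alpha\in(0,1)$ $$\mathbb{P}\Big\{\big|\widehat{\mathsf{SURE}}-\|\mu-\hat\mu\|^2\big|\le\sigma^2(v_\alpha+v_0)\sqrt{2n}\Big\}\ge1-\alpha-\epsilon_n,$$ where $v_\alpha$ is defined by $\mathbb{P}\{(2n)^{-1/2}|\chi^2_n-n|>v_\alpha\}=\alpha$, and $$\mathbb{P}\Big\{\|\mu-\hat\mu\|^2\le\widehat{\mathsf{SURE}}+\sigma^2(v_{-,\alpha}+v_0)\sqrt{2n}\Big\}\ge1-\alpha-\epsilon_n,$$ where $v_{-,\alpha}$ is defined by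 $\mathbb{P}\{(2n)^{-1/2}(n-\chi^2_n)>v_{-,\alpha}\}=\alpha$.
   Context: $\chi^2_n$ denotes a chi-square random variable with $n$ degrees of freedom. $\|\cdot\|$ is the Euclidean norm; $\operatorname{div}\hat\mu=\sum_i\partial\hat\mu_i/\partial y_i$; $\nabla\hat\mu$ is the $n\times n$ matrix whose columns are the gradients of the components of $\hat\mu$, evaluated at $y$ (weak derivatives). $\gamma_n$ is the standard Gaussian measure on $\mathbb{R}^n$ and $W^{1,2}(\gamma_n)$ is the set of locally integrable, weakly differentiable $g:\mathbb{R}^n\to\mathbb{R}$ with $\int(g^2+\|\nabla g\|^2)\,d\gamma_n<\infty$. *)

(* Defs.v *)
From HB Require Import structures.
From mathcomp Require Import all_boot all_order all_algebra.
From mathcomp Require Import all_classical all_reals all_analysis.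

Set Implicit Arguments.
Unset Strict Implicit.
Unset Printing Implicit Defensive.

Import Order.TTheory GRing.Theory Num.Theory.
Import numFieldNormedType.Exports.

Local Open Scope classical_set_scope.
Local Open Scope ring_scope.

Section measurable_rV.
Context {R : realType} (n : nat).

Let coors (i : 'I_n) (x : 'rV[R]_n) : R := x ord0 i.

Let rV_set0 : g_sigma_preimage coors set0.
Proof. exact: sigma_algebra0. Qed.

Let rV_setC A : g_sigma_preimage coors A -> g_sigma_preimage coors (~` A).
Proof. exact: sigma_algebraC. Qed.

Let rV_bigcup (F : _^nat) : (forall i, g_sigma_preimage coors (F i)) ->
  g_sigma_preimage coors (\bigcup_i (F i)).
Proof. exact: sigma_algebra_bigcup. Qed.

HB.instance Definition _ := @isMeasurable.Build default_measure_display
  'rV[R]_n (g_sigma_preimage coors) rV_set0 rV_setC rV_bigcup.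

Lemma measurable_coord (i : 'I_n) :
  measurable_fun [set: 'rV[R]_n] (fun x : 'rV[R]_n => x ord0 i).
Proof.
move=> _ Y mY; rewrite setTI; apply: sub_sigma_algebra => /=.
rewrite -bigcup_seq/=; exists i => /=; first by rewrite mem_index_enum.
by exists Y => //; rewrite setTI.
Qed.

Lemma measurable_fun_rV d (T : measurableType d) (f : T -> 'rV[R]_n) :
  (forall i, measurable_fun [set: T] (fun x => f x ord0 i)) ->
  measurable_fun [set: T] f.
Proof.
move=> mf _ A mA; rewrite setTI.
have : preimage_set_system [set: T] f measurable `<=` measurable; last first.
  by apply; exists A => //; rewrite setTI.
have <- : g_sigma_preimage (fun i => coors i \o f) =
          preimage_set_system [set: T] f measurable.
  by rewrite g_sigma_preimage_comp.
apply: smallest_sub; first exact: sigma_algebra_measurable.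
rewrite -bigcup_seq; apply: bigcup_sub => i _ B [C mC <-]; exact: mf.
Qed.

End measurable_rV.

(* lebesgue_measure and normal_prob are measures on measurableTypeR R, which has
   the same measurable sets as R but another display. *)
Section product_measure_rV.
Context {R : realType}.

Definition cons_rV (n : nat) (p : measurableTypeR R * 'rV[R]_n) : 'rV[R]_n.+1 :=
  \row_i oapp (p.2 ord0) p.1 (unlift ord0 i).

Definition uncons_rV (n : nat) (x : 'rV[R]_n.+1) : measurableTypeR R * 'rV[R]_n :=
  (x ord0 ord0, \row_i x ord0 (lift ord0 i)).

Lemma cons_rV_cancel n : cancel (@cons_rV n) (@uncons_rV n).
Proof.
case=> a v; congr pair; first by rewrite mxE unlift_none.
by apply/rowP => i; rewrite !mxE liftK.
Qed.

Lemma uncons_rV_cancel n : cancel (@uncons_rV n) (@cons_rV n).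
Proof.
by move=> x; apply/rowP => i; rewrite mxE; case: unliftP => [j|] -> //=; rewrite mxE.
Qed.

Lemma measurable_cons_rV n : measurable_fun [set: measurableTypeR R * 'rV[R]_n] (@cons_rV n).
Proof.
apply: measurable_fun_rV => i; under eq_fun do rewrite mxE.
case: unliftP => [j _|_] /=; last exact: measurable_fst.
exact: (measurableT_comp (measurable_coord j) measurable_snd).
Qed.

Lemma measurable_uncons_rV n :
  measurable_fun [set: 'rV[R]_n.+1] (@uncons_rV n).
Proof.
apply: measurable_fun_pair; first exact: measurable_coord.
apply: measurable_fun_rV => i; under eq_fun do rewrite mxE.
exact: measurable_coord.
Qed.

Section cons_measure.
Context (n : nat) (m : {sigma_finite_measure set (measurableTypeR R) -> \bar R})
  (mn : {sigma_finite_measure set 'rV[R]_n -> \bar R}).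

Definition cons_measure : set 'rV[R]_n.+1 -> \bar R :=
  pushforward (m \x mn)%E (@cons_rV n).

Let mC A : measurable A -> measurable (@cons_rV n @^-1` A).
Proof. by move=> mA; rewrite -[X in measurable X]setTI; exact: measurable_cons_rV. Qed.

Let cons_measure0 : cons_measure set0 = 0%E.
Proof. by rewrite /cons_measure /pushforward preimage_set0 measure0. Qed.

Let cons_measure_ge0 A : (0 <= cons_measure A)%E.
Proof. by rewrite /cons_measure /pushforward measure_ge0. Qed.

Let cons_measure_sigma_additive : semi_sigma_additive cons_measure.
Proof.
move=> F mF tF mUF; rewrite /cons_measure /pushforward preimage_bigcup.
apply: (@measure_semi_sigma_additive _ _ _ (m \x mn)%E).
- by move=> i; apply: mC; exact: mF.
- apply/trivIsetP => /= i j _ _ ij; rewrite -preimage_setI.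
  by move/trivIsetP : tF => /(_ _ _ _ _ ij) ->//; rewrite preimage_set0.
- by rewrite -preimage_bigcup; exact: mC.
Qed.

HB.instance Definition _ := isMeasure.Build _ _ _ cons_measure
  cons_measure0 cons_measure_ge0 cons_measure_sigma_additive.

Let cons_measure_sigma_finite : sigma_finite [set: 'rV[R]_n.+1] cons_measure.
Proof.
have /sigma_finiteP[F [FT ndF Foo]] := sigma_finiteT m.
have /sigma_finiteP[G [GT ndG Goo]] := sigma_finiteT mn.
exists (fun i => @uncons_rV n @^-1` (F i `*` G i)).
  rewrite -preimage_bigcup -[LHS](preimage_setT (@uncons_rV n)).
  congr (_ @^-1` _); rewrite -setXTT FT GT predeqE => -[x y]; split.
    move=> [/= [i _ Fix] [k _ Gky]]; exists (maxn i k) => //; split.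
    - by move: x Fix; exact/subsetPset/ndF/leq_maxl.
    - by move: y Gky; exact/subsetPset/ndG/leq_maxr.
  by move=> [i _ []/= ? ?]; split; exists i.
move=> k; have [mF Fk] := Foo k; have [mG Gk] := Goo k; split.
  rewrite -[X in measurable X]setTI; apply: measurable_uncons_rV => //.
  exact: measurableX.
rewrite /cons_measure /pushforward -comp_preimage.
rewrite [X in X @^-1` _](_ : _ = id).
  by rewrite preimage_id product_measure1E// lte_mul_pinfty// ge0_fin_numE.
by apply/funext => p /=; rewrite cons_rV_cancel.
Qed.

HB.instance Definition _ := Measure_isSigmaFinite.Build _ _ _ cons_measure
  cons_measure_sigma_finite.

End cons_measure.

(* n-fold product of a measure on R; dimension 0 carries the unit mass. *)
Fixpoint power_measure (m : {sigma_finite_measure set (measurableTypeR R) -> \bar R}) (n : nat) :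
    {sigma_finite_measure set 'rV[R]_n -> \bar R} :=
  match n with
  | 0 => @dirac _ 'rV[R]_0 0 R
  | k.+1 => cons_measure m (power_measure m k)
  end.

Lemma power_measureE (m : {sigma_finite_measure set (measurableTypeR R) -> \bar R}) (n : nat)
    (A : 'I_n -> set (measurableTypeR R)) : (forall i, measurable (A i)) ->
  power_measure m n [set x | forall i, A i (x ord0 i)] =
  (\prod_(i < n) m (A i))%E.
Proof.
elim: n A => [|n IHn] A mA /=.
  by rewrite big_ord0 diracE mem_set// => -[].
have mB : measurable [set x : 'rV[R]_n | forall i, A (lift ord0 i) (x ord0 i)].
  rewrite [X in measurable X](_ : _ =
      \big[setI/setT]_(i < n) ((fun x : 'rV[R]_n => x ord0 i) @^-1` A (lift ord0 i))).
    apply: bigsetI_measurable => i _.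
    by rewrite -[X in measurable X]setTI; apply: measurable_coord => //; exact: mA.
  rewrite -bigcap_seq; apply/seteqP; split => x /= h i; first by move=> _; exact: h.
  by apply: h; rewrite /= mem_index_enum.
rewrite big_ord_recl -IHn//.
rewrite -(product_measure1E m (power_measure m n))//.
rewrite /cons_measure /pushforward; congr (_ _).
apply/seteqP; split => [[a v] /= h|[a v] /= [ha hv] i].
  split; first by have := h ord0; rewrite mxE unlift_none.
  by move=> i; have := h (lift ord0 i); rewrite mxE liftK.
by rewrite mxE; case: unliftP => [j|] ->; [exact: hv|].
Qed.

End product_measure_rV.

Definition lebesgue_rV {R : realType} (n : nat) :
    {sigma_finite_measure set 'rV[R]_n -> \bar R} :=
  power_measure lebesgue_measure n.

(* The law N(0, s ^+ 2 I_n), i.e. n independent coordinates N(0, s ^+ 2);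
   normal_prob takes the standard deviation as its second argument. *)
Definition gaussian_rV {R : realType} (n : nat) (s : R) :
    {sigma_finite_measure set 'rV[R]_n -> \bar R} :=
  power_measure (normal_prob 0 s) n.

(* The norm that the library puts on 'rV is the sup norm. *)
Definition enorm {R : realType} (n : nat) (x : 'rV[R]_n) : R :=
  Num.sqrt (\sum_(i < n) x ord0 i ^+ 2).

Definition chi_square {R : realType} (n : nat) : set R -> \bar R :=
  pushforward (gaussian_rV n 1) (fun x : 'rV[R]_n => enorm x ^+ 2).

Section weak_derivatives.
Context {R : realType} (n : nat).
Implicit Types (g h phi : 'rV[R]_n -> R).

(* Continuous partial derivatives up to order k. *)
Fixpoint Ck (k : nat) phi : Prop :=
  if k is k'.+1 then continuous phi /\ forall i : 'I_n,
    (forall x, derivable phi x (delta_mx ord0 i)) /\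
    Ck k' ('D_(delta_mx ord0 i) phi)
  else continuous phi.

Definition test_function phi : Prop :=
  (forall k, Ck k phi) /\ compact (closure [set x | phi x != 0]).

Definition loc_integrable g : Prop :=
  measurable_fun [set: 'rV[R]_n] g /\
  forall K : set 'rV[R]_n, compact K ->
    (\int[lebesgue_rV n]_(x in K) `|g x|%:E < +oo)%E.

(* h is a weak partial derivative of g in direction i. *)
Definition weak_partial (i : 'I_n) g h : Prop :=
  loc_integrable h /\
  forall phi, test_function phi ->
    \int[lebesgue_rV n]_x (g x * 'D_(delta_mx ord0 i) phi x) =
    - \int[lebesgue_rV n]_x (h x * phi x).

(* The space W^{1,2} of the standard Gaussian measure. *)
Definition gauss_sobolev g : Prop :=
  loc_integrable g /\
  exists h : 'I_n -> 'rV[R]_n -> R, (forall i, weak_partial i g (h i)) /\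
    (\int[gaussian_rV n 1%R]_x (g x ^+ 2 + \sum_(i < n) h i x ^+ 2)%:E < +oo)%E.

(* A version J of the weak derivative matrix of f : column j is the gradient
   of the j-th component. *)
Definition weak_gradient_mx (f : 'rV[R]_n -> 'rV[R]_n)
    (J : 'rV[R]_n -> 'M[R]_n) : Prop :=
  forall i j, weak_partial i (fun y => f y ord0 j) (fun y => J y i j).

End weak_derivatives.

Definition SURE {R : realType} (n : nat) (sigma : R)
    (muhat : 'rV[R]_n -> 'rV[R]_n) (J : 'rV[R]_n -> 'M[R]_n)
    (y : 'rV[R]_n) : R :=
  enorm (y - muhat y) ^+ 2 + 2 * sigma ^+ 2 * (\sum_(i < n) J y i i)
  - sigma ^+ 2 * n%:R.

(* Main.v *)
Require Import Defs.
From HB Require Import structures.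
From mathcomp Require Import all_boot all_order all_algebra.
From mathcomp Require Import all_classical all_reals all_analysis.
From mathcomp Require Import measurable_realfun.
From mathcomp Require Import ring lra.

(** With [x = eps / sigma] a standard Gaussian vector and
    [g x = muhat (mu + sigma x) - mu], the deviation whose second moment is
    computed equals [- 2 sigma (x . g - div g)], so the identity is the second
    order Stein formula
      [E (x . g - div g)^2 = E |g|^2 + E tr ((grad g)^2)] for [g] in W^{1,2}.
    It is obtained without smoothing [g].  For [rho < 1] let [(X, Y)] be a pair
    of standard Gaussian vectors with correlation [rho]; its density [K] (the
    Mehler kernel) is smooth.  When [F] is [g] times a cutoff, integration by
    parts against [K (., y)] and Fubini give the exact identity
      [E (delta_i F_i)(X) (delta_j F_j)(Y) =
         rho (i == j) E F_i(X) F_j(Y) + rho^2 E (d_j F_i)(X) (d_i F_j)(Y)],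
    where [delta_i F = x_i F - d_i F].  As [rho] tends to 1 the law of [(X, Y)]
    concentrates on the diagonal, and pairings of L2 functions converge; then
    the cutoff is removed by Fatou's lemma and dominated convergence.  The same
    concentration, for pairings of an L1 function with a bounded one, shows that
    weak derivatives are unique, so that [sigma J] inherits the square
    integrability of the derivatives provided by W^{1,2}.  The two confidence
    bounds follow from Chebyshev's inequality and a union bound. *)

Set Implicit Arguments.
Unset Strict Implicit.
Unset Printing Implicit Defensive.

Import Order.TTheory GRing.Theory Num.Theory.
Import numFieldNormedType.Exports.

Local Open Scope classical_set_scope.
Local Open Scope ring_scope.

(** * Gaussian and Lebesgue measures on row vectors *)

(** With two correlated points one derivative falls on [g] at X and the other on [g] at Y, so first
    weak derivatives suffice. The exchange of indices in d_j F_i, d_i F_j comes from the kernel: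
    both sides of the correlated identity reduce to the same pairings of F_i(X) and F_j(Y) weighted
    by coordinates, and they agree because the conditional variance is 1 - rho^2. Another obstacle
    is that square integrability of x_i g_i is not among the hypotheses. Under a cutoff of fixed
    radius it is immediate, so rho tends to 1 first and the radius grows afterwards; square
    integrability of x . g - div g is then a conclusion. In the constants, 4 sigma^2 is the square
    of 2 sigma, and the trace carries two more factors sigma because the Jacobian of [g] is sigma J.
    Chebyshev's inequality is used at the level sigma^2 v0 sqrt(2n), whose square times eps_n is
    exactly the assumed bound. *)

Section density.
Context d (T : measurableType d) (R : realType).
Variables (mu nu : {measure set T -> \bar R}) (p : T -> R).
Hypotheses (mp : measurable_fun [set: T] p) (p0 : forall x, 0 <= p x).
Hypothesis nuE : forall A, measurable A -> nu A = (\int[mu]_(x in A) (p x)%:E)%E.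
Import HBNNSimple.

(** On indicators this is [nuE]; linearity gives simple functions, and monotone convergence along
    [nnsfun_approx] gives all nonnegative measurable functions. *)
Lemma ge0_integral_density (f : T -> \bar R) :
  measurable_fun [set: T] f -> (forall x, 0 <= f x)%E ->
  (\int[nu]_x f x = \int[mu]_x (f x * (p x)%:E))%E.
Proof.
move=> mf f0.
pose g := nnsfun_approx measurableT mf.
have gf x : (fun n => (g n x)%:E) @ \oo --> f x by exact: cvg_nnsfun_approx.
have nd_g x : {homo (fun n => (g n x)%:E) : a b / (a <= b)%N >-> (a <= b)%E}.
  by move=> a b ab; rewrite lee_fin; exact/lefP/nd_nnsfun_approx.
transitivity (limn (fun n => \int[nu]_x (g n x)%:E)%E).
  rewrite -monotone_convergence//.
  - by apply: eq_integral => x _; apply/esym/cvg_lim.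
  - by move=> n; exact/measurable_EFinP.
  - by move=> n x _; rewrite lee_fin.
transitivity (limn (fun n => \int[mu]_x ((g n x)%:E * (p x)%:E))%E); last first.
  rewrite -monotone_convergence//.
  - apply: eq_integral => x _; apply/cvg_lim => //.
    apply: cvgeZr => //; exact: gf.
  - move=> n; apply: emeasurable_funM; exact/measurable_EFinP.
  - by move=> n x _; rewrite -EFinM lee_fin mulr_ge0.
  - by move=> x _ a b ab; rewrite lee_wpmul2r ?lee_fin//; exact: nd_g.
congr (limn _); apply/funext => n.
under eq_integral do rewrite fimfunE -fsumEFin//.
rewrite ge0_integral_fsum//; last 2 first.
  by move=> r; exact/measurable_EFinP/measurable_funM.
  by move=> r x _; rewrite nnfun_muleindic_ge0.
rewrite [RHS](_ : _ = \int[mu]_x \sum_(r \in range (g n))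
    ((r * \1_(g n @^-1` [set r]) x)%:E * (p x)%:E))%E; last first.
  apply: eq_integral => x _; rewrite fimfunE -fsumEFin// ge0_mule_fsuml// => r.
  exact: nnfun_muleindic_ge0.
rewrite ge0_integral_fsum//; last 2 first.
  move=> r; apply: emeasurable_funM; last exact/measurable_EFinP.
  exact/measurable_EFinP/measurable_funM.
  by move=> r x _; rewrite mule_ge0 ?lee_fin//; exact: nnfun_muleindic_ge0.
apply: eq_fsbigr => r _.
rewrite integralZl_indic_nnsfun// integral_indic//= setIT nuE//.
rewrite integral_mkcond/=.
(* Pulling the scalar [r] out of the integral requires [0 <= r]; a negative level of a nonnegative
   simple function has empty preimage, so both sides vanish. *)
have [r0|r0] := ltP r 0.
  rewrite preimage_nnfun0// (_ : restrict _ _ = cst 0%E); last first.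
    by apply/funext => x; rewrite /restrict /= in_set0.
  rewrite integral0 mule0 integral0_eq// => x _.
  by rewrite indicE in_set0 mulr0 mul0e.
rewrite -ge0_integralZl//; first last.
- by move=> x _; apply: erestrict_ge0 => y _; rewrite lee_fin.
- apply/(measurable_restrictT (fun x => (p x)%:E)) => //.
  by apply: measurable_funTS; exact/measurable_EFinP.
apply: eq_integral => x _; rewrite indicE/= /restrict; case: ifPn => // _.
  by rewrite mulr1.
by rewrite mulr0 mul0e -[point]/(0%E) mule0.
Qed.

End density.

Section power_measure.
Context {R : realType}.
Implicit Type m : {sigma_finite_measure set (measurableTypeR R) -> \bar R}.

Lemma ge0_integral_power_measureS m n (F : 'rV[R]_n.+1 -> \bar R) :
  measurable_fun [set: 'rV[R]_n.+1] F -> (forall x, 0 <= F x)%E ->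
  (\int[power_measure m n.+1]_x F x =
   \int[m]_a \int[power_measure m n]_v F (cons_rV (a, v)))%E.
Proof.
move=> mF F0 /=.
rewrite [LHS](@ge0_integral_pushforward _ _ _ _ _ _ (@measurable_cons_rV R n)) //.
rewrite preimage_setT fubini_tonelli1//; last by move=> x; exact: F0.
exact: (measurableT_comp mF (@measurable_cons_rV R n)).
Qed.

Lemma ge0_integral_power_measure0 m (F : 'rV[R]_0 -> \bar R) :
  measurable_fun [set: 'rV[R]_0] F ->
  (\int[power_measure m 0]_x F x = F 0%R)%E.
Proof. by move=> mF /=; rewrite integral_dirac//= diracT mul1e. Qed.

Lemma measurable_fun_cons_r n (F : 'rV[R]_n.+1 -> \bar R) (a : measurableTypeR R) :
  measurable_fun [set: 'rV[R]_n.+1] F ->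
  measurable_fun [set: 'rV[R]_n] (fun v => F (cons_rV (a, v))).
Proof.
move=> mF; apply: (measurableT_comp mF).
exact: (measurableT_comp (@measurable_cons_rV R n) (measurable_pair1 a)).
Qed.

Lemma cons_rV0 n a (v : 'rV[R]_n) : cons_rV (a, v) 0 0 = a.
Proof. by rewrite mxE unlift_none. Qed.

Lemma cons_rVS n a (v : 'rV[R]_n) i : cons_rV (a, v) 0 (lift 0 i) = v 0 i.
Proof. by rewrite mxE liftK. Qed.

Lemma cons_rVDZ n (a b s : R) (u v : 'rV[R]_n) :
  cons_rV (a, u) + s *: cons_rV (b, v) = cons_rV (a + s * b, u + s *: v).
Proof.
by apply/rowP => i; rewrite !mxE; case: unliftP => //= j _; rewrite !mxE.
Qed.

Lemma rV_cons n (x : 'rV[R]_n.+1) : exists a v, x = cons_rV (a, v).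
Proof. by exists (uncons_rV x).1, (uncons_rV x).2; rewrite -surjective_pairing uncons_rV_cancel. Qed.

Lemma measurable_fun_cons2 n (F : 'rV[R]_n.+1 -> \bar R) :
  measurable_fun [set: 'rV[R]_n.+1] F ->
  measurable_fun [set: measurableTypeR R * 'rV[R]_n] (fun p => F (cons_rV p)).
Proof. by move=> mF; apply: (measurableT_comp mF); exact: measurable_cons_rV. Qed.

Lemma measurable_integral_rV m n (G : measurableTypeR R * 'rV[R]_n -> \bar R) :
  measurable_fun [set: measurableTypeR R * 'rV[R]_n] G -> (forall p, 0 <= G p)%E ->
  measurable_fun [set: measurableTypeR R]
    (fun a => \int[power_measure m n]_v G (a, v))%E.
Proof. by move=> mG G0; exact: (@measurable_fun_fubini_tonelli_F _ _ _ _ _ _ G). Qed.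

Lemma measurable_affine_rV n (c : 'rV[R]_n) (s : R) :
  measurable_fun [set: 'rV[R]_n] (fun x => c + s *: x).
Proof.
apply: measurable_fun_rV => i; under eq_fun do rewrite !mxE.
apply: measurable_funD => //; apply: measurable_funM => //.
exact: measurable_coord.
Qed.

End power_measure.

Section affine_change.
Context {R : realType}.
Variable s : R.
Hypothesis s0 : 0 < s.

(** By uniqueness of Lebesgue measure it is enough to compare it with the rescaled pushforward on
    half-open intervals. *)
Lemma lebesgue_measure_affine (c : R) (A : set (measurableTypeR R)) :
  measurable A ->
  lebesgue_measure A =
  (s%:E * lebesgue_measure ((fun x => c + s * x)%R @^-1` A))%E.
Proof.
move=> mA.
have mphi : @measurable_fun _ _ (measurableTypeR R) (measurableTypeR R)
    setT (fun x => c + s * x)%R.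
  have : measurable_fun [set: R] (fun x => c + s * x)%R.
    by apply: measurable_funD => //; exact: measurable_funM.
  exact.
pose nu : {measure set (measurableTypeR R) -> \bar R} :=
  measure_function_pushforward__canonical__measure_function_Measure
    (@lebesgue_measure R) mphi.
pose k : {nonneg R} := NngNum (ltW s0).
rewrite (@lebesgue_measure_unique _ (mscale k nu))//.
move=> _ [[a b]] _ <-/=.
rewrite /pushforward/= -[RHS]/(s%:E * lebesgue_measure
  ((fun x => c + s * x)%R @^-1` `]a, b]%classic))%E.
rewrite (_ : _ @^-1` _ = `](a - c) / s, (b - c) / s]%classic); last first.
  apply/seteqP; split => x /=; rewrite !in_itv/= ltr_pdivrMr// ler_pdivlMr//.
    by rewrite mulrC ltrBlDl lerBrDl.
  by rewrite mulrC ltrBlDl lerBrDl.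
rewrite !lebesgue_measure_itv/= !lte_fin ltr_pM2r ?invr_gt0// ltrD2r.
case: ifPn => _; last by rewrite mule0.
rewrite -!EFinD -EFinM; congr (_%:E); field.
by rewrite gt_eqF.
Qed.

Lemma ge0_integral_lebesgue_affine (c : R) (F : measurableTypeR R -> \bar R) :
  measurable_fun [set: measurableTypeR R] F -> (forall x, 0 <= F x)%E ->
  (\int[lebesgue_measure]_x F x =
   s%:E * \int[lebesgue_measure]_x F (c + s * x)%R)%E.
Proof.
move=> mF F0.
have mphi : @measurable_fun _ _ (measurableTypeR R) (measurableTypeR R)
    setT (fun x => c + s * x)%R.
  have : measurable_fun [set: R] (fun x => c + s * x)%R.
    by apply: measurable_funD => //; exact: measurable_funM.
  exact.
pose nu : {measure set (measurableTypeR R) -> \bar R} :=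
  measure_function_pushforward__canonical__measure_function_Measure
    (@lebesgue_measure R) mphi.
pose k : {nonneg R} := NngNum (ltW s0).
transitivity (\int[mscale k nu]_x F x)%E.
  apply: eq_measure_integral => A mA _.
  by rewrite [LHS](lebesgue_measure_affine c mA).
rewrite ge0_integral_mscale//.
by rewrite [X in (_ * X)%E](ge0_integral_pushforward mphi)// preimage_setT.
Qed.

(** The map acts coordinatewise, so induction on the dimension with Tonelli's theorem contributes
    one factor [s] per coordinate. *)
Lemma ge0_integral_lebesgue_rV_affine n (c : 'rV[R]_n) (F : 'rV[R]_n -> \bar R) :
  measurable_fun [set: 'rV[R]_n] F -> (forall x, 0 <= F x)%E ->
  (\int[lebesgue_rV n]_x F x =
   (s ^+ n)%:E * \int[lebesgue_rV n]_x F (c + s *: x)%R)%E.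
Proof.
elim: n c F => [|n IHn] c F mF F0.
  rewrite /lebesgue_rV !ge0_integral_power_measure0//; last first.
    exact: (measurableT_comp mF (measurable_affine_rV _ _)).
  by rewrite expr0 mul1e; congr F; apply/rowP => -[].
have [c0 [c' ->]] := rV_cons c.
have mFc b : measurable_fun [set: 'rV[R]_n] (fun v => F (cons_rV (b, v))).
  exact: measurable_fun_cons_r.
rewrite /lebesgue_rV !ge0_integral_power_measureS//; last first.
  exact: (measurableT_comp mF (measurable_affine_rV _ _)).
have mG : measurable_fun [set: measurableTypeR R]
    (fun a => \int[lebesgue_rV n]_v F (cons_rV (a, c' + s *: v)%R))%E.
  apply: (measurable_integral_rV lebesgue_measure
    (G := fun p => F (cons_rV (p.1, c' + s *: p.2)%R))).
    apply: (measurableT_comp mF).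
    apply: (measurableT_comp (@measurable_cons_rV R n)).
    apply: measurable_fun_pair => //=.
    exact: (measurableT_comp (measurable_affine_rV _ _) measurable_snd).
  by move=> p; exact: F0.
have G0 a : (0 <= \int[lebesgue_rV n]_v F (cons_rV (a, c' + s *: v)%R))%E.
  by apply: integral_ge0.
transitivity (\int[lebesgue_measure]_a ((s ^+ n)%:E *
    \int[lebesgue_rV n]_v F (cons_rV (a, c' + s *: v)%R)))%E.
  by apply: eq_integral => a _; exact: (IHn c').
rewrite ge0_integralZl; first last.
- by rewrite lee_fin exprn_ge0// ltW.
- by move=> x _; exact: G0.
- exact: mG.
- exact: measurableT.
rewrite (ge0_integral_lebesgue_affine c0 mG G0).
rewrite muleA -EFinM -exprSr; congr (_ * _)%E.
apply: eq_integral => a _; apply: eq_integral => v _.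
by rewrite cons_rVDZ.
Qed.

End affine_change.

Section gaussian.
Context {R : realType}.

(** The centre [c] is a parameter because the conditional law of one correlated point given the
    other is a Gaussian centred away from the origin. *)
Definition gauss_pdf n (c : 'rV[R]_n) (s : R) (x : 'rV[R]_n) : R :=
  \prod_(i < n) normal_pdf (c ord0 i) s (x ord0 i).

Lemma gauss_pdf_ge0 n (c : 'rV[R]_n) s x : 0 <= gauss_pdf c s x.
Proof. by apply: prodr_ge0 => i _; exact: normal_pdf_ge0. Qed.

Lemma measurable_gauss_pdf n (c : 'rV[R]_n) s :
  measurable_fun [set: 'rV[R]_n] (gauss_pdf c s).
Proof.
apply: measurable_prod => i _.
exact: (measurableT_comp (measurable_normal_pdf _ _) (measurable_coord i)).
Qed.

Lemma emeasurable_gauss_pdf n (c : 'rV[R]_n) s :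
  measurable_fun [set: 'rV[R]_n] (fun x => (gauss_pdf c s x)%:E).
Proof. by apply/measurable_EFinP; exact: measurable_gauss_pdf. Qed.

Lemma gauss_pdf_cons n a (c : 'rV[R]_n) s b (x : 'rV[R]_n) :
  gauss_pdf (cons_rV (a, c)) s (cons_rV (b, x)) =
  normal_pdf a s b * gauss_pdf c s x.
Proof.
rewrite /gauss_pdf big_ord_recl !cons_rV0; congr (_ * _).
by apply: eq_bigr => i _; rewrite !cons_rVS.
Qed.

Lemma ge0_integral_normal_prob (c s : R) (F : measurableTypeR R -> \bar R) :
  measurable_fun [set: measurableTypeR R] F -> (forall x, 0 <= F x)%E ->
  (\int[normal_prob c s]_x F x =
   \int[lebesgue_measure]_x (F x * (normal_pdf c s x)%:E))%E.
Proof.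
move=> mF F0; apply: ge0_integral_density => //.
  exact: measurable_normal_pdf.
by move=> x; exact: normal_pdf_ge0.
Qed.

Lemma ge0_integral_gaussian_rV n (s : R) (F : 'rV[R]_n -> \bar R) :
  measurable_fun [set: 'rV[R]_n] F -> (forall x, 0 <= F x)%E ->
  (\int[gaussian_rV n s]_x F x =
   \int[lebesgue_rV n]_x (F x * (gauss_pdf 0 s x)%:E))%E.
Proof.
elim: n F => [|n IHn] F mF F0.
  have mF' : measurable_fun [set: 'rV[R]_0] (fun x => F x * (gauss_pdf 0 s x)%:E)%E.
    exact: emeasurable_funM mF (emeasurable_gauss_pdf _ _).
  rewrite /gaussian_rV /lebesgue_rV !ge0_integral_power_measure0//.
  by rewrite /gauss_pdf big_ord0 mule1.
have mF' : measurable_fun [set: 'rV[R]_n.+1] (fun x => F x * (gauss_pdf 0 s x)%:E)%E.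
  exact: emeasurable_funM mF (emeasurable_gauss_pdf _ _).
have F'0 x : (0 <= F x * (gauss_pdf 0 s x)%:E)%E.
  by rewrite mule_ge0// lee_fin gauss_pdf_ge0.
rewrite /gaussian_rV /lebesgue_rV !ge0_integral_power_measureS//.
rewrite ge0_integral_normal_prob; last 2 first.
- apply: (measurable_integral_rV (normal_prob 0 s) (G := fun p => F (cons_rV p))) => //.
  exact: measurable_fun_cons2.
- by move=> a; exact: integral_ge0.
apply: eq_integral => a _.
rewrite [X in (X * _)%E]IHn//; last exact: measurable_fun_cons_r.
rewrite -ge0_integralZr//=; last 3 first.
- apply: emeasurable_funM; first exact: measurable_fun_cons_r.
  exact: emeasurable_gauss_pdf.
- by move=> v _; rewrite mule_ge0// lee_fin gauss_pdf_ge0.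
- by rewrite lee_fin normal_pdf_ge0.
apply: eq_integral => v _.
have -> : (0 : 'rV[R]_n.+1) = cons_rV (0, 0).
  by apply/rowP => i; rewrite !mxE; case: unliftP => //= j; rewrite mxE.
by rewrite gauss_pdf_cons mulrC EFinM muleA.
Qed.

Lemma normal_pdf_affine (c s z : R) : 0 < s ->
  s * normal_pdf c s (c + s * z) = normal_pdf 0 1 z.
Proof.
move=> s0; have sn0 : s != 0 by rewrite gt_eqF.
rewrite !normal_pdfE ?oner_neq0// mulrA; congr (_ * _).
  rewrite /normal_peak expr1n mul1r -mulrnAr sqrtrM ?sqr_ge0// sqrtr_sqr gtr0_norm//.
  by rewrite invfM mulrA divff// mul1r.
rewrite /normal_fun addrC addKr subr0 exprMn expr1n; congr expR.
by field.
Qed.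

(** The Jacobian [s ^+ n] of the affine substitution is absorbed by the normalising constants of the
    density, one [s] per coordinate. With [c := rho *: y] this identifies the conditional density
    inside the Mehler kernel. *)
Lemma ge0_integral_gauss_pdf n (c : 'rV[R]_n) (s : R) (F : 'rV[R]_n -> \bar R) :
  0 < s -> measurable_fun [set: 'rV[R]_n] F -> (forall x, 0 <= F x)%E ->
  (\int[lebesgue_rV n]_x (F x * (gauss_pdf c s x)%:E) =
   \int[gaussian_rV n 1]_z F (c + s *: z)%R)%E.
Proof.
move=> s0 mF F0.
have mFc : measurable_fun [set: 'rV[R]_n] (fun z => F (c + s *: z)).
  exact: (measurableT_comp mF (measurable_affine_rV _ _)).
rewrite (ge0_integral_gaussian_rV _ mFc); last by move=> x; exact: F0.
rewrite (ge0_integral_lebesgue_rV_affine s0 c); last 2 first.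
- exact: emeasurable_funM mF (emeasurable_gauss_pdf _ _).
- by move=> x; rewrite mule_ge0// lee_fin gauss_pdf_ge0.
rewrite -ge0_integralZl; last 4 first.
- exact: measurableT.
- apply: (emeasurable_funM mFc).
  exact: (measurableT_comp (emeasurable_gauss_pdf _ _) (measurable_affine_rV _ _)).
- by move=> v _; rewrite mule_ge0// lee_fin gauss_pdf_ge0.
- by rewrite lee_fin exprn_ge0// ltW.
apply: eq_integral => z _; rewrite muleCA -EFinM; congr (_ * _%:E)%E.
rewrite /gauss_pdf -[in s ^+ n](card_ord n) -prodr_const -big_split/=.
by apply: eq_bigr => i _; rewrite !mxE normal_pdf_affine.
Qed.

Lemma ge0_integral_gaussian_rV_scale n (s : R) (F : 'rV[R]_n -> \bar R) :
  0 < s -> measurable_fun [set: 'rV[R]_n] F -> (forall x, 0 <= F x)%E ->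
  (\int[gaussian_rV n s]_x F x = \int[gaussian_rV n 1]_z F (s *: z)%R)%E.
Proof.
move=> s0 mF F0.
rewrite (ge0_integral_gaussian_rV s mF F0) (ge0_integral_gauss_pdf _ s0 mF F0).
by under eq_integral do rewrite add0r.
Qed.

(** The type of [gaussian_rV] only records sigma-finiteness; the total mass is recovered from the
    product formula on the full box. *)
Lemma gaussian_rV_setT n (s : R) : gaussian_rV n s [set: 'rV[R]_n] = 1%E.
Proof.
rewrite (_ : [set: 'rV[R]_n] = [set x : 'rV[R]_n | forall i : 'I_n,
    [set: measurableTypeR R] (x ord0 i)]); last by apply/seteqP; split.
rewrite [LHS](power_measureE (normal_prob 0 s) (A := fun=> setT))//.
by rewrite big1// => i _; exact: probability_setT.
Qed.

End gaussian.

(** * Product test functions *)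

Section smooth.
Context {R : realType}.
Implicit Types (f g : R -> R) (k : nat).

(** The derivative is an existential witness, so that the product and chain rules can supply it
    directly. Continuity at successor levels follows from derivability, whereas [Ck] asserts it. *)
Fixpoint C1 (k : nat) (f : R -> R) : Prop :=
  if k is k'.+1 then exists f' : R -> R,
    (forall x : R, is_derive x 1 f (f' x)) /\ C1 k' f'
  else continuous f.

Definition smooth f := forall k, C1 k f.

Lemma is_derive1_continuous f (f' : R -> R) :
  (forall x : R, is_derive x 1 f (f' x)) -> continuous f.
Proof.
move=> df x; apply/differentiable_continuous/derivable1_diffP.
by case: (df x).
Qed.

Lemma C1W k f : C1 k.+1 f -> C1 k f.
Proof.
elim: k f => [|k IHk] f [f' [df Cf']]; first exact: is_derive1_continuous df.
by exists f'; split => //; exact: IHk.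
Qed.

Lemma C1_continuous k f : C1 k f -> continuous f.
Proof. by elim: k => // k IHk /C1W. Qed.

Lemma C1_cst k (c : R) : C1 k (fun=> c).
Proof.
elim: k c => [|k IHk] c; first by move=> x; exact: cvg_cst.
by exists (fun=> 0); split=> // x; exact: is_derive_cst.
Qed.

Lemma C1D k f g : C1 k f -> C1 k g -> C1 k (fun x => f x + g x).
Proof.
elim: k f g => [|k IHk] f g.
  by move=> cf cg x; apply: cvgD; [exact: cf|exact: cg].
move=> [f' [df Cf']] [g' [dg Cg']]; exists (fun x => f' x + g' x); split.
  by move=> x; exact: is_deriveD.
exact: IHk.
Qed.

Lemma C1M k f g : C1 k f -> C1 k g -> C1 k (fun x => f x * g x).
Proof.
elim: k f g => [|k IHk] f g.
  by move=> cf cg x; apply: cvgM; [exact: cf|exact: cg].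
move=> Cf Cg; have Cf1 := C1W Cf; have Cg1 := C1W Cg.
case: Cf Cg => [f' [df Cf']] [g' [dg Cg']].
exists (fun x => f x * g' x + g x * f' x); split.
  by move=> x; exact: is_deriveM.
by apply: C1D; exact: IHk.
Qed.

Lemma C1_id k : C1 k id.
Proof.
case: k => [|k]; first by move=> x; exact: cvg_id.
by exists (fun=> 1); split; [move=> x; exact: is_derive_id | exact: C1_cst].
Qed.

Lemma is_derive1_affine (a b x : R) : is_derive x 1 (fun t => a + b * t) b.
Proof.
apply: is_derive_eq.
by rewrite add0r mul1r /GRing.scale/= mulr1.
Qed.

Lemma C1_affine k (a b : R) : C1 k (fun t => a + b * t).
Proof. by apply: C1D; [exact: C1_cst|apply: C1M; [exact: C1_cst|exact: C1_id]]. Qed.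

Lemma C1_comp_affine k f (a b : R) : C1 k f -> C1 k (fun x => f (a + b * x)).
Proof.
elim: k f => [|k IHk] f.
  move=> cf x; apply: continuous_comp; last exact: cf.
  exact: (C1_continuous (@C1_affine 0 a b)).
move=> [f' [df Cf']]; exists (fun x => f' (a + b * x) * b); split.
  by move=> x; exact: (is_derive1_comp (df _) (is_derive1_affine a b x)).
by apply: C1M; [exact: IHk|exact: C1_cst].
Qed.

(** Bootstrapping on f' = p f: if f is k times differentiable then so is p f, hence f gains one
    order. This gives the smoothness of Gaussian factors, whose logarithmic derivative is affine. *)
Lemma smooth_logderive f p : (forall x : R, is_derive x 1 f (p x * f x)) ->
  smooth p -> smooth f.
Proof.
move=> df sp; elim=> [|k IHk]; first exact: is_derive1_continuous df.
by exists (fun x => p x * f x); split=> //; exact: C1M.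
Qed.

End smooth.

(** * A smooth compactly supported bump on the line *)

Section bump.
Context {R : realType}.
Implicit Types (p : {poly R}) (x t : R).

Lemma poly_expRN_bound p :
  exists2 C, 0 <= C & forall t, 0 <= t -> `|p.[t]| * expR (- t) <= C.
Proof.
exists (\sum_(i < size p) `|p`_i| * i`!%:R).
  by apply: sumr_ge0 => i _; rewrite mulr_ge0.
move=> t t0; rewrite horner_coef.
apply: (@le_trans _ _ ((\sum_(i < size p) `|p`_i * t ^+ i|) * expR (- t))).
  by rewrite ler_wpM2r ?expR_ge0// ler_norm_sum.
rewrite mulr_suml; apply: ler_sum => i _.
rewrite normrM -mulrA ler_wpM2l// ger0_norm ?exprn_ge0//.
rewrite expRN ler_pdivrMr ?expR_gt0//.
case: (nat_of_ord i) => [|m].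
  by rewrite expr0 fact0 mul1r -[leLHS]expR0 ler_expR.
rewrite mulrC -ler_pdivrMr ?ltr0n ?fact_gt0//.
apply: le_trans (expR_ge1Dxn m t0); first by rewrite lerDr.
Qed.

Definition flat p x : R := if 0 < x then p.[x^-1] * expR (- x^-1) else 0.

(** Boundedness for the polynomial [p * 'X^2] is quadratic decay for [p]; this forces the derivative
    at the origin to be 0. *)
Lemma flat_le_sqr p : exists2 C, 0 <= C & forall x, `|flat p x| <= C * x ^+ 2.
Proof.
have [C C0 hC] := poly_expRN_bound (p * 'X^2).
exists C => // x; rewrite /flat; case: ltP => x0; last first.
  by rewrite normr0 mulr_ge0 ?sqr_ge0.
rewrite -ler_pdivrMr ?exprn_gt0//.
have := hC x^-1; rewrite invr_ge0 ltW// => /(_ isT); apply: le_trans.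
rewrite !normrM hornerM hornerXn normrM (ger0_norm (expR_ge0 _)).
by rewrite (ger0_norm (sqr_ge0 _)) exprVn mulrAC.
Qed.

Lemma is_derive_flat p x :
  is_derive x 1 (flat p) (flat ('X^2 * (p - p^`())) x).
Proof.
have [x0|x0|->] := ltgtP x 0.
- rewrite {2}/flat ltNge (ltW x0)/=.
  have := is_derive_cst (0 : R) x 1; apply: near_eq_is_derive.
  near=> y; rewrite /flat ltNge ltW//=.
  by near: y; exact: lt_nbhsl.
- rewrite {2}/flat x0.
  have xn0 : x != 0 by rewrite gt_eqF.
  have dinv : is_derive x 1 (fun y : R => y^-1) (- x ^- 2).
    apply: (is_derive_eq (is_deriveV xn0 (is_derive_id x 1))).
    by rewrite /GRing.scale/= mulr1.
  have d1 := is_derive1_comp (is_derive_poly p x^-1) dinv.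
  have dN : is_derive x 1 (fun y : R => - y^-1) (- - x ^- 2) by exact: is_deriveN.
  have d2 := is_derive1_comp (f := expR) (is_derive_expR _) dN.
  have : is_derive x 1 (fun y : R => p.[y^-1] * expR (- y^-1))
      (('X^2 * (p - p^`())).[x^-1] * expR (- x^-1)); last first.
    apply: near_eq_is_derive; near=> y; rewrite /flat ifT//.
    by near: y; exact: lt_nbhsr.
  apply: (is_derive_eq (is_deriveM d1 d2)).
  rewrite /GRing.scale/= !hornerE/= exprVn.
  by ring.
rewrite {2}/flat ltxx.
have [C C0 hC] := flat_le_sqr p.
have lim0 : h^-1 *: (flat p (h *: (1:R) + 0) - flat p 0) @[h --> 0^'] --> (0 : R).
  apply/cvgrPdist_lt => e e0; near=> h.
  have hn0 : h != 0 by near: h; exact: nbhs_dnbhs_neq.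
  rewrite sub0r normrN /GRing.scale/= mulr1 addr0 {2}/flat ltxx subr0 normrM normfV.
  rewrite mulrC ltr_pdivrMr ?normr_gt0//.
  apply: le_lt_trans (hC h) _.
  rewrite -real_normK ?num_real// expr2 mulrA ltr_pM2r ?normr_gt0//.
  (* [C] may be 0, so [C + 1] is used as the divisor. *)
  apply: (@le_lt_trans _ _ ((C + 1) * `|h|)).
    by rewrite ler_wpM2r// lerDl.
  rewrite mulrC -ltr_pdivlMr ?ltr_wpDl//.
  by near: h; apply: dnbhs0_lt; rewrite divr_gt0// ltr_wpDl.
apply: DeriveDef; first by apply/cvg_ex; exists 0.
exact: cvg_lim lim0.
Unshelve. all: by end_near. Qed.

Lemma smooth_flat p : smooth (flat p).
Proof.
move=> k; elim: k p => [|k IHk] p.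
  exact: is_derive1_continuous (is_derive_flat p).
by exists (flat ('X^2 * (p - p^`()))); split => //; exact: is_derive_flat.
Qed.

Lemma flat_bound p : exists2 C, 0 <= C & forall x, `|flat p x| <= C.
Proof.
have [C C0 hC] := poly_expRN_bound p; exists C => // x; rewrite /flat.
case: ltP => x0; last by rewrite normr0.
by rewrite normrM (ger0_norm (expR_ge0 _)) hC// invr_ge0 ltW.
Qed.

(** Each factor vanishes on one side of [[-1, 1]] and equals [expR (- 1)] at the origin, so [expR 2]
    normalises the value there to 1. The arguments have the shape [a + b * x] of the affine
    composition lemma. *)
Definition bumpR x := expR 2 * (flat 1 (1 + 1 * x) * flat 1 (1 + (- 1) * x)).

Definition dbumpR x := expR 2 *
  (flat 1 (1 + 1 * x) * (flat ('X^2 * (1 - 1^`())) (1 + (- 1) * x) * (- 1)) +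
   flat 1 (1 + (- 1) * x) * (flat ('X^2 * (1 - 1^`())) (1 + 1 * x) * 1)).

Lemma smooth_bumpR : smooth bumpR.
Proof.
move=> k; apply: C1M; first exact: C1_cst.
by apply: C1M; apply: C1_comp_affine; exact: smooth_flat.
Qed.

Lemma is_derive_bumpR x : is_derive x 1 bumpR (dbumpR x).
Proof.
have d1 := is_derive1_comp (is_derive_flat 1 _) (is_derive1_affine 1 1 x).
have d2 := is_derive1_comp (is_derive_flat 1 _) (is_derive1_affine 1 (- 1) x).
exact: (is_deriveZ (expR 2) (is_deriveM d1 d2)).
Qed.

Lemma continuous_dbumpR : continuous dbumpR.
Proof.
suff : C1 0 dbumpR by [].
apply: C1M; first exact: C1_cst.
apply: C1D; (apply: C1M; first by apply: C1_comp_affine; exact: smooth_flat);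
  (apply: C1M; last exact: C1_cst); by apply: C1_comp_affine; exact: smooth_flat.
Qed.

Lemma bumpR0 : bumpR 0 = 1.
Proof.
have h1 : (1 : {poly R}).[1] = 1 by rewrite -polyC1 hornerC.
rewrite /bumpR !mulr0 !addr0 /flat ltr01 invr1 h1 mul1r -!expRD.
by rewrite (_ : _ + _ = 0) ?expR0//; lra.
Qed.

Lemma bumpR_out x : 1 <= `|x| -> bumpR x = 0.
Proof.
rewrite ler_normr /bumpR /flat; case/orP => x1.
  by rewrite [X in _ * (_ * X)]ifF ?mulr0//; apply/negbTE; rewrite -leNgt; lra.
by rewrite [X in _ * (X * _)]ifF ?mul0r ?mulr0//; apply/negbTE; rewrite -leNgt; lra.
Qed.

Lemma bumpR_bound : exists2 B, 0 <= B & forall x, `|bumpR x| <= B /\ `|dbumpR x| <= B.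
Proof.
have [C C0 hC] := flat_bound 1.
have [D D0 hD] := flat_bound ('X^2 * (1 - 1^`())).
(* [C * C] accounts for the bump and the two terms [C * D] for the product rule in its derivative;
   the sum bounds both at once. *)
exists (expR 2 * (C * C + 2 * (C * D))).
  by rewrite mulr_ge0 ?expR_ge0// addr_ge0 ?mulr_ge0.
move=> x; rewrite /bumpR /dbumpR !normrM (ger0_norm (expR_ge0 _)).
have CD0 : 0 <= C * D by rewrite mulr_ge0.
have CC0 : 0 <= C * C by rewrite mulr_ge0.
split; rewrite ler_wpM2l ?expR_ge0//.
  apply: (@le_trans _ _ (C * C)); last by lra.
  by rewrite ler_pM.
rewrite (le_trans (ler_normD _ _))// !normrM normrN normr1 !mulr1.
apply: (@le_trans _ _ (C * D + C * D)); last by lra.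
by rewrite lerD// ler_pM.
Qed.

End bump.

Section tensor.
Context {R : realType} (n : nat).
Implicit Types (theta : 'I_n -> R -> R) (x : 'rV[R]_n).

Definition tensor theta x : R := \prod_(i < n) theta i (x ord0 i).

Lemma tensor_replace theta j (f : R -> R) x :
  tensor (fun k => if k == j then f else theta k) x =
  f (x ord0 j) * \prod_(k < n | k != j) theta k (x ord0 k).
Proof.
rewrite /tensor (bigD1 j)//= eqxx; congr (_ * _).
by apply: eq_bigr => k /negbTE ->.
Qed.

(** Along the j-th basis vector only the j-th factor moves, so the difference quotient is literally
    a one-variable quotient times a constant. *)
Lemma is_derive_tensor theta j x (d : R) :
  is_derive (x ord0 j) 1 (theta j) d ->
  is_derive x (delta_mx ord0 j) (tensor theta)
    (d * \prod_(k < n | k != j) theta k (x ord0 k)).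
Proof.
move=> dt; set c := \prod_(k < n | _) _.
have Et : (fun h : R => h^-1 *: (tensor theta (h *: delta_mx ord0 j + x) - tensor theta x)) =
    (fun h => h^-1 *: (theta j (h *: (1 : R) + x ord0 j) * c - theta j (x ord0 j) * c)).
  apply/funext => h; congr (_ *: (_ - _)); rewrite /tensor (bigD1 j)//=; congr (_ * _).
    by rewrite !mxE !eqxx.
  by apply: eq_bigr => k /negbTE kj; rewrite !mxE kj mulr0 add0r.
have [/= dg dgE] : is_derive (x ord0 j) 1 (fun t => theta j t * c) (d * c).
  apply: (is_derive_eq (is_deriveM dt (is_derive_cst c _ _))).
  by rewrite scaler0 add0r /GRing.scale/= mulrC.
apply: DeriveDef; first by rewrite /derivable Et.
by rewrite -dgE /derive Et.
Qed.

Lemma continuous_tensor theta : (forall i, continuous (theta i)) ->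
  continuous (tensor theta).
Proof.
move=> ct; rewrite /tensor; elim: (index_enum _) => [|i s IHs] x.
  rewrite (_ : (fun _ => _) = cst 1); last by apply/funext => y; rewrite big_nil.
  exact: cst_continuous.
rewrite (_ : (fun _ => _) = (fun y : 'rV[R]_n => theta i (y ord0 i) *
    \prod_(j <- s) theta j (y ord0 j))); last by apply/funext => y; rewrite big_cons.
apply: continuousM; last exact: IHs.
apply: (@continuous_comp _ _ _ (fun y : 'rV[R]_n => y ord0 i) (theta i)).
  exact: coord_continuous.
exact: ct.
Qed.

(** A partial derivative of a product function is a product function with one factor replaced, so
    the induction stays inside the class. *)
Lemma Ck_tensor k theta : (forall i, C1 k (theta i)) -> Ck k (tensor theta).
Proof.
elim: k theta => [|k IHk] theta Ct; first exact: continuous_tensor.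
split; first by apply: continuous_tensor => i; exact: C1_continuous (Ct i).
move=> i; have [t' [dt Ct']] := Ct i.
have dT x := is_derive_tensor (dt (x ord0 i)).
split; first by move=> x; case: (dT x).
rewrite (_ : 'D_(delta_mx ord0 i) (tensor theta) =
    tensor (fun k => if k == i then t' else theta k)).
  by apply: IHk => k'; case: eqP => // _; exact: C1W.
by apply/funext => x; rewrite tensor_replace; case: (dT x).
Qed.

Lemma compact_box (r : R) :
  compact [set x : 'rV[R]_n | forall i, `|x ord0 i| <= r].
Proof.
have := @rV_compact R n (fun=> `[- r, r]%classic) (fun=> @segment_compact _ _ _).
congr compact; apply/seteqP; split => x /= h i; have := h i;
  by rewrite /= in_itv/= ler_norml.
Qed.

Lemma test_function_tensor (r : R) theta : (forall i, smooth (theta i)) ->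
  (forall i t, r <= `|t| -> theta i t = 0) -> test_function (tensor theta).
Proof.
move=> st t0; split; first by move=> k; apply: Ck_tensor => i; exact: st.
apply: (subclosed_compact (@closed_closure _ _) (@compact_box r)).
have cB : closed [set x : 'rV[R]_n | forall i, `|x ord0 i| <= r].
  exact: compact_closed (@norm_hausdorff _ _) (@compact_box r).
rewrite ((closure_id _).1 cB); apply: closure_subset => x /= tx i.
rewrite leNgt; apply/negP => rx; move/eqP: tx; apply.
by rewrite /tensor (bigD1 i)//= t0 ?mul0r// ltW.
Qed.

End tensor.

(** * The Mehler kernel *)

Section real_density.
Context d (T : measurableType d) (R : realType).
Variables (mu nu : {measure set T -> \bar R}) (p : T -> R).
Hypotheses (mp : measurable_fun [set: T] p) (p0 : forall x, 0 <= p x).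
Hypothesis nuE : forall f : T -> \bar R, measurable_fun [set: T] f ->
  (forall x, 0 <= f x)%E -> (\int[nu]_x f x = \int[mu]_x (f x * (p x)%:E))%E.

Lemma integrable_density (f : T -> R) : measurable_fun [set: T] f ->
  nu.-integrable setT (EFin \o f) <->
  mu.-integrable setT (fun x => (f x * p x)%:E).
Proof.
move=> mf.
have mfE : measurable_fun [set: T] (fun x => `|f x|%:E).
  by apply/measurable_EFinP; exact: measurableT_comp.
have E : (\int[nu]_x `|(EFin \o f) x| = \int[mu]_x `|(f x * p x)%:E|)%E.
  rewrite (_ : (fun x => _) = (fun x => `|f x|%:E)); last by [].
  rewrite nuE//.
  by apply: eq_integral => x _; rewrite /= normrM (ger0_norm (p0 x)) EFinM.
split => /integrableP[_ foo]; apply/integrableP; split.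
- by apply/measurable_EFinP; exact: measurable_funM.
- by rewrite -E.
- by apply/measurable_EFinP.
- by rewrite E.
Qed.

(** Since [p] is nonnegative, multiplication by it commutes with taking positive and negative
    parts. *)
Lemma integral_density (f : T -> R) : measurable_fun [set: T] f ->
  (\int[nu]_x (f x)%:E = \int[mu]_x (f x * p x)%:E)%E.
Proof.
move=> mf; have mfE : measurable_fun [set: T] (EFin \o f) by exact/measurable_EFinP.
rewrite [LHS]integralE [RHS]integralE; congr (_ - _)%E.
  rewrite nuE//; last exact: measurable_funepos.
  apply: eq_integral => x _; rewrite !funeposE -!EFin_max -EFinM; congr EFin.
  by rewrite maxr_pMl// mul0r.
rewrite nuE//; last exact: measurable_funeneg.
apply: eq_integral => x _; rewrite !funenegE -!EFinN -!EFin_max -EFinM; congr EFin.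
by rewrite maxr_pMl// mul0r mulNr.
Qed.

Lemma Rintegral_density (f : T -> R) : measurable_fun [set: T] f ->
  \int[nu]_x f x = \int[mu]_x (f x * p x).
Proof. by move=> mf; rewrite /Rintegral integral_density. Qed.

End real_density.

Section mehler.
Context {R : realType} (n : nat) (rho : R).
Hypothesis rho01 : 0 < rho < 1.
Notation lam := (@lebesgue_rV R n).
Notation gam := (@gaussian_rV R n 1).

(** The conditional standard deviation of one standard Gaussian given another with correlation
    [r]. *)
Definition mehler_sd (r : R) : R := Num.sqrt (1 - r ^+ 2).
Notation s := (mehler_sd rho).

Lemma mehler_sd_gt0 : 0 < s.
Proof. by rewrite sqrtr_gt0; move: rho01; nra. Qed.

Lemma mehler_sd_sqr : s ^+ 2 = 1 - rho ^+ 2.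
Proof. by rewrite sqr_sqrtr//; move: rho01; nra. Qed.

(** The joint density, written as the law of [b] times the conditional law of [a]: this form yields
    the marginal in [b] and the sampling map, while the symmetry is recovered separately. *)
Definition mehler_ker1 (a b : R) : R := normal_pdf 0 1 b * normal_pdf (rho * b) s a.

(** Completing the square with [s ^+ 2 = 1 - rho ^+ 2] makes the exponent symmetric in [a] and
    [b]. *)
Lemma mehler_ker1E a b : mehler_ker1 a b = normal_peak 1 * normal_peak s *
  expR (- (a ^+ 2 + b ^+ 2 - 2 * rho * a * b) / (2 * s ^+ 2)).
Proof.
have s0 := mehler_sd_gt0; have sn0 : s != 0 by rewrite gt_eqF.
rewrite /mehler_ker1 !normal_pdfE ?oner_neq0// mulrACA; congr (_ * _).
rewrite /normal_fun -expRD; congr expR.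
rewrite expr1n subr0 -[s ^+ 2 *+ 2]mulr_natr.
have h : 2 * s ^+ 2 != 0 by rewrite mulf_neq0// expf_neq0.
apply: (mulIf h); rewrite divfK// mulrDl.
rewrite (_ : - b ^+ 2 / 2 * (2 * s ^+ 2) = - b ^+ 2 * s ^+ 2); last by field.
rewrite (_ : - (a - rho * b) ^+ 2 / (s ^+ 2 * 2) * (2 * s ^+ 2) = - (a - rho * b) ^+ 2); last by field.
by rewrite mehler_sd_sqr; ring.
Qed.

Lemma mehler_ker1C a b : mehler_ker1 a b = mehler_ker1 b a.
Proof.
rewrite !mehler_ker1E.
by have -> : a ^+ 2 + b ^+ 2 - 2 * rho * a * b = b ^+ 2 + a ^+ 2 - 2 * rho * b * a by ring.
Qed.

Lemma is_derive_mehler_ker1 (a b : R) :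
  is_derive a 1 (mehler_ker1 ^~ b) (- (a - rho * b) / s ^+ 2 * mehler_ker1 a b).
Proof.
have s0 := mehler_sd_gt0; have sn0 : s != 0 by rewrite gt_eqF.
have dq : is_derive a 1 (fun t => - (t ^+ 2 + b ^+ 2 - 2 * rho * t * b) / (2 * s ^+ 2))
    (- (a - rho * b) / s ^+ 2).
  apply: is_derive_eq.
  rewrite /GRing.scale/=; field; exact: sn0.
have := is_deriveZ (normal_peak 1 * normal_peak s) (is_derive1_comp (is_derive_expR _) dq).
rewrite (_ : _ \*: _ = mehler_ker1 ^~ b); last by apply/funext => t; rewrite mehler_ker1E.
by move=> h; apply: (is_derive_eq h); rewrite mehler_ker1E /GRing.scale/=; ring.
Qed.

Lemma smooth_mehler_ker1 b : smooth (mehler_ker1 ^~ b).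
Proof.
apply: (smooth_logderive (p := fun a => rho * b / s ^+ 2 + (- (s ^+ 2)^-1) * a)).
  move=> a; apply: (is_derive_eq (is_derive_mehler_ker1 a b)); congr (_ * _); ring.
by move=> k; exact: C1_affine.
Qed.

Lemma mehler_ker1_ge0 a b : 0 <= mehler_ker1 a b.
Proof. by rewrite mulr_ge0// normal_pdf_ge0. Qed.

Lemma mehler_ker1_ub a b : mehler_ker1 a b <= normal_peak 1 * normal_peak s.
Proof.
have s0 := mehler_sd_gt0; have sn0 : s != 0 by rewrite gt_eqF.
by rewrite ler_pM ?normal_pdf_ge0 ?normal_pdf_ub ?oner_neq0.
Qed.

Definition mehler_ker (x y : 'rV[R]_n) : R := \prod_(i < n) mehler_ker1 (x ord0 i) (y ord0 i).

Lemma mehler_kerC x y : mehler_ker x y = mehler_ker y x.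
Proof. by apply: eq_bigr => i _; exact: mehler_ker1C. Qed.

Lemma mehler_kerE x y : mehler_ker x y = gauss_pdf 0 1 y * gauss_pdf (rho *: y) s x.
Proof.
by rewrite /mehler_ker big_split/=; congr (_ * _); apply: eq_bigr => i _; rewrite mxE.
Qed.

Lemma mehler_ker_ge0 x y : 0 <= mehler_ker x y.
Proof. by apply: prodr_ge0 => i _; exact: mehler_ker1_ge0. Qed.

(** A bound uniform in both points: multiplying by the kernel preserves Lebesgue integrability,
    which justifies every later use of Fubini's theorem. *)
Lemma mehler_ker_ub x y : mehler_ker x y <= (normal_peak 1 * normal_peak s) ^+ n.
Proof.
rewrite -[in leRHS](card_ord n) -prodr_const.
by apply: ler_prod => i _; rewrite mehler_ker1_ge0 mehler_ker1_ub.
Qed.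

Lemma measurable_mehler_ker :
  measurable_fun [set: 'rV[R]_n * 'rV[R]_n] (fun p => mehler_ker p.1 p.2).
Proof.
apply: measurable_prod => i _.
have m1 : measurable_fun [set: 'rV[R]_n * 'rV[R]_n] (fun p => p.1 ord0 i).
  exact: (measurableT_comp (measurable_coord i) measurable_fst).
have m2 : measurable_fun [set: 'rV[R]_n * 'rV[R]_n] (fun p => p.2 ord0 i).
  exact: (measurableT_comp (measurable_coord i) measurable_snd).
under eq_fun do rewrite mehler_ker1E.
apply: measurable_funM => //; apply: measurableT_comp => //.
apply: measurable_funM => //; apply: measurableT_comp => //.
apply: measurable_funB; last first.
  by apply: measurable_funM => //; apply: measurable_funM.
by apply: measurable_funD; exact: measurable_funX.
Qed.

(* [(x, y)] is distributed as the pair [(rho y + s z, y)] with [y], [z]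
   independent standard Gaussian vectors. *)
Definition mehler_map (p : 'rV[R]_n * 'rV[R]_n) := (rho *: p.1 + s *: p.2, p.1).

Lemma measurable_mehler_map : measurable_fun setT mehler_map.
Proof.
apply: measurable_fun_pair; last exact: measurable_fst.
apply: measurable_fun_rV => i; under eq_fun do rewrite !mxE.
by apply: measurable_funD; apply: measurable_funM => //;
  [exact: (measurableT_comp (measurable_coord i) measurable_fst)
  |exact: (measurableT_comp (measurable_coord i) measurable_snd)].
Qed.

Definition mehler : {measure set ('rV[R]_n * 'rV[R]_n) -> \bar R} :=
  measure_function_pushforward__canonical__measure_function_Measure
    (gam \x gam)%E measurable_mehler_map.

Lemma ge0_integral_mehler (F : 'rV[R]_n * 'rV[R]_n -> \bar R) :
  measurable_fun setT F -> (forall p, 0 <= F p)%E ->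
  (\int[mehler]_p F p = \int[gam \x gam]_p F (mehler_map p))%E.
Proof.
move=> mF F0.
by rewrite [LHS](ge0_integral_pushforward measurable_mehler_map)// preimage_setT.
Qed.

(** For fixed [y] the substitution [x = rho y + s z] turns the integral over the Gaussian [z] into
    an integral against the conditional density of [x]. *)
Lemma ge0_integral_mehler_density (F : 'rV[R]_n * 'rV[R]_n -> \bar R) :
  measurable_fun setT F -> (forall p, 0 <= F p)%E ->
  (\int[mehler]_p F p = \int[lam \x lam]_p (F p * (mehler_ker p.1 p.2)%:E))%E.
Proof.
move=> mF F0.
have mFm : measurable_fun setT (F \o mehler_map).
  exact: (measurableT_comp mF measurable_mehler_map).
have mFK : measurable_fun setT (fun p => F p * (mehler_ker p.1 p.2)%:E)%E.
  by apply: (emeasurable_funM mF); apply/measurable_EFinP; exact: measurable_mehler_ker.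
rewrite ge0_integral_mehler// fubini_tonelli1//.
rewrite fubini_tonelli2//; last first.
  by move=> p; rewrite mule_ge0// lee_fin mehler_ker_ge0.
rewrite [LHS]ge0_integral_gaussian_rV; last 2 first.
- by apply: measurable_fun_fubini_tonelli_F => // p; exact: F0.
- by move=> y; apply: integral_ge0.
apply: eq_integral => y _; rewrite /fubini_F /fubini_G/=.
have mFy : measurable_fun setT (fun x => F (x, y)).
  exact: (measurableT_comp mF (measurable_pair2 y)).
rewrite -(ge0_integral_gauss_pdf (rho *: y) mehler_sd_gt0 mFy); last by move=> x; exact: F0.
rewrite -ge0_integralZr//; last 3 first.
- by apply: (emeasurable_funM mFy); exact: emeasurable_gauss_pdf.
- by move=> x _; rewrite mule_ge0// lee_fin gauss_pdf_ge0.
- by rewrite lee_fin gauss_pdf_ge0.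
by apply: eq_integral => x _; rewrite mehler_kerE mulrC EFinM muleA.
Qed.

Lemma ge0_integral_mehler_snd (F : 'rV[R]_n -> \bar R) :
  measurable_fun setT F -> (forall p, 0 <= F p)%E ->
  (\int[mehler]_p F p.2 = \int[gam]_x F x)%E.
Proof.
move=> mF F0.
rewrite ge0_integral_mehler//; last exact: (measurableT_comp mF measurable_snd).
rewrite fubini_tonelli1//; last exact: (measurableT_comp mF measurable_fst).
apply: eq_integral => x _; rewrite /fubini_F/=.
by rewrite integral_cst//= gaussian_rV_setT mule1.
Qed.

(** The sampling map gives the law of the second point directly; that of the first follows from the
    symmetry of the density. *)
Lemma ge0_integral_mehler_fst (F : 'rV[R]_n -> \bar R) :
  measurable_fun setT F -> (forall p, 0 <= F p)%E ->
  (\int[mehler]_p F p.1 = \int[gam]_x F x)%E.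
Proof.
move=> mF F0; rewrite -ge0_integral_mehler_snd//.
rewrite !ge0_integral_mehler_density//; last 2 first.
- exact: (measurableT_comp mF measurable_snd).
- exact: (measurableT_comp mF measurable_fst).
rewrite fubini_tonelli1; last 2 first.
- apply: (emeasurable_funM (measurableT_comp mF measurable_fst)).
  by apply/measurable_EFinP; exact: measurable_mehler_ker.
- by move=> p; rewrite mule_ge0// lee_fin mehler_ker_ge0.
rewrite fubini_tonelli2; last 2 first.
- apply: (emeasurable_funM (measurableT_comp mF measurable_snd)).
  by apply/measurable_EFinP; exact: measurable_mehler_ker.
- by move=> p; rewrite mule_ge0// lee_fin mehler_ker_ge0.
apply: eq_integral => x _; apply: eq_integral => y _ /=.
by rewrite mehler_kerC.
Qed.

End mehler.

(** * Concentration on the diagonal as rho tends to 1 *)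

Section rho_seq.
Context {R : realType}.

(** A sequence inside the open interval (0, 1) with limit 1; sequences are what dominated
    convergence takes. *)
Definition rho_ (N : nat) : R := N.+1%:R / N.+2%:R.

Lemma rho_01 N : 0 < rho_ N < 1.
Proof.
by rewrite /rho_ divr_gt0 ?ltr0n//= ltr_pdivrMr ?ltr0n// mul1r ltr_nat.
Qed.

Lemma cvg_rho_ : rho_ N @[N --> \oo] --> (1 : R).
Proof.
rewrite (_ : rho_ = (fun N => 1 - (N.+2%:R)^-1)); last first.
  apply/funext => N; rewrite /rho_.
  have h : N.+2%:R != 0 :> R by rewrite pnatr_eq0.
  by apply: (mulIf h); rewrite divfK// mulrBl mulVf// mul1r -[N.+2%:R]natr1 addrK.
rewrite -[X in _ --> X]subr0; apply: cvgB; first exact: cvg_cst.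
have := @cvg_harmonic R.
by rewrite -(cvg_shiftS (harmonic : nat -> R^o)).
Qed.

Lemma cvg_mehler_sd : mehler_sd (rho_ N) @[N --> \oo] --> (0 : R).
Proof.
have h : (1 - rho_ N ^+ 2) @[N --> \oo] --> (0 : R).
  have : rho_ N * rho_ N @[N --> \oo] --> (1 * 1 : R) by apply: cvgM; exact: cvg_rho_.
  rewrite mulr1 => r2.
  rewrite -[X in _ --> X](subrr 1); apply: cvgB; first exact: cvg_cst.
  by under eq_fun do rewrite expr2; exact: r2.
rewrite -[X in _ --> X](@sqrtr0 R).
by apply: (cvg_comp (fun N => 1 - rho_ N ^+ 2) Num.sqrt h); exact: sqrt_continuous.
Qed.

End rho_seq.

Lemma cvge0_near_le (R : realType) (u : (\bar R)^nat) (e : R) :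
  u @ \oo --> 0%E -> 0 < e -> \forall N \near \oo, (u N <= e%:E)%E.
Proof.
move=> /fine_cvgP[ufin /cvgrPdist_le uc] e0; near=> N.
rewrite -[leLHS]fineK; last by near: N; exact: ufin.
rewrite lee_fin; have : `|0 - fine (u N)| <= e by near: N; exact: uc.
by apply: le_trans; rewrite sub0r normrN ler_norm.
Unshelve. all: by end_near. Qed.

Section continuity.
Context {R : realType} (n : nat).
Notation gam := (@gaussian_rV R n 1).
Notation Gam N := (mehler n (rho_ N)).
Import HBSimple.
Implicit Types u v w : 'rV[R]_n -> R.

Lemma measurable_diff12 u : measurable_fun setT u ->
  measurable_fun [set: 'rV[R]_n * 'rV[R]_n] (fun p => `|u p.1 - u p.2|%:E).
Proof.
move=> mu; apply/measurable_EFinP; apply: measurableT_comp => //.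
by apply: measurable_funB; [exact: (measurableT_comp mu measurable_fst)
  |exact: (measurableT_comp mu measurable_snd)].
Qed.

Definition osc N u : \bar R := (\int[Gam N]_p `|u p.1 - u p.2|%:E)%E.

(* Holds for half-spaces because their boundary is null, then for all measurable
   sets by a sigma-algebra argument, and for L1 by density of simple functions. *)
Definition vanish u := forall e : R, 0 < e -> \forall N \near \oo, (osc N u <= e%:E)%E.

Lemma osc_leD N u v w : measurable_fun setT v ->
  measurable_fun setT w ->
  (forall x y, `|u x - u y| <= `|v x - v y| + `|w x - w y|) ->
  measurable_fun setT u -> (osc N u <= osc N v + osc N w)%E.
Proof.
move=> mv mw uvw mu; rewrite /osc -ge0_integralD//; first last.
- exact: measurable_diff12.
- exact: measurable_diff12.
apply: ge0_le_integral => //.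
- exact: measurable_diff12.
- by apply: emeasurable_funD; exact: measurable_diff12.
- by move=> p _; rewrite -EFinD lee_fin.
Qed.

Lemma vanish_leD u v w : measurable_fun setT u -> measurable_fun setT v ->
  measurable_fun setT w ->
  (forall x y, `|u x - u y| <= `|v x - v y| + `|w x - w y|) ->
  vanish v -> vanish w -> vanish u.
Proof.
move=> mu mv mw uvw Vv Vw e e0.
have e20 : 0 < e / 2 by rewrite divr_gt0.
near=> N; apply: (le_trans (osc_leD N mv mw uvw mu)).
rewrite [e]splitr EFinD; apply: leeD.
- by near: N; exact: Vv.
- by near: N; exact: Vw.
Unshelve. all: by end_near. Qed.

Lemma vanish0 : vanish (fun=> 0).
Proof.
move=> e e0; near=> N; rewrite /osc integral0_eq ?lee_fin ?ltW// => p _.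
by rewrite subrr normr0.
Unshelve. all: by end_near. Qed.

Lemma vanishZ (c : R) u : measurable_fun setT u -> vanish u -> vanish (fun x => c * u x).
Proof.
move=> mu Vu e e0.
have c0 : 0 < `|c| + 1 by rewrite ltr_wpDl.
have e'0 : 0 < e / (`|c| + 1) by rewrite divr_gt0.
near=> N.
have : (osc N u <= (e / (`|c| + 1))%:E)%E by near: N; exact: Vu.
rewrite EFinM muleC -lee_pdivrMl//?invr_gt0// => h.
apply: le_trans h; rewrite invrK /osc -ge0_integralZl//; last first.
  exact: measurable_diff12.
apply: ge0_le_integral => //.
- by apply: (measurable_diff12 (u := fun x => c * u x)); exact: measurable_funM.
- by apply: emeasurable_funM => //; exact: measurable_diff12.
- move=> p _; rewrite -EFinM lee_fin -mulrBr normrM ler_wpM2r//.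
  by rewrite lerDl.
Unshelve. all: by end_near. Qed.

(** Both marginals are standard Gaussian for every correlation, so the bound is uniform in [N]. *)
Lemma osc_le_L1 N u : measurable_fun setT u ->
  (osc N u <= \int[gam]_x `|u x|%:E + \int[gam]_x `|u x|%:E)%E.
Proof.
move=> mu.
have mau : measurable_fun setT (fun x => `|u x|%:E).
  by apply/measurable_EFinP; exact: measurableT_comp.
rewrite -[X in (_ <= X + _)%E](ge0_integral_mehler_fst (rho_01 N))//.
rewrite -[X in (_ <= _ + X)%E](ge0_integral_mehler_snd (rho_ N))//.
rewrite -ge0_integralD//; last 2 first.
- exact: (measurableT_comp mau measurable_fst).
- exact: (measurableT_comp mau measurable_snd).
apply: ge0_le_integral => //.
- exact: measurable_diff12.
- apply: emeasurable_funD; [exact: (measurableT_comp mau measurable_fst)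
    |exact: (measurableT_comp mau measurable_snd)].
- by move=> p _; rewrite -EFinD lee_fin ler_normB.
Qed.

(** A three-epsilon argument: one third for the approximant and, by the uniform L1 bound, two thirds
    for the remainder. *)
Lemma vanish_approx u : measurable_fun setT u ->
  (forall e : R, 0 < e -> exists v, [/\ measurable_fun setT v, vanish v &
    (\int[gam]_x `|u x - v x|%:E <= e%:E)%E]) -> vanish u.
Proof.
move=> mu H e e0.
have e30 : 0 < e / 3 by rewrite divr_gt0.
have [v [mv Vv uv]] := H _ e30.
have muv : measurable_fun setT (fun x => u x - v x) by exact: measurable_funB.
near=> N.
have : (osc N u <= osc N v + osc N (fun x => u x - v x)%R)%E.
  apply: osc_leD => // x y; rewrite (le_trans _ (ler_normD _ _))//.
  by rewrite (_ : u x - u y = v x - v y + (u x - v x - (u y - v y)))//; ring.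
move=> /le_trans; apply.
have -> : e%:E = ((e / 3)%:E + ((e / 3)%:E + (e / 3)%:E))%E.
  by rewrite -!EFinD; congr EFin; field.
apply: leeD; first by near: N; exact: Vv.
by apply: (le_trans (osc_le_L1 N muv)); exact: leeD.
Unshelve. all: by end_near. Qed.

Lemma gaussian_hyperplane (i : 'I_n) (c : R) :
  gam [set x | x ord0 i = c] = 0%E.
Proof.
pose A k : set (measurableTypeR R) := if k == i then [set c] else setT.
transitivity (gam [set x : 'rV[R]_n | forall k : 'I_n, A k (x ord0 k)]).
  congr (gam _); apply/seteqP; split => x /= h.
    by move=> k; rewrite /A; case: eqP => [->|].
  by have := h i; rewrite /A eqxx.
rewrite [LHS](power_measureE (normal_prob 0 1)); last by move=> k; rewrite /A; case: ifP.
rewrite (bigD1 i)//= {1}/A eqxx [X in (X * _)%E](_ : _ = 0%E) ?mul0e//.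
have := @normal_prob_dominates R 0 1.
move/null_content_dominatesP => /(_ [set c]); apply => //.
exact: lebesgue_measure_set1.
Qed.

Lemma gaussian_prod_setT : (gam \x gam)%E setT = 1%E.
Proof.
rewrite -setXTT; apply: (etrans (product_measure1E gam gam measurableT measurableT)).
have g1 := @gaussian_rV_setT R n 1.
by rewrite [X in (X * _)%E]g1 [X in (_ * X)%E]g1 mule1.
Qed.

Lemma measurable_hyperplane (i : 'I_n) (c : R) :
  measurable [set x : 'rV[R]_n | x ord0 i = c].
Proof.
by have := @measurable_coord R n i measurableT [set c] (measurable_set1 c); rewrite setTI.
Qed.

Lemma integrable_cst_prod (c : R) : (gam \x gam)%E.-integrable setT (cst c%:E).
Proof.
apply/integrableP; split => //=.
rewrite /= (integral_cst (gam \x gam)%E measurableT `|c|%:E).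
rewrite [X in (_ * X)%E](_ : _ = 1%E) ?mule1 ?ltry//.
exact: gaussian_prod_setT.
Qed.

(** In the coordinates [(y, z)] the first point [rho y + s z] converges to [y], so the two
    indicators eventually agree unless [y] lies on the boundary hyperplane, which is null. Dominated
    convergence with bound 1 concludes. *)
Lemma vanish_halfspace (i : 'I_n) (c : R) :
  vanish (\1_[set x : 'rV[R]_n | c < x ord0 i]).
Proof.
set A := [set x | _].
have mA : measurable A.
  rewrite -[A]setTI; have := @measurable_coord R n i.
  by move=> /(_ measurableT `]c, +oo[%classic (measurable_itv _)); congr measurable;
     apply/seteqP; split => x /=; rewrite in_itv/= andbT.
have mu : measurable_fun setT (\1_A : 'rV[R]_n -> R) by exact: measurable_indic.
pose f N (p : 'rV[R]_n * 'rV[R]_n) : \bar R :=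
  (`| \1_A (rho_ N *: p.1 + mehler_sd (rho_ N) *: p.2) - \1_A p.1 |)%:E.
have mf N : measurable_fun setT (f N).
  exact: (measurableT_comp (measurable_diff12 mu) (@measurable_mehler_map R n (rho_ N))).
have oscE N : osc N (\1_A) = (\int[gam \x gam]_p f N p)%E.
  by rewrite /osc ge0_integral_mehler//; exact: measurable_diff12.
have [||||_ _ ] := @dominated_convergence _ _ _ (gam \x gam)%E setT measurableT f (cst 0%E) (cst 1%E) mf.
- exact: measurable_cst.
- exists ([set x : 'rV[R]_n | x ord0 i = c] `*` setT); split.
  + by apply: measurableX => //; exact: measurable_hyperplane.
  + apply: (etrans (product_measure1E gam gam (measurable_hyperplane i c) measurableT)).
    by rewrite [X in (X * _)%E](gaussian_hyperplane i c) mul0e.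
  + move=> [y z] /= h; split => //.
    apply: contrapT => yc; apply: h => _.
    have cv : (rho_ N *: y + mehler_sd (rho_ N) *: z) ord0 i @[N --> \oo] --> y ord0 i.
      rewrite (_ : (fun N => _) = (fun N => rho_ N * y ord0 i +
        mehler_sd (rho_ N) * z ord0 i)); last by apply/funext => N; rewrite !mxE.
      have : rho_ N * y ord0 i + mehler_sd (rho_ N) * z ord0 i @[N --> \oo] -->
          1 * y ord0 i + 0 * z ord0 i.
        by apply: cvgD; apply: cvgM; [exact: cvg_rho_|exact: cvg_cst
          |exact: cvg_mehler_sd|exact: cvg_cst].
      by rewrite mul1r mul0r addr0.
    have cA : \forall N \near \oo, (c < (rho_ N *: y + mehler_sd (rho_ N) *: z) ord0 i) =
        (c < y ord0 i).
      have [yc'|cy|//] := ltgtP (y ord0 i) c; near=> N.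
        by apply/negbTE; rewrite -leNgt ltW//; near: N; exact: (cvgr_lt _ cv).
      by near: N; exact: (cvgr_gt _ cv).
    apply: cvg_near_cst; near=> N; rewrite /f/=.
    suff -> : \1_A (rho_ N *: y + mehler_sd (rho_ N) *: z) = \1_A y :> R.
      by rewrite subrr normr0.
    rewrite !indicE; congr (nat_of_bool _)%:R.
    have h : (c < (rho_ N *: y + mehler_sd (rho_ N) *: z) ord0 i) = (c < y ord0 i).
      by near: N.
    by apply/idP/idP; rewrite !inE /A/= h.
- exact: integrable_cst_prod.
- apply: aeW => p N _; rewrite /f gee0_abs ?lee_fin//= !indicE.
  by case: (_ \in A); case: (_ \in A); rewrite ?subrr ?subr0 ?sub0r ?normrN ?normr1 ?normr0.
rewrite integral0 => f0 e e0; near=> N; rewrite oscE.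
by near: N; exact: (cvge0_near_le f0).
Unshelve. all: by end_near. Qed.

Let S := [set A : set 'rV[R]_n | measurable A /\ vanish (\1_A)].

(** The oscillation of an indicator is unchanged by complement and subadditive under arbitrary
    finite unions, so a full sigma-algebra is obtained without a Dynkin class. Countable unions are
    L1 limits of finite ones. *)
Lemma vanish_sigma_algebra : sigma_algebra setT S.
Proof.
have S0 : S set0.
  by split => //; rewrite indic0; exact: vanish0.
have SU A B : S A -> S B -> S (A `|` B).
  move=> [mA VA] [mB VB]; split; first exact: measurableU.
  apply: (vanish_leD (v := \1_A) (w := \1_B)) => //.
    by apply: measurable_indic; exact: measurableU.
  move=> x y; rewrite !indicE !in_setU.
  case: (x \in A); case: (x \in B); case: (y \in A); case: (y \in B) => /=;
    by rewrite ?subrr ?subr0 ?sub0r ?normrN ?normr1 ?normr0 ?addr0 ?add0r ?lerDl.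
have Sbig (A : (set 'rV[R]_n)^nat) : (forall k, S (A k)) ->
    forall m, S (\big[setU/set0]_(k < m) A k).
  by move=> SA m; apply: big_ind => // k _; exact: SA.
split => //.
  move=> A [mA VA]; rewrite setTD; split; first exact: measurableC.
  apply: (vanish_leD (v := \1_A) (w := fun=> 0)) => //; last exact: vanish0.
    by apply: measurable_indic; exact: measurableC.
  move=> x y; rewrite subrr normr0 addr0 !indicE !in_setC.
  case: (x \in A); case: (y \in A) => /=;
    by rewrite ?subrr ?subr0 ?sub0r ?normrN ?normr1 ?normr0.
move=> A SA; have mA k : measurable (A k) by have [] := SA k.
have mUA : measurable (\bigcup_k A k) by exact: bigcupT_measurable.
split => //.
pose B m := \big[setU/set0]_(k < m) A k.
have mB m : measurable (B m) by have [] := Sbig _ SA m.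
have BA m : B m `<=` \bigcup_k A k.
  by rewrite /B -bigcup_mkord; apply: bigcup_sub => k _; exact: bigcup_sup.
apply: vanish_approx; first exact: measurable_indic.
move=> e e0; pose F m := (\bigcup_k A k) `\` B m.
have mF m : measurable (F m) by exact: measurableD.
(* Continuity from above along the decreasing remainders, valid because the Gaussian measure is
   finite. *)
have F0 : gam \o F @ \oo --> 0%E.
  have <- : gam (\bigcap_m F m) = 0%E.
    rewrite (_ : \bigcap_m _ = set0) ?measure0//.
    apply/seteqP; split => x //= h.
    have [[k _ Akx] _] := h 0%N I.
    have [_] := h k.+1 I; apply.
    by rewrite /B big_ord_recr/=; right.
  apply: nonincreasing_cvg_mu => //.
  - apply: (@le_lt_trans _ _ (gam setT)); last by rewrite gaussian_rV_setT ltry.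
    by apply: le_measure; rewrite ?inE.
  - exact: bigcapT_measurable.
  - move=> m1 m2 m12; apply/subsetPset => x [Ux nBx]; split => //.
    apply: contra_not nBx; rewrite /B -!bigcup_mkord => -[k /= km Akx].
    by exists k => //=; exact: leq_trans m12.
have [m _ /(_ m (leqnn _)) Fm] := cvge0_near_le F0 e0.
exists (\1_(B m)); split; first exact: measurable_indic.
  by have [] := Sbig _ SA m.
rewrite (_ : (fun x => _) = (fun x => (\1_(F m) x)%:E)); last first.
  apply/funext => x; congr EFin; rewrite !indicE in_setD.
  have := @BA m x; have [xB|xB] := boolP (x \in B m) => /= BAx.
    by rewrite mem_set ?subrr ?normr0//; apply: BAx; exact: set_mem.
  by rewrite subr0 andbT ger0_norm.
by rewrite integral_indic// setIT.
Qed.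

(** Two generation steps: coordinate preimages generate the sets of row vectors, and open right
    half-lines generate the Borel sets of the line. *)
Lemma vanish_indic (A : set 'rV[R]_n) : measurable A -> vanish (\1_A).
Proof.
have [S0 SC SU] := vanish_sigma_algebra.
suff H i Y : measurable Y -> S ((fun x : 'rV[R]_n => x ord0 i) @^-1` Y).
  suff: measurable `<=` S by move=> /[apply] -[].
  apply: smallest_sub; first exact: vanish_sigma_algebra.
  rewrite -bigcup_seq; apply: bigcup_sub => i _ B [C mC <-].
  by rewrite setTI; exact: H.
move=> mY; have : (@RGenOInfty.G R).-sigma.-measurable Y by rewrite -RGenOInfty.measurableE.
move: Y {mY}; apply: smallest_sub.
  split => /=.
  - by rewrite preimage_set0.
  - by move=> B SB; rewrite setTD preimage_setC -setTD; exact: SC.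
  - by move=> B SB; rewrite preimage_bigcup; exact: SU.
move=> _ [c ->] /=; rewrite (_ : _ @^-1` _ = [set x : 'rV[R]_n | c < x ord0 i]); last first.
  by apply/seteqP; split => x /=; rewrite in_itv/= andbT.
split; last exact: vanish_halfspace.
have := @measurable_coord R n i measurableT `]c, +oo[%classic (measurable_itv _).
rewrite setTI; congr measurable; apply/seteqP; split => x /=; by rewrite in_itv/= andbT.
Qed.

Lemma vanish_sum (m : nat) (u : 'I_m -> 'rV[R]_n -> R) :
  (forall i, measurable_fun setT (u i)) -> (forall i, vanish (u i)) ->
  vanish (fun x => \sum_(i < m) u i x).
Proof.
move=> mu Vu; elim: m u mu Vu => [|m IHm] u mu Vu.
  rewrite (_ : (fun x => _) = fun=> 0); first exact: vanish0.
  by apply/funext => x; rewrite big_ord0.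
apply: (vanish_leD (v := fun x => \sum_(i < m) u (widen_ord (leqnSn m) i) x)
                   (w := u ord_max)) => //.
- exact: measurable_sum.
- exact: measurable_sum.
- by move=> x y; rewrite !big_ord_recr/= opprD addrACA ler_normD.
- by apply: IHm => i.
Qed.

Lemma vanish_sfun (f : {sfun 'rV[R]_n >-> R}) : vanish f.
Proof.
(* The sum over the finite range is reindexed by ordinals so that [vanish_sum] applies. *)
have [s fs] : exists s : seq R, forall x,
    f x = \sum_(i < size s) (s`_i * \1_(f @^-1` [set s`_i]) x).
  eexists => x; rewrite fimfunE fsbig_finite//= (big_nth 0)/= big_mkord.
  by apply: eq_bigr.
rewrite (_ : (f : 'rV[R]_n -> R) = fun x =>
  \sum_(i < size s) (s`_i * \1_(f @^-1` [set s`_i]) x)); last exact/funext.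
have mA c : measurable (f @^-1` [set c]) by exact: measurable_sfunP.
apply: vanish_sum => i.
  by apply: measurable_funM => //; exact: measurable_indic.
by apply: vanishZ; [exact: measurable_indic|exact: vanish_indic].
Qed.

Lemma vanish_L1 u : measurable_fun setT u -> gam.-integrable setT (EFin \o u) ->
  vanish u.
Proof.
move=> mu iu; apply: vanish_approx => // e e0.
have [g [ig _ gu]] := approximation_sfun_integrable measurableT iu.
have [m _ /(_ m (leqnn _)) gm] := cvge0_near_le gu e0.
exists (g m); split => //; exact: vanish_sfun.
Qed.

End continuity.

Section transfer.
Context d1 d2 (T1 : measurableType d1) (T2 : measurableType d2) (R : realType).
Variables (mu : {measure set T1 -> \bar R}) (nu : {measure set T2 -> \bar R}).
Variable phi : T1 -> T2.
Hypothesis mphi : measurable_fun [set: T1] phi.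
Hypothesis phiE : forall F : T2 -> \bar R, measurable_fun [set: T2] F ->
  (forall x, 0 <= F x)%E -> (\int[mu]_x F (phi x) = \int[nu]_y F y)%E.

(** Positive and negative parts commute with composition, so the nonnegative case [phiE] extends to
    signed functions. It serves both the marginals of the correlated pair and the standardised
    noise. *)
Lemma integral_transfer (f : T2 -> \bar R) : measurable_fun [set: T2] f ->
  (\int[mu]_x f (phi x) = \int[nu]_y f y)%E.
Proof.
move=> mf; rewrite [LHS]integralE [RHS]integralE; congr (_ - _)%E.
  rewrite -phiE//; last exact: measurable_funepos.
  by apply: eq_integral => x _; rewrite !funeposE.
rewrite -phiE//; last exact: measurable_funeneg.
by apply: eq_integral => x _; rewrite !funenegE.
Qed.

Lemma Rintegral_transfer (f : T2 -> R) : measurable_fun [set: T2] f ->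
  \int[mu]_x f (phi x) = \int[nu]_y f y.
Proof.
move=> mf; rewrite /Rintegral; congr fine.
by apply: (@integral_transfer (EFin \o f)); exact/measurable_EFinP.
Qed.

Lemma integrable_transfer (f : T2 -> R) : measurable_fun [set: T2] f ->
  mu.-integrable setT (EFin \o (f \o phi)) <-> nu.-integrable setT (EFin \o f).
Proof.
move=> mf.
have mfE : measurable_fun [set: T2] (fun y => `|f y|%:E).
  by apply/measurable_EFinP; exact: measurableT_comp.
have E : (\int[mu]_x `|f (phi x)|%:E = \int[nu]_y `|f y|%:E)%E.
  by rewrite (@phiE (fun y => `|f y|%:E)).
split => /integrableP[_ foo]; apply/integrableP; split.
- by apply/measurable_EFinP.
- by rewrite /= -E.
- by apply/measurable_EFinP; exact: (measurableT_comp mf mphi).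
- by rewrite /= E.
Qed.

End transfer.

Section real_integrable.
Context d (T : measurableType d) (R : realType) (mu : {measure set T -> \bar R}).
Implicit Types f g : T -> R.

Definition Rintegrable f := mu.-integrable setT (EFin \o f).

Lemma Rintegrable_le f g : measurable_fun setT f -> Rintegrable g ->
  (forall x, `|f x| <= g x) -> Rintegrable f.
Proof.
move=> mf ig fg; apply: (le_integrable _ _ _ ig) => //.
  exact/measurable_EFinP.
by move=> x _; rewrite /= lee_fin (le_trans (fg x))// ler_norm.
Qed.

Lemma Rintegrable_lty f : measurable_fun setT f -> (forall x, 0 <= f x) ->
  (\int[mu]_x (f x)%:E < +oo)%E -> Rintegrable f.
Proof.
move=> mf f0 foo; apply/integrableP; split; first exact/measurable_EFinP.
apply: le_lt_trans foo; apply: ge0_le_integral => //=.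
- by apply/measurable_EFinP; exact: measurableT_comp.
- exact/measurable_EFinP.
- by move=> x _; rewrite ger0_norm.
Qed.

Lemma RintegrableD f g : Rintegrable f -> Rintegrable g ->
  Rintegrable (fun x => f x + g x).
Proof. by move=> fi gi; have := integrableD measurableT fi gi. Qed.

Lemma RintegrableB f g : Rintegrable f -> Rintegrable g ->
  Rintegrable (fun x => f x - g x).
Proof. by move=> fi gi; have := integrableB measurableT fi gi. Qed.

Lemma RintegrableZ (c : R) f : Rintegrable f -> Rintegrable (fun x => c * f x).
Proof. by move=> fi; have := integrableZl measurableT c fi. Qed.

Lemma Rintegrable_norm f : Rintegrable f -> Rintegrable (fun x => `|f x|).
Proof. by move=> fi; have := integrable_abse fi. Qed.

Lemma Rintegrable_measurable f : Rintegrable f -> measurable_fun setT f.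
Proof. by move=> /measurable_int/measurable_EFinP. Qed.

Lemma Rintegrable_sum I (s : seq I) (f : I -> T -> R) :
  (forall i, Rintegrable (f i)) -> Rintegrable (fun x => \sum_(i <- s) f i x).
Proof.
move=> fi; elim: s => [|i s IHs].
  under eq_fun do rewrite big_nil; exact: integrable0.
under eq_fun do rewrite big_cons; exact: RintegrableD.
Qed.

Lemma Rintegral_sum I (s : seq I) (f : I -> T -> R) :
  (forall i, Rintegrable (f i)) ->
  \int[mu]_x (\sum_(i <- s) f i x) = \sum_(i <- s) \int[mu]_x f i x.
Proof.
move=> fi; elim: s => [|i s IHs].
  rewrite big_nil; under eq_Rintegral do rewrite big_nil.
  by rewrite /Rintegral integral0.
rewrite big_cons -IHs; under eq_Rintegral do rewrite big_cons.
by rewrite (RintegralD measurableT (fi i) (@Rintegrable_sum _ s _ fi)).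
Qed.

Lemma EFin_Rintegral f : Rintegrable f -> ((\int[mu]_x f x)%:E = \int[mu]_x (f x)%:E)%E.
Proof. by move=> fi; rewrite /Rintegral fineK//; exact: integrable_fin_num. Qed.

Lemma Rintegrable_mul f g : measurable_fun setT f -> measurable_fun setT g ->
  Rintegrable (fun x => f x ^+ 2) -> Rintegrable (fun x => g x ^+ 2) ->
  Rintegrable (fun x => f x * g x).
Proof.
move=> mf mg fi gi; apply: (Rintegrable_le _ (RintegrableD fi gi)).
  exact: measurable_funM.
move=> x; rewrite normrM -(real_normK (num_real (f x))) -(real_normK (num_real (g x))).
by have := normr_ge0 (f x); have := normr_ge0 (g x); nra.
Qed.

End real_integrable.

(** * Convergence of correlated pairings to Gaussian inner products *)

Section pairing.
Context {R : realType} (n : nat).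
Notation gam := (@gaussian_rV R n 1).
Notation Gam N := (mehler n (rho_ N)).
Implicit Types u v : 'rV[R]_n -> R.

Lemma mehler_integrable_fst N u : measurable_fun setT u ->
  Rintegrable gam u -> Rintegrable (Gam N) (fun p => u p.1).
Proof.
move=> mu; apply: (integrable_transfer (phi := fst) _ _ mu).2.
  exact: measurable_fst.
by move=> F mF F0; rewrite (ge0_integral_mehler_fst (rho_01 N)).
Qed.

Lemma mehler_integrable_snd N u : measurable_fun setT u ->
  Rintegrable gam u -> Rintegrable (Gam N) (fun p => u p.2).
Proof.
move=> mu; apply: (integrable_transfer (phi := snd) _ _ mu).2.
  exact: measurable_snd.
by move=> F mF F0; rewrite (ge0_integral_mehler_snd (rho_ N)).
Qed.

Lemma Rintegral_mehler_snd N u : measurable_fun setT u ->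
  \int[Gam N]_p u p.2 = \int[gam]_x u x.
Proof.
move=> mu; apply: (Rintegral_transfer (phi := snd) _ mu).
by move=> F mF F0; rewrite (ge0_integral_mehler_snd (rho_ N)).
Qed.

Lemma measurable_fst_fun u : measurable_fun setT u ->
  measurable_fun [set: 'rV[R]_n * 'rV[R]_n] (fun p => u p.1).
Proof. by move=> mu; exact: (measurableT_comp mu measurable_fst). Qed.

Lemma measurable_snd_fun u : measurable_fun setT u ->
  measurable_fun [set: 'rV[R]_n * 'rV[R]_n] (fun p => u p.2).
Proof. by move=> mu; exact: (measurableT_comp mu measurable_snd). Qed.

(** The second marginal is Gaussian, so the diagonal integral can also be read under the law of the
    pair; the difference then only involves the increment of [u]. *)
Lemma pairing_diff N u v : measurable_fun setT u -> measurable_fun setT v ->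
  Rintegrable (Gam N) (fun p => u p.1 * v p.2) ->
  Rintegrable gam (fun x => u x * v x) ->
  \int[Gam N]_p (u p.1 * v p.2) - \int[gam]_x (u x * v x) =
  \int[Gam N]_p ((u p.1 - u p.2) * v p.2).
Proof.
move=> mu mv i1 i2.
have muv : measurable_fun setT (fun x => u x * v x) by exact: measurable_funM.
rewrite -(Rintegral_mehler_snd N muv) -(RintegralB measurableT i1 (mehler_integrable_snd N muv i2)).
by apply: eq_Rintegral => p _; rewrite mulrBl.
Qed.

Lemma cvg_pairing_L1 u v (B : R) : measurable_fun setT u -> measurable_fun setT v ->
  Rintegrable gam u -> (forall x, `|v x| <= B) ->
  \int[Gam N]_p (u p.1 * v p.2) @[N --> \oo] --> \int[gam]_x (u x * v x).
Proof.
move=> mu mv iu vB.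
have B0 : 0 <= B by apply: le_trans (vB 0).
have vanu := vanish_L1 mu iu.
apply/cvgrPdist_le => /= e e0.
(* [B] may be 0, hence the shift before dividing. *)
have B1 : 0 < B + 1 by rewrite ltr_wpDl.
have e'0 : 0 < e / (B + 1) by rewrite divr_gt0.
near=> N; rewrite distrC.
have m1 := measurable_fst_fun mu; have m2 := measurable_snd_fun mu.
have m3 := measurable_snd_fun mv.
have iu1 := mehler_integrable_fst N mu iu.
have iu2 := mehler_integrable_snd N mu iu.
have id := Rintegrable_norm (RintegrableB iu1 iu2).
rewrite pairing_diff//; last 2 first.
- apply: (Rintegrable_le _ (RintegrableZ B (Rintegrable_norm iu1))); first exact: measurable_funM.
  by move=> p; rewrite normrM mulrC ler_wpM2r.
- apply: (Rintegrable_le _ (RintegrableZ B (Rintegrable_norm iu))); first exact: measurable_funM.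
  by move=> p; rewrite normrM mulrC ler_wpM2r.
have idv : Rintegrable (Gam N) (fun p => (u p.1 - u p.2) * v p.2).
  apply: (Rintegrable_le _ (RintegrableZ B id)).
    by apply: measurable_funM => //; exact: measurable_funB.
  by move=> p; rewrite normrM mulrC ler_wpM2r.
apply: (le_trans (le_normr_Rintegral measurableT idv)).
apply: (@le_trans _ _ (\int[Gam N]_p (B * `|u p.1 - u p.2|))).
  apply: le_Rintegral => //.
  - exact: Rintegrable_norm.
  - exact: RintegrableZ.
  - by move=> p _; rewrite normrM mulrC ler_wpM2r.
rewrite RintegralZl//.
have : (osc N u <= (e / (B + 1))%:E)%E by near: N; exact: vanu.
rewrite /osc -EFin_Rintegral// lee_fin ler_pdivlMr// => h.
apply: le_trans h; rewrite mulrC ler_wpM2l//; last by rewrite lerDl.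
exact: Rintegral_ge0.
Unshelve. all: by end_near. Qed.

(** Turns a square increment of [u] into a first-power increment of [u |u|], which is integrable
    when [u ^+ 2] is. The L2 convergence thereby reduces to the L1 concentration already proved. *)
Lemma sqr_diff_le (a b : R) : (a - b) ^+ 2 <= 2 * `|a * `|a| - b * `|b| |.
Proof.
have [a0|a0] := leP 0 a; have [b0|b0] := leP 0 b;
  rewrite ?(ger0_norm a0) ?(ltr0_norm a0) ?(ger0_norm b0) ?(ltr0_norm b0).
- by have [ab|ab] := leP a b; [rewrite ler0_norm|rewrite ger0_norm]; nra.
- by rewrite ger0_norm; have := sqr_ge0 (a + b); nra.
- by rewrite ler0_norm; have := sqr_ge0 (a + b); nra.
- by have [ab|ab] := leP a b; [rewrite ler0_norm|rewrite ger0_norm]; nra.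
Qed.

Lemma cvg_pairing_L2 u v : measurable_fun setT u -> measurable_fun setT v ->
  Rintegrable gam (fun x => u x ^+ 2) -> Rintegrable gam (fun x => v x ^+ 2) ->
  \int[Gam N]_p (u p.1 * v p.2) @[N --> \oo] --> \int[gam]_x (u x * v x).
Proof.
move=> mu mv iu iv.
pose w x := u x * `|u x|.
have mw : measurable_fun setT w.
  by apply: measurable_funM => //; exact: measurableT_comp.
have iw : Rintegrable gam w.
  apply: (Rintegrable_le mw iu) => x.
  by rewrite /w normrM normr_id -expr2 real_normK ?num_real.
have vanw := vanish_L1 mw iw.
apply/cvgrPdist_le => /= e e0.
set V := \int[gam]_x (v x ^+ 2).
have V0 : 0 <= V by apply: Rintegral_ge0 => x _; exact: sqr_ge0.
have V1 : 0 < V + 1 by rewrite ltr_wpDl.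
(* The weight in Young's inequality: the term with [v ^+ 2] contributes [D / 2 * V <= e / 2], and
   the oscillation of [w] is then asked to be at most [D * e / 2]. *)
pose D := e / (V + 1).
have D0 : 0 < D by rewrite divr_gt0.
have De0 : 0 < D * e / 2 by apply: divr_gt0 => //; exact: mulr_gt0.
near=> N; rewrite distrC.
have m1 := measurable_fst_fun mu; have m2 := measurable_snd_fun mu.
have m3 := measurable_snd_fun mv.
have iu1 := mehler_integrable_fst N (measurable_funX 2 mu) iu.
have iv2 := mehler_integrable_snd N (measurable_funX 2 mv) iv.
have iw1 := mehler_integrable_fst N mw iw.
have iw2 := mehler_integrable_snd N mw iw.
have id := Rintegrable_norm (RintegrableB iw1 iw2).
rewrite pairing_diff//; last 2 first.
- exact: (@Rintegrable_mul _ _ _ _ (fun p => u p.1) (fun p => v p.2)).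
- exact: Rintegrable_mul.
have bound p : `|(u p.1 - u p.2) * v p.2| <= D^-1 * `|w p.1 - w p.2| + D / 2 * v p.2 ^+ 2.
  have := sqr_diff_le (u p.1) (u p.2); rewrite -/(w p.1) -/(w p.2) => h.
  rewrite normrM -(real_normK (num_real (v p.2))).
  (* Young's inequality with weight [D]; the factor 2 of [sqr_diff_le] then cancels the one half in
     the first term. *)
  have : `|u p.1 - u p.2| * `|v p.2| <= D^-1 / 2 * `|u p.1 - u p.2| ^+ 2 + D / 2 * `|v p.2| ^+ 2.
    rewrite -(ler_pM2l D0) mulrDr mulrA (mulrA D (D^-1 / 2)) (mulrA D D^-1) divff ?gt_eqF// mul1r.
    by have := sqr_ge0 (`|u p.1 - u p.2| - D * `|v p.2|); nra.
  move=> /le_trans; apply; rewrite lerD2r real_normK ?num_real// -mulrA.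
  apply: ler_wpM2l; first by rewrite invr_ge0 ltW.
  by rewrite mulrC ler_pdivrMr// mulrC.
have idb := RintegrableD (RintegrableZ D^-1 id) (RintegrableZ (D / 2) iv2).
have idv : Rintegrable (Gam N) (fun p => (u p.1 - u p.2) * v p.2).
  apply: (Rintegrable_le _ idb) => //.
  by apply: measurable_funM => //; exact: measurable_funB.
apply: (le_trans (le_normr_Rintegral measurableT idv)).
apply: (@le_trans _ _ (\int[Gam N]_p (D^-1 * `|w p.1 - w p.2| + D / 2 * v p.2 ^+ 2))).
  by apply: le_Rintegral => //; exact: Rintegrable_norm.
rewrite RintegralD//; last 2 first.
- exact: RintegrableZ.
- exact: RintegrableZ.
rewrite !RintegralZl// (Rintegral_mehler_snd N (u := fun x => v x ^+ 2)); last exact: measurable_funX.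
have : (osc N w <= (D * e / 2)%:E)%E by near: N; exact: vanw.
rewrite /osc -EFin_Rintegral// lee_fin => h.
rewrite [leRHS]splitr; apply: lerD.
  by rewrite mulrC ler_pdivrMr// [e / 2 * D]mulrC mulrA.
rewrite -/V /D mulrAC ler_pdivrMr// -mulrA divfK ?pnatr_eq0//.
by rewrite ler_piMr ?(ltW e0)// mulrC ler_pdivrMr// mul1r lerDl.
Unshelve. all: by end_near. Qed.

End pairing.

(** * Integration by parts against the Mehler kernel *)

Section compact_tensor.
Context {R : realType} (n : nat).
Notation lam := (@lebesgue_rV R n).
Implicit Types (theta : 'I_n -> R -> R) (x : 'rV[R]_n).

Lemma continuous_compact_bounded (r : R) (f : R -> R) : 0 < r -> continuous f ->
  (forall t, r <= `|t| -> f t = 0) -> exists2 B, 0 <= B & forall t, `|f t| <= B.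
Proof.
move=> r0 cf f0.
have rr : - r <= r by rewrite ge0_cp// ltW.
have [|c _ cmax] := @EVT_max _ (fun t => `|f t|) _ _ rr.
  by apply: continuous_subspaceT => t; apply: continuous_comp; [exact: cf|exact: norm_continuous].
exists `|f c| => // t; have [rt|rt] := leP r `|t|; first by rewrite f0// normr0.
by apply: cmax; rewrite in_itv/= -ler_norml ltW.
Qed.

Definition box (r : R) : set 'rV[R]_n := [set x | forall i, `|x ord0 i| <= r].

Lemma measurable_box (r : R) : measurable (box r).
Proof.
rewrite (_ : box r =
    \big[setI/setT]_(i < n) ((fun x : 'rV[R]_n => x ord0 i) @^-1` `[- r, r]%classic)).
  apply: bigsetI_measurable => i _; rewrite -[X in measurable X]setTI.
  exact: measurable_coord.
rewrite -bigcap_seq; apply/seteqP; split => x /= h i.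
  by move=> _; rewrite /= in_itv/= -ler_norml.
by have := h i; rewrite /= mem_index_enum in_itv/= -ler_norml; exact.
Qed.

Definition supported (r : R) (u : 'rV[R]_n -> R) := forall x i, r < `|x ord0 i| -> u x = 0.

(** Boxes replace compact sets because the supports of product functions are boxes and affine maps
    send boxes into boxes. The restriction is an indicator factor since [Rintegrable] refers to the
    whole space. *)
Definition box_integrable (g : 'rV[R]_n -> R) := measurable_fun setT g /\
  forall r, Rintegrable lam (fun x => `|g x| * \1_(box r) x).

Lemma loc_box_integrable g : loc_integrable g -> box_integrable g.
Proof.
move=> [mg ig]; split => // r.
apply: Rintegrable_lty => [||].
- apply: measurable_funM; first exact: measurableT_comp.
  by apply: measurable_indic; exact: measurable_box.
- by move=> x; rewrite mulr_ge0.
- rewrite (_ : (\int[_]_x _)%E = (\int[lam]_(x in box r) `|g x|%:E)%E); first exact: ig (@compact_box R n r).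
  rewrite [RHS]integral_mkcond; apply: eq_integral => x _.
  by rewrite patchE indicE; case: ifP => _; rewrite ?mulr1 ?mulr0.
Qed.

Lemma integrable_box_mul (g b : 'rV[R]_n -> R) (r B : R) : box_integrable g ->
  measurable_fun setT b -> (forall x, `|b x| <= B) -> supported r b ->
  Rintegrable lam (fun x => g x * b x).
Proof.
move=> [mg /(_ r) iD] mb bB sb.
have B0 : 0 <= B by apply: le_trans (bB 0).
apply: (Rintegrable_le _ (RintegrableZ B iD)); first exact: measurable_funM.
move=> x; rewrite normrM mulrA [B * _]mulrC indicE.
have [xD|xD] := boolP (x \in box r); first by rewrite mulr1 ler_wpM2l.
rewrite mulr0 (_ : b x = 0) ?normr0 ?mulr0//.
move: xD => /negP; rewrite inE => /existsNP[i /negP]; rewrite -ltNge; exact: sb.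
Qed.

Lemma measurable_tensor theta : (forall i, continuous (theta i)) ->
  measurable_fun setT (tensor theta).
Proof.
move=> ct; apply: measurable_prod => i _.
apply: (measurableT_comp (continuous_measurable_fun (ct i))).
exact: measurable_coord.
Qed.

Lemma tensor_bounded theta : (forall i, exists2 B, 0 <= B & forall t, `|theta i t| <= B) ->
  exists2 B, 0 <= B & forall x, `|tensor theta x| <= B.
Proof.
move=> H.
have {}H i : exists B, 0 <= B /\ forall t, `|theta i t| <= B.
  by have [B ? ?] := H i; exists B.
have [B hB] := choice H.
exists (\prod_(i < n) B i); first by apply: prodr_ge0 => i _; have [] := hB i.
move=> x; rewrite /tensor normr_prod; apply: ler_prod => i _.
by rewrite normr_ge0/=; have [_] := hB i; exact.
Qed.

Lemma tensor_supported theta (r : R) : (forall i t, r < `|t| -> theta i t = 0) ->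
  supported r (tensor theta).
Proof. by move=> t0 x i xi; rewrite /tensor (bigD1 i)//= t0 ?mul0r. Qed.

Lemma integrable_box_tensor (g : 'rV[R]_n -> R) (r : R) theta : 0 < r ->
  box_integrable g -> (forall i, continuous (theta i)) ->
  (forall i t, r <= `|t| -> theta i t = 0) ->
  Rintegrable lam (fun x => g x * tensor theta x).
Proof.
move=> r0 lg ct t0.
have [B B0 hB] : exists2 B, 0 <= B & forall x, `|tensor theta x| <= B.
  by apply: tensor_bounded => i; exact: continuous_compact_bounded (t0 i).
apply: (integrable_box_mul lg _ hB); first exact: measurable_tensor.
by apply: (@tensor_supported _ r) => i t rt; rewrite t0// ltW.
Qed.

(* Weak derivatives tested only against products of one-variable functions: this
   class contains the cut-off Mehler kernel and is stable under affine maps. *)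
Definition tensor_partial (i : 'I_n) (g h : 'rV[R]_n -> R) :=
  box_integrable h /\ forall (r : R) theta (dtheta : R -> R), 0 < r ->
    (forall k, smooth (theta k)) -> (forall t : R, is_derive t 1 (theta i) (dtheta t)) ->
    continuous dtheta -> (forall k t, r <= `|t| -> theta k t = 0) ->
    (forall t, r <= `|t| -> dtheta t = 0) ->
    \int[lam]_x (g x * tensor (fun k => if k == i then dtheta else theta k) x) =
    - \int[lam]_x (h x * tensor theta x).

Lemma weak_tensor_partial i g h : weak_partial i g h -> tensor_partial i g h.
Proof.
move=> [lh wp]; split; first exact: loc_box_integrable.
move=> r theta dtheta r0 st dt _ t0 _.
rewrite -wp; last exact: (test_function_tensor (r := r)).
apply: eq_Rintegral => x _; congr (_ * _).
by have [_ ->] := is_derive_tensor (dt (x ord0 i)); rewrite tensor_replace.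
Qed.

End compact_tensor.

Section cutoff.
Context {R : realType} (n : nat).
Notation lam := (@lebesgue_rV R n).
Implicit Types (theta : 'I_n -> R -> R) (x : 'rV[R]_n).
Variable r : R.
Hypothesis r0 : 0 < r.

(* The shape [a + b * t] is the one of [C1_comp_affine]. *)
Definition bump_scale (t : R) := bumpR (0 + r^-1 * t).
Definition dbump_scale (t : R) := dbumpR (0 + r^-1 * t) * r^-1.

Lemma smooth_bump_scale : smooth bump_scale.
Proof. by move=> k; apply: C1_comp_affine; exact: smooth_bumpR. Qed.

Lemma is_derive_bump_scale (t : R) : is_derive t 1 bump_scale (dbump_scale t).
Proof. exact: (is_derive1_comp (is_derive_bumpR _) (is_derive1_affine 0 r^-1 t)). Qed.

Lemma continuous_dbump_scale : continuous dbump_scale.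
Proof.
suff : C1 0 dbump_scale by [].
by apply: C1M; [apply: C1_comp_affine; exact: continuous_dbumpR|exact: C1_cst].
Qed.

Lemma bump_scale_out (t : R) : r <= `|t| -> bump_scale t = 0.
Proof.
move=> rt; rewrite /bump_scale bumpR_out// add0r normrM gtr0_norm ?invr_gt0//.
by rewrite mulrC ler_pdivlMr// mul1r.
Qed.

Lemma dbump_scale_out (t : R) : r <= `|t| -> dbump_scale t = 0.
Proof.
move=> rt; rewrite /dbump_scale /dbumpR add0r.
have : 1 <= `|r^-1 * t|.
  by rewrite normrM gtr0_norm ?invr_gt0// mulrC ler_pdivlMr// mul1r.
rewrite ler_normr /flat => /orP[] h.
  rewrite (_ : (0 < 1 + -1 * (r^-1 * t)) = false) ?(mul0r, mulr0, addr0)//.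
  by apply/negbTE; rewrite -leNgt; lra.
rewrite (_ : (0 < 1 + 1 * (r^-1 * t)) = false) ?(mul0r, mulr0, addr0)//.
by apply/negbTE; rewrite -leNgt; lra.
Qed.

Definition cut : 'rV[R]_n -> R := tensor (fun=> bump_scale).
Definition dcut (j : 'I_n) : 'rV[R]_n -> R :=
  tensor (fun k => if k == j then dbump_scale else bump_scale).

Lemma tensorM theta1 theta2 x : tensor theta1 x * tensor theta2 x =
  tensor (fun k t => theta1 k t * theta2 k t) x.
Proof. by rewrite /tensor -big_split. Qed.

(* [tensor theta] need not be compactly supported: the cutoff is. *)
Lemma cut_by_parts (g h : 'rV[R]_n -> R) (j : 'I_n) theta (dtheta : R -> R) :
  box_integrable g -> tensor_partial j g h ->
  (forall k, smooth (theta k)) -> (forall t : R, is_derive t 1 (theta j) (dtheta t)) ->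
  continuous dtheta ->
  \int[lam]_x ((cut x * h x + dcut j x * g x) * tensor theta x) =
  - \int[lam]_x (cut x * g x * tensor (fun k => if k == j then dtheta else theta k) x).
Proof.
move=> lg [lh wp] st dt cdt.
(* [tau] is an admissible product test function; [tau1] and [tau2] are the two terms of the product
   rule in its j-th derivative, falling on the cutoff and on [theta]. *)
pose tau k t := bump_scale t * theta k t.
pose tau1 k (t : R) := (if k == j then dbump_scale else bump_scale) t * theta k t.
pose tau2 k (t : R) := bump_scale t * (if k == j then dtheta else theta k) t.
have ct k : continuous (theta k) by exact: (st k 0%N).
have cb : continuous bump_scale := smooth_bump_scale 0%N.
have stau k : smooth (tau k) by move=> m; apply: C1M; [exact: smooth_bump_scale|exact: st].
have i1 : Rintegrable lam (fun x => h x * tensor tau x).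
  apply: (integrable_box_tensor r0 lh) => [i|i t rt]; first exact: (stau i 0%N).
  by rewrite /tau bump_scale_out ?mul0r.
have i2 : Rintegrable lam (fun x => g x * tensor tau1 x).
  apply: (integrable_box_tensor r0 lg) => [i|i t rt]; rewrite /tau1; case: (i == j).
  - by move=> t; apply: cvgM; [exact: continuous_dbump_scale|exact: ct].
  - by move=> t; apply: cvgM; [exact: cb|exact: ct].
  - by rewrite dbump_scale_out ?mul0r.
  - by rewrite bump_scale_out ?mul0r.
have i3 : Rintegrable lam (fun x => g x * tensor tau2 x).
  apply: (integrable_box_tensor r0 lg) => [i|i t rt]; rewrite /tau2.
  - by case: (i == j) => t; (apply: cvgM; first exact: cb); [exact: cdt|exact: ct].
  - by rewrite bump_scale_out ?mul0r.
have t0 k t : r <= `|t| -> tau k t = 0 by move=> rt; rewrite /tau bump_scale_out ?mul0r.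
have dj (t : R) : is_derive t 1 (tau j) (dbump_scale t * theta j t + bump_scale t * dtheta t).
  apply: (is_derive_eq (is_deriveM (is_derive_bump_scale t) (dt _))).
  by rewrite addrC /GRing.scale/= [theta _ _ * _]mulrC.
have cdj : continuous (fun t => dbump_scale t * theta j t + bump_scale t * dtheta t).
  move=> t; apply: cvgD; apply: cvgM;
    [exact: continuous_dbump_scale|exact: ct|exact: cb|exact: cdt].
have d0 (t : R) : r <= `|t| -> dbump_scale t * theta j t + bump_scale t * dtheta t = 0.
  by move=> rt; rewrite dbump_scale_out ?bump_scale_out// !mul0r addr0.
have := wp r tau _ r0 stau dj cdj t0 d0.
rewrite (eq_Rintegral lam (g := fun x => g x * tensor tau1 x + g x * tensor tau2 x)); last first.
  move=> x _; rewrite -mulrDr; congr (_ * _).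
  rewrite tensor_replace.
  have E1 : tensor tau1 x = dbump_scale (x ord0 j) * theta j (x ord0 j) *
      \prod_(k < n | k != j) tau k (x ord0 k).
    rewrite /tensor (bigD1 j)//= /tau1 eqxx; congr (_ * _).
    by apply: eq_bigr => k /negbTE kj; rewrite kj.
  have E2 : tensor tau2 x = bump_scale (x ord0 j) * dtheta (x ord0 j) *
      \prod_(k < n | k != j) tau k (x ord0 k).
    rewrite /tensor (bigD1 j)//= /tau2 eqxx; congr (_ * _).
    by apply: eq_bigr => k /negbTE kj; rewrite kj.
  by rewrite E1 E2 mulrDl.
rewrite RintegralD// => E.
rewrite (eq_Rintegral lam (g := fun x => h x * tensor tau x + g x * tensor tau1 x)); last first.
  by move=> x _; rewrite /cut /dcut mulrDl mulrAC tensorM [_ * h x]mulrC mulrAC tensorM [_ * g x]mulrC.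
rewrite RintegralD//.
rewrite [in RHS](eq_Rintegral lam (g := fun x => g x * tensor tau2 x)); last first.
  by move=> x _; rewrite /cut mulrAC tensorM mulrC.
move: E; set a := Rintegral _ _ _; set b := Rintegral _ _ _; set c := Rintegral _ _ _.
by move=> E; lra.
Qed.

End cutoff.

Section kernel_parts.
Context {R : realType} (n : nat) (rho : R).
Hypothesis rho01 : 0 < rho < 1.
Notation lam := (@lebesgue_rV R n).
Notation K := (mehler_ker rho).
Implicit Types (x y : 'rV[R]_n) (U V : 'rV[R]_n -> R).

Let Kmax : R := (normal_peak 1 * normal_peak (mehler_sd rho)) ^+ n.

Let K_ub x y : `|K x y| <= Kmax.
Proof. by rewrite ger0_norm ?mehler_ker_ge0//; exact: mehler_ker_ub. Qed.

Let measurable_kernel_l y : measurable_fun setT (K ^~ y).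
Proof.
exact: (measurableT_comp (@measurable_mehler_ker R n rho rho01) (measurable_pair2 y)).
Qed.

Lemma integrable_prod U V : Rintegrable lam U -> Rintegrable lam V ->
  Rintegrable (lam \x lam)%E (fun p => U p.1 * V p.2).
Proof.
move=> iU iV; have mU := Rintegrable_measurable iU; have mV := Rintegrable_measurable iV.
apply/integrable12ltyP.
  by apply/measurable_EFinP; apply: measurable_funM;
    [exact: measurable_fst_fun|exact: measurable_snd_fun].
have [_ fV] := integrableP _ _ _ iV; have [_ fU] := integrableP _ _ _ iU.
have mVE : measurable_fun setT (fun y => `|V y|%:E).
  by apply/measurable_EFinP; exact: measurableT_comp.
have mUE : measurable_fun setT (fun y => `|U y|%:E).
  by apply/measurable_EFinP; exact: measurableT_comp.
under eq_integral => x _.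
  under eq_integral => y _ do rewrite /= normrM EFinM.
  rewrite ge0_integralZl//; over.
rewrite ge0_integralZr//; last exact: integral_ge0.
apply: lte_mul_pinfty; [exact: integral_ge0|..|exact: fV].
by rewrite ge0_fin_numE; [exact: fU|exact: integral_ge0].
Qed.

Lemma integrable_prod_kernel U V : Rintegrable lam U -> Rintegrable lam V ->
  Rintegrable (lam \x lam)%E (fun p => U p.1 * V p.2 * K p.1 p.2).
Proof.
move=> iU iV; have iUV := integrable_prod iU iV.
apply: (Rintegrable_le _ (RintegrableZ Kmax (Rintegrable_norm iUV))).
  apply: measurable_funM; first exact: (Rintegrable_measurable iUV).
  exact: measurable_mehler_ker.
by move=> p; rewrite normrM mulrC ler_wpM2r.
Qed.

Lemma integrable_kernel U y : Rintegrable lam U -> Rintegrable lam (fun x => U x * K x y).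
Proof.
move=> iU; apply: (Rintegrable_le _ (RintegrableZ Kmax (Rintegrable_norm iU))).
  by apply: measurable_funM; [exact: Rintegrable_measurable iU|exact: measurable_kernel_l].
by move=> x; rewrite normrM mulrC ler_wpM2r.
Qed.

Lemma integrable_mehler U V : Rintegrable lam U -> Rintegrable lam V ->
  Rintegrable (mehler n rho) (fun p => U p.1 * V p.2).
Proof.
move=> iU iV.
have m : measurable_fun setT (fun p : 'rV[R]_n * 'rV[R]_n => U p.1 * V p.2).
  exact: (Rintegrable_measurable (integrable_prod iU iV)).
apply/(integrable_density (mu := (lam \x lam)%E) (@measurable_mehler_ker _ _ _ rho01)
  (fun p => mehler_ker_ge0 rho p.1 p.2) _ m) => //.
  exact: ge0_integral_mehler_density.
exact: integrable_prod_kernel.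
Qed.

Definition pairing U V : R := \int[mehler n rho]_p (U p.1 * V p.2).
(** This is the conditional expectation of U(X) given Y = y times the Gaussian density at [y].
    Freezing [y] lets the integration by parts take place in [x] alone. *)
Definition smear U y : R := \int[lam]_x (U x * K x y).

Let mehler_ker_ge0_pair (p : 'rV[R]_n * 'rV[R]_n) : 0 <= K p.1 p.2.
Proof. exact: mehler_ker_ge0. Qed.

Let pairingE U V : Rintegrable lam U -> Rintegrable lam V ->
  pairing U V = \int[(lam \x lam)%E]_p (U p.1 * V p.2 * K p.1 p.2).
Proof.
move=> iU iV; have mUV := Rintegrable_measurable (integrable_prod iU iV).
have := Rintegral_density (@mehler_ker_ge0_pair) (@ge0_integral_mehler_density R n rho rho01) mUV.
exact.
Qed.

Let fubiniG U V : Rintegrable lam U -> Rintegrable lam V ->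
  fubini_G lam (EFin \o (fun p => U p.1 * V p.2 * K p.1 p.2)) =
  EFin \o (fun y => V y * smear U y).
Proof.
move=> iU iV; apply/funext => y; rewrite /fubini_G/=.
rewrite -RintegralZl//; last exact: integrable_kernel.
rewrite EFin_Rintegral; last by apply: RintegrableZ; exact: integrable_kernel.
by apply: eq_integral => x _; rewrite -mulrA mulrCA.
Qed.

Lemma integrable_smear U V : Rintegrable lam U -> Rintegrable lam V ->
  Rintegrable lam (fun y => V y * smear U y).
Proof.
move=> iU iV; have := measurable_fubini_G (integrable_prod_kernel iU iV).
rewrite fubiniG// => /measurable_EFinP mG.
apply: (Rintegrable_le mG
  (RintegrableZ (\int[lam]_x (Kmax * `|U x|)) (Rintegrable_norm iV))) => y.
rewrite normrM mulrC ler_wpM2r//.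
have iUK := integrable_kernel y iU.
apply: (le_trans (le_normr_Rintegral measurableT iUK)).
apply: le_Rintegral => //.
- exact: Rintegrable_norm.
- by apply: RintegrableZ; exact: Rintegrable_norm.
- by move=> x _; rewrite normrM mulrC ler_wpM2r.
Qed.

Lemma pairing_smear U V : Rintegrable lam U -> Rintegrable lam V ->
  pairing U V = \int[lam]_y (V y * smear U y).
Proof.
move=> iU iV; rewrite pairingE// /Rintegral; congr fine.
have := integral21_prod_meas1 (integrable_prod_kernel iU iV).
by rewrite fubiniG.
Qed.

(** Symmetry of the kernel plus Fubini's theorem in the other order; it allows integration by parts
    in the second argument too. *)
Lemma pairingC U V : Rintegrable lam U -> Rintegrable lam V ->
  pairing U V = pairing V U.
Proof.
move=> iU iV; rewrite (pairing_smear iV iU) pairingE// /Rintegral; congr fine.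
rewrite -(integral12_prod_meas1 (integrable_prod_kernel iU iV)).
apply: eq_integral => x _; rewrite /fubini_F/= /smear.
rewrite -RintegralZl//; last exact: integrable_kernel.
rewrite EFin_Rintegral; last by apply: RintegrableZ; exact: integrable_kernel.
by apply: eq_integral => y _; rewrite -mulrA mehler_kerC.
Qed.

Lemma pairingDl U1 U2 V : Rintegrable lam U1 -> Rintegrable lam U2 -> Rintegrable lam V ->
  pairing (fun x => U1 x - U2 x) V = pairing U1 V - pairing U2 V.
Proof.
move=> i1 i2 iV; rewrite /pairing -RintegralB//; [|exact: integrable_mehler..].
by apply: eq_Rintegral => p _; rewrite mulrBl.
Qed.

End kernel_parts.

(** * The correlated divergence identity for truncated functions *)

Section cutoff_kernel.
Context {R : realType} (n : nat) (rho r : R).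
Hypotheses (rho01 : 0 < rho < 1) (r0 : 0 < r).
Notation lam := (@lebesgue_rV R n).
Notation K := (mehler_ker rho).
Notation s := (mehler_sd rho).
Implicit Types (x y : 'rV[R]_n) (g h U V : 'rV[R]_n -> R) (i j : 'I_n).

Definition cutF g x : R := cut r x * g x.
(** The weak j-th derivative of [cutF g] by the Leibniz rule, when [h] is that of [g]. *)
Definition cutH j g h x : R := cut r x * h x + dcut r j x * g x.
Definition xmul i U x : R := x ord0 i * U x.

Lemma integrable_cutF g : box_integrable g -> Rintegrable lam (cutF g).
Proof.
move=> lg; rewrite (_ : cutF g = fun x => g x * cut r x); last first.
  by apply/funext => x; rewrite /cutF mulrC.
apply: (integrable_box_tensor r0 lg) => [i|i t rt]; first exact: (smooth_bump_scale _ 0%N).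
exact: bump_scale_out.
Qed.

Lemma integrable_cutH j g h : box_integrable g -> box_integrable h ->
  Rintegrable lam (cutH j g h).
Proof.
move=> lg lh; apply: RintegrableD; first exact: integrable_cutF.
rewrite (_ : (fun x => _) = fun x => g x * dcut r j x); last first.
  by apply/funext => x; rewrite mulrC.
apply: (integrable_box_tensor r0 lg) => [i|i t rt]; case: (i == j).
- exact: continuous_dbump_scale.
- exact: (smooth_bump_scale _ 0%N).
- exact: dbump_scale_out.
- exact: bump_scale_out.
Qed.

Lemma supported_cutF g : supported r (cutF g).
Proof.
move=> x i xi; rewrite /cutF /cut (@tensor_supported _ _ _ r _ x i)// ?mul0r// => k t rt.
by apply: bump_scale_out => //; exact: ltW.
Qed.

Lemma supported_cutH j g h : supported r (cutH j g h).
Proof.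
move=> x i xi; rewrite /cutH /cut /dcut (@tensor_supported _ _ _ r _ x i)//; last first.
  by move=> k t rt; apply: bump_scale_out => //; exact: ltW.
rewrite mul0r add0r (@tensor_supported _ _ _ r _ x i)// ?mul0r// => k t rt.
by case: (k == j); [apply: dbump_scale_out|apply: bump_scale_out] => //; exact: ltW.
Qed.

Lemma supported_xmul i U : supported r U -> supported r (xmul i U).
Proof. by move=> sU x k xk; rewrite /xmul (sU x k)// mulr0. Qed.

Lemma integrable_xmul i U : supported r U -> Rintegrable lam U -> Rintegrable lam (xmul i U).
Proof.
move=> sU iU; apply: (Rintegrable_le _ (RintegrableZ r (Rintegrable_norm iU))).
  by apply: measurable_funM; [exact: measurable_coord|exact: Rintegrable_measurable iU].
move=> x; rewrite /xmul normrM; have [xr|rx] := leP `|x ord0 i| r.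
  by rewrite ler_wpM2r.
by rewrite (sU x i)// normr0 !mulr0.
Qed.

(** The test function is an affine function of one coordinate times the kernel; its j-th derivative
    produces the Gaussian score and, when [i = j], the slope [b]. The choices (1, 0) and (0, 1) of
    [(a, b)] give the plain and the coordinate-weighted formula. *)
Lemma smear_by_parts g h i j (a b : R) y :
  box_integrable g -> tensor_partial j g h ->
  \int[lam]_x (cutH j g h x * ((a + b * x ord0 i) * K x y)) =
  \int[lam]_x (cutF g x * (((a + b * x ord0 i) * (x ord0 j - rho * y ord0 j) / s ^+ 2 -
     (i == j)%:R * b) * K x y)).
Proof.
move=> lg wp.
(* Placing the affine weight in the i-th factor keeps the test function a product of one-variable
   functions. *)
pose p k (t : R) : R := if k == i then a + b * t else 1.
pose theta k (t : R) := p k t * mehler_ker1 rho t (y ord0 k).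
pose dtheta (t : R) : R := (i == j)%:R * b * mehler_ker1 rho t (y ord0 j) +
  (- (t - rho * y ord0 j) / s ^+ 2) * theta j t.
have sk k : smooth (mehler_ker1 rho ^~ (y ord0 k)) by exact: smooth_mehler_ker1.
have sp k : smooth (p k).
  by move=> m; rewrite /p; case: (k == i); [exact: C1_affine|exact: C1_cst].
have st k : smooth (theta k) by move=> m; apply: C1M; [exact: sp|exact: sk].
have dt (t : R) : is_derive t 1 (theta j) (dtheta t).
  have dp : is_derive t 1 (p j) ((i == j)%:R * b).
    have -> : p j = if i == j then (fun t => a + b * t) else cst 1.
      by apply/funext => u; rewrite /p eq_sym; case: ifP.
    case: (i == j); first by rewrite mul1r; exact: is_derive1_affine.
    by rewrite mul0r; exact: is_derive_cst.
  apply: (is_derive_eq (is_deriveM dp (is_derive_mehler_ker1 rho01 t (y ord0 j)))).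
  by rewrite /dtheta /theta /GRing.scale/=; ring.
have cdt : continuous dtheta.
  have : C1 1 (theta j) by exact: st.
  move=> [d [dd cd]]; rewrite (_ : dtheta = d)//; apply/funext => t.
  by have [_ <-] := dt t; have [_ <-] := dd t.
have pE x : \prod_(k < n) p k (x ord0 k) = a + b * x ord0 i.
  rewrite (bigD1 i)//= big1 ?mulr1; first by rewrite /p eqxx.
  by move=> k /negbTE ki; rewrite /p ki.
have tE x : tensor theta x = (a + b * x ord0 i) * K x y.
  by rewrite /tensor big_split/= pE.
pose tau k (t : R) := bump_scale r t * (if k == j then dtheta else theta k) t.
have ctau k : continuous (tau k).
  rewrite /tau; case: (k == j) => t;
    (apply: cvgM; first exact: (smooth_bump_scale _ 0%N)).
    exact: cdt.
  exact: (st _ 0%N).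
have iA : Rintegrable lam (fun x => cutF g x * tensor (fun k => if k == j then dtheta else theta k) x).
  rewrite (_ : (fun x => _) = fun x => g x * tensor tau x); last first.
    by apply/funext => x; rewrite /cutF mulrAC tensorM mulrC.
  apply: (integrable_box_tensor r0 lg) => [k|k t rt]; first exact: ctau.
  by rewrite /tau bump_scale_out ?mul0r.
rewrite (eq_Rintegral lam (g := fun x => cutH j g h x * tensor theta x)); last first.
  by move=> x _; rewrite tE.
rewrite (cut_by_parts r0 lg wp st dt cdt) -mulN1r -RintegralZl//.
apply: eq_Rintegral => x _; rewrite mulrCA; congr (_ * _).
rewrite tensor_replace /dtheta.
pose P := \prod_(k < n | k != j) theta k (x ord0 k).
rewrite -/P mulrDl.
have E1 : theta j (x ord0 j) * P = (a + b * x ord0 i) * K x y.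
  by rewrite -tE /tensor (bigD1 j).
have E2 : (i == j)%:R * b * mehler_ker1 rho (x ord0 j) (y ord0 j) * P = (i == j)%:R * b * K x y.
  have [ij|ij] := eqVneq i j; last by rewrite !mul0r.
  rewrite mul1r -mulrA; congr (_ * _); rewrite /mehler_ker (bigD1 j)//=; congr (_ * _).
  by apply: eq_bigr => k kj; rewrite /theta /p ij (negbTE kj) mul1r.
rewrite E2 -(mulrA _ (theta j _)) E1; ring.
Qed.

(** The score in [x] also contains [rho * y ord0 j]; this factor depends on the second point only
    and is absorbed into [V], so the result is again made of pairings. *)
Lemma pairing_by_parts g h j V : box_integrable g -> tensor_partial j g h ->
  supported r V -> Rintegrable lam V ->
  pairing rho (cutH j g h) V =
  (pairing rho (xmul j (cutF g)) V - rho * pairing rho (cutF g) (xmul j V)) / s ^+ 2.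
Proof.
move=> lg wp sV iV; have [lh _] := wp.
have iF := integrable_cutF lg; have iH := integrable_cutH j lg lh.
have iXF := integrable_xmul j (supported_cutF g) iF.
have iXV := integrable_xmul j sV iV.
have E y : smear rho (cutH j g h) y =
    (s ^+ 2)^-1 * (smear rho (xmul j (cutF g)) y - rho * y ord0 j * smear rho (cutF g) y).
  have := @smear_by_parts g h j j 1 0 y lg wp.
  rewrite (eq_Rintegral lam (g := fun x => cutH j g h x * K x y)); last first.
    by move=> x _; rewrite mul0r addr0 mul1r.
  rewrite /smear => ->.
  rewrite -(RintegralZl (rho * y ord0 j) measurableT (integrable_kernel rho01 y iF)).
  have iy := RintegrableZ (rho * y ord0 j) (integrable_kernel rho01 y iF).
  rewrite -(RintegralB measurableT (integrable_kernel rho01 y iXF) iy).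
  rewrite -RintegralZl//; last by apply: RintegrableB => //; exact: integrable_kernel.
  apply: eq_Rintegral => x _; rewrite /xmul; ring.
rewrite !pairing_smear//.
rewrite (eq_Rintegral lam (g := fun y => (s ^+ 2)^-1 *
  (V y * smear rho (xmul j (cutF g)) y - rho * (xmul j V y * smear rho (cutF g) y)))); last first.
  by move=> y _; rewrite E /xmul; ring.
have i1 := integrable_smear rho01 iXF iV.
have i2 := integrable_smear rho01 iF iXV.
rewrite RintegralZl//; last by apply: RintegrableB => //; exact: RintegrableZ.
rewrite RintegralB//; last exact: RintegrableZ.
by rewrite RintegralZl// mulrC.
Qed.

Lemma pairing_xmul_by_parts g h i j V : box_integrable g -> tensor_partial j g h ->
  supported r V -> Rintegrable lam V ->
  pairing rho (xmul i (cutH j g h)) V =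
  (pairing rho (xmul i (xmul j (cutF g))) V - rho * pairing rho (xmul i (cutF g)) (xmul j V)) / s ^+ 2
  - (i == j)%:R * pairing rho (cutF g) V.
Proof.
move=> lg wp sV iV; have [lh _] := wp.
have iF := integrable_cutF lg; have iH := integrable_cutH j lg lh.
have iXH := integrable_xmul i (supported_cutH j g h) iH.
have iXF := integrable_xmul j (supported_cutF g) iF.
have iXiF := integrable_xmul i (supported_cutF g) iF.
have iXXF := integrable_xmul i (supported_xmul j (supported_cutF g)) iXF.
have iXV := integrable_xmul j sV iV.
have E y : smear rho (xmul i (cutH j g h)) y =
    (s ^+ 2)^-1 * (smear rho (xmul i (xmul j (cutF g))) y -
       rho * y ord0 j * smear rho (xmul i (cutF g)) y) - (i == j)%:R * smear rho (cutF g) y.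
  have := @smear_by_parts g h i j 0 1 y lg wp.
  rewrite (eq_Rintegral lam (g := fun x => xmul i (cutH j g h) x * K x y)); last first.
    by move=> x _; rewrite /xmul; ring.
  rewrite /smear => ->.
  have iy := RintegrableZ (rho * y ord0 j) (integrable_kernel rho01 y iXiF).
  have iK := integrable_kernel rho01 y iF.
  have iK2 := integrable_kernel rho01 y iXXF.
  rewrite -(RintegralZl (rho * y ord0 j) measurableT (integrable_kernel rho01 y iXiF)).
  rewrite -(RintegralB measurableT iK2 iy).
  have iB := RintegrableB iK2 iy.
  rewrite -(RintegralZl (s ^- 2) measurableT iB) -(RintegralZl (i == j)%:R measurableT iK).
  rewrite -(RintegralB measurableT (RintegrableZ (s ^- 2) iB) (RintegrableZ (i == j)%:R iK)).
  apply: eq_Rintegral => x _; rewrite /xmul; ring.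
rewrite !pairing_smear//.
rewrite (eq_Rintegral lam (g := fun y => (s ^+ 2)^-1 *
  (V y * smear rho (xmul i (xmul j (cutF g))) y - rho * (xmul j V y * smear rho (xmul i (cutF g)) y))
  - (i == j)%:R * (V y * smear rho (cutF g) y))); last first.
  by move=> y _; rewrite E /xmul; ring.
have i1 := integrable_smear rho01 iXXF iV.
have i2 := integrable_smear rho01 iXiF iXV.
have i3 := integrable_smear rho01 iF iV.
have i12 := RintegrableB i1 (RintegrableZ rho i2).
rewrite RintegralB//; [|exact: RintegrableZ|exact: RintegrableZ].
congr (_ - _); last exact: (RintegralZl (i == j)%:R measurableT i3).
rewrite [LHS](RintegralZl (s ^- 2) measurableT i12) mulrC; congr (_ * _).
rewrite [LHS](RintegralB measurableT i1 (RintegrableZ rho i2)); congr (_ - _).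
exact: (RintegralZl rho measurableT i2).
Qed.

(** Every derivative on either side is removed by parts until only pairings of [cutF g1] and
    [cutF g2] weighted by coordinates remain. The rest is a rational identity in [rho], with
    denominators powers of [1 - rho ^+ 2]. *)
Lemma pairing_divergence g1 h1i h1j g2 h2i h2j i j :
  box_integrable g1 -> box_integrable g2 ->
  tensor_partial i g1 h1i -> tensor_partial j g1 h1j ->
  tensor_partial i g2 h2i -> tensor_partial j g2 h2j ->
  pairing rho (fun x => xmul i (cutF g1) x - cutH i g1 h1i x)
              (fun x => xmul j (cutF g2) x - cutH j g2 h2j x) =
  rho * ((i == j)%:R * pairing rho (cutF g1) (cutF g2)) +
  rho ^+ 2 * pairing rho (cutH j g1 h1j) (cutH i g2 h2i).
Proof.
move=> lg1 lg2 w1i w1j w2i w2j.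
have [l1i _] := w1i; have [l1j _] := w1j; have [l2i _] := w2i; have [l2j _] := w2j.
have i1 := integrable_cutF lg1; have i2 := integrable_cutF lg2.
have s1 := supported_cutF g1; have s2 := supported_cutF g2.
have iH1i := integrable_cutH i lg1 l1i; have iH1j := integrable_cutH j lg1 l1j.
have iH2i := integrable_cutH i lg2 l2i; have iH2j := integrable_cutH j lg2 l2j.
have sH1i := @supported_cutH i g1 h1i; have sH1j := @supported_cutH j g1 h1j.
have sH2i := @supported_cutH i g2 h2i; have sH2j := @supported_cutH j g2 h2j.
have X U k (sU : supported r U) (iU : Rintegrable lam U) := integrable_xmul k sU iU.
have SX := supported_xmul.
have iX1i := X _ i s1 i1; have iX1j := X _ j s1 i1.
have iX2i := X _ i s2 i2; have iX2j := X _ j s2 i2.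
rewrite pairingDl//; last exact: RintegrableB.
have swap U V1 V2 : Rintegrable lam U -> Rintegrable lam V1 -> Rintegrable lam V2 ->
    pairing rho U (fun x => V1 x - V2 x) = pairing rho U V1 - pairing rho U V2.
  move=> iU iV1 iV2; rewrite pairingC//; last exact: RintegrableB.
  by rewrite pairingDl// ![pairing rho U _]pairingC.
rewrite !swap//.
have q0 : 1 - rho ^+ 2 != 0 by rewrite gt_eqF//; move: rho01; nra.
have C U V (iU : Rintegrable lam U) (iV : Rintegrable lam V) := pairingC rho01 iU iV.
(* The formulas by parts act on the first argument, so a derivative in the second one is first
   brought forward by symmetry. *)
rewrite (C _ _ iX1i iH2j) (pairing_by_parts lg2 w2j (SX _ _ s1) iX1i).
rewrite (pairing_by_parts lg1 w1i (SX _ _ s2) iX2j).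
rewrite (pairing_by_parts lg1 w1i sH2j iH2j).
rewrite (C _ _ iX1i iH2j) (pairing_by_parts lg2 w2j (SX _ _ s1) iX1i).
rewrite (C _ _ i1 (X _ i sH2j iH2j)) (pairing_xmul_by_parts i lg2 w2j s1 i1).
rewrite (pairing_by_parts lg1 w1j sH2i iH2i).
rewrite (C _ _ iX1j iH2i) (pairing_by_parts lg2 w2i (SX _ _ s1) iX1j).
rewrite (C _ _ i1 (X _ j sH2i iH2i)) (pairing_xmul_by_parts j lg2 w2i s1 i1).
rewrite (C _ _ iX2j iX1i) (C _ _ iX2i iX1j) (C _ _ i2 i1) [j == i]eq_sym.
have xx U : xmul j (xmul i U) = xmul i (xmul j U).
  by apply/funext => x; rewrite /xmul mulrCA.
rewrite !xx (C _ _ i2 (X _ i (SX _ _ s1) iX1j)) (C _ _ (X _ i (SX _ _ s2) iX2j) i1).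
rewrite (mehler_sd_sqr rho01); field.
exact: q0.
Qed.

End cutoff_kernel.

(** * The second order Stein formula *)

Section square_integrable.
Context d (T : measurableType d) (R : realType) (mu : {measure set T -> \bar R}).
Implicit Types u v : T -> R.

Definition L2 u := measurable_fun setT u /\ Rintegrable mu (fun x => u x ^+ 2).

Lemma L2_le u v : measurable_fun setT u -> L2 v -> (forall x, `|u x| <= `|v x|) -> L2 u.
Proof.
move=> mu' [mv iv] uv; split => //; apply: (Rintegrable_le _ iv).
  exact: measurable_funX.
move=> x; rewrite ger0_norm ?sqr_ge0//.
by rewrite -(real_normK (num_real (u x))) -(real_normK (num_real (v x))) lerXn2r ?nnegrE.
Qed.

Lemma L2D u v : L2 u -> L2 v -> L2 (fun x => u x + v x).
Proof.
move=> [mu' iu] [mv iv]; split; first exact: measurable_funD.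
apply: (Rintegrable_le _ (RintegrableD (RintegrableZ 2 iu) (RintegrableZ 2 iv))).
  by apply: measurable_funX; exact: measurable_funD.
by move=> x; rewrite ger0_norm ?sqr_ge0//; have := sqr_ge0 (u x - v x); nra.
Qed.

Lemma L2Z (c : R) u : L2 u -> L2 (fun x => c * u x).
Proof.
move=> [mu' iu]; split; first exact: measurable_funM.
rewrite (_ : (fun x => _) = fun x => c ^+ 2 * u x ^+ 2); last first.
  by apply/funext => x; rewrite exprMn.
exact: RintegrableZ.
Qed.

Lemma L2B u v : L2 u -> L2 v -> L2 (fun x => u x - v x).
Proof.
move=> Lu Lv; have := L2D Lu (L2Z (-1) Lv).
by rewrite (_ : (fun x => _) = fun x => u x - v x)//; apply/funext => x; rewrite mulN1r.
Qed.

Lemma L2_norm u : L2 u -> L2 (fun x => `|u x|).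
Proof.
move=> Lu; apply: (L2_le _ Lu) => [|x]; last by rewrite normr_id.
by apply: measurableT_comp => //; case: Lu.
Qed.

Lemma L2_0 : L2 (fun=> 0).
Proof.
split => //; rewrite (_ : (fun=> _) = fun=> 0); first exact: integrable0.
by apply/funext => x; rewrite expr0n.
Qed.

Lemma L2_sum I (s : seq I) (u : I -> T -> R) : (forall i, L2 (u i)) ->
  L2 (fun x => \sum_(i <- s) u i x).
Proof.
move=> Lu; elim: s => [|i s IHs].
  by under eq_fun do rewrite big_nil; exact: L2_0.
by under eq_fun do rewrite big_cons; exact: L2D.
Qed.

Lemma L2_mul u v : L2 u -> L2 v -> Rintegrable mu (fun x => u x * v x).
Proof. by move=> [? ?] [? ?]; exact: Rintegrable_mul. Qed.

Lemma cvg_Rintegral (f_ : nat -> T -> R) (f G : T -> R) :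
  (forall k, measurable_fun setT (f_ k)) -> measurable_fun setT f ->
  (forall x, f_ k x @[k --> \oo] --> f x) -> Rintegrable mu G ->
  (forall k x, `|f_ k x| <= G x) ->
  \int[mu]_x f_ k x @[k --> \oo] --> \int[mu]_x f x.
Proof.
move=> mf_ mf ff iG fG.
have [|||||fi _ fc] := @dominated_convergence _ _ _ mu setT measurableT
  (fun k => EFin \o f_ k) (EFin \o f) (EFin \o G).
- by move=> k; exact/measurable_EFinP.
- exact/measurable_EFinP.
- by apply: aeW => x _; apply: cvg_EFin; [exact: nearW|exact: ff].
- exact: iG.
- by apply: aeW => x k _; rewrite /= lee_fin.
apply: fine_cvg; rewrite fineK//; exact: integrable_fin_num.
Qed.

End square_integrable.

Section pairing_sum.
Context {R : realType} (n : nat) (rho : R).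
Hypothesis rho01 : 0 < rho < 1.
Notation lam := (@lebesgue_rV R n).

Lemma pairing_sum2 (D : 'I_n -> 'rV[R]_n -> R) : (forall i, Rintegrable lam (D i)) ->
  pairing rho (fun x => \sum_(i < n) D i x) (fun x => \sum_(i < n) D i x) =
  \sum_(i < n) \sum_(j < n) pairing rho (D i) (D j).
Proof.
move=> iD; rewrite /pairing.
rewrite (eq_Rintegral _ (g := fun p => \sum_(i < n) \sum_(j < n) D i p.1 * D j p.2)); last first.
  by move=> p _; rewrite mulr_suml; apply: eq_bigr => i _; rewrite mulr_sumr.
rewrite Rintegral_sum; last first.
  by move=> i; apply: Rintegrable_sum => j; exact: integrable_mehler.
apply: eq_bigr => i _; rewrite Rintegral_sum// => j; exact: integrable_mehler.
Qed.

End pairing_sum.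

Section divergence.
Context {R : realType} (n : nat).
Notation lam := (@lebesgue_rV R n).
Notation gam := (@gaussian_rV R n 1).
Implicit Types x : 'rV[R]_n.
Variables (g : 'I_n -> 'rV[R]_n -> R) (h : 'I_n -> 'I_n -> 'rV[R]_n -> R).
Hypotheses (lg : forall j, box_integrable (g j))
  (wh : forall i j, tensor_partial i (g j) (h i j))
  (L2g : forall j, L2 gam (g j)) (L2h : forall i j, L2 gam (h i j)).

(** One constant for all radii, with derivatives of order [1 / r]: this yields domination as the
    radius grows and makes the derivative of the cutoff disappear in the limit. *)
Lemma cut_bounded : exists2 C : R, 0 <= C & forall (r : R) x, 0 < r -> `|cut r x| <= C /\
  forall j : 'I_n, `|dcut r j x| <= C / r.
Proof.
have [B B0 hB] := @bumpR_bound R.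
have hBn : B ^+ n = \prod_(k < n) B by rewrite prodr_const card_ord.
(* One factor [B] per coordinate; [B] bounds both the bump and its derivative, so replacing a factor
   costs only [1 / r]. *)
exists (B ^+ n); first exact: exprn_ge0.
move=> r x r0; split.
  rewrite /cut /tensor normr_prod hBn; apply: ler_prod => k _.
  by rewrite normr_ge0/=; have [] := hB (0 + r^-1 * x ord0 k).
have rE : `|r^-1| = r^-1 by rewrite ger0_norm ?invr_ge0 ?ltW.
move=> j; rewrite /dcut tensor_replace /dbump_scale mulrAC normrM rE.
rewrite ler_wpM2r ?invr_ge0 ?(ltW r0)// normrM normr_prod hBn [\prod_(k < n) B](bigD1 j)//=.
apply: ler_pM; [exact: normr_ge0|exact: prodr_ge0|..].
  by have [_] := hB (0 + r^-1 * x ord0 j); exact.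
by apply: ler_prod => k _; rewrite normr_ge0/=; have [] := hB (0 + r^-1 * x ord0 k).
Qed.

Lemma cvg_cut x : cut k.+1%:R x @[k --> \oo] --> (1 : R).
Proof.
have ct : continuous (tensor (fun=> @bumpR R) : 'rV[R]_n -> R).
  by apply: continuous_tensor => i; exact: (smooth_bumpR 0%N).
rewrite [X in _ --> X](_ : _ = tensor (fun=> @bumpR R) (0 *: x)); last first.
  by rewrite /tensor big1// => i _; rewrite !mxE mul0r bumpR0.
rewrite (_ : (fun k => _) = tensor (fun=> @bumpR R) \o (fun k => (k.+1%:R : R)^-1 *: x)); last first.
  apply/funext => k; rewrite /cut /tensor /=; apply: eq_bigr => i _.
  by rewrite /bump_scale add0r mxE.
apply: cvg_comp; last exact: ct.
by apply: cvgZr_tmp; exact: cvg_harmonic.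
Qed.

Lemma cvg_dcut j x : dcut k.+1%:R j x @[k --> \oo] --> (0 : R).
Proof.
have [C C0 hC] := cut_bounded.
apply/norm_cvg0P.
apply: (@squeeze_cvgr _ _ _ _ (cst 0) (fun k => C * (k.+1%:R)^-1)).
- near=> k; rewrite normr_ge0/=.
  by have [_] := hC k.+1%:R x (ltr0Sn _ _); exact.
- exact: cvg_cst.
- rewrite -[X in _ --> X](mulr0 C); apply: cvgM; first exact: cvg_cst.
  exact: cvg_harmonic.
Unshelve. all: by end_near. Qed.

Lemma cvg_sum_nat I (s : seq I) (a : I -> nat -> R) (l : I -> R) :
  (forall i, a i N @[N --> \oo] --> l i) ->
  \sum_(i <- s) a i N @[N --> \oo] --> \sum_(i <- s) l i.
Proof.
move=> al; elim: s => [|i s IHs].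
  rewrite big_nil (_ : (fun N => _) = fun=> 0); first exact: cvg_cst.
  by apply/funext => N; rewrite big_nil.
rewrite big_cons (_ : (fun N => _) = fun N => a i N + \sum_(j <- s) a j N); first exact: cvgD.
by apply/funext => N; rewrite big_cons.
Qed.

(** The Gaussian divergence, adjoint of the gradient for the standard Gaussian measure. *)
Definition divg x : R := \sum_(i < n) (x ord0 i * g i x - h i i x).

Section fixed_radius.
Variable r : R.
Hypothesis r0 : 0 < r.

Notation F j := (cutF r (g j)).
Notation H i j := (cutH r i (g j) (h i j)).

Definition cut_divg x : R := \sum_(i < n) (xmul i (F i) x - H i i x).

Lemma measurable_cut : measurable_fun setT (cut r : 'rV[R]_n -> R).
Proof. by apply: measurable_tensor => i; exact: (smooth_bump_scale _ 0%N). Qed.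

Lemma measurable_dcut j : measurable_fun setT (dcut r j : 'rV[R]_n -> R).
Proof.
apply: measurable_tensor => i; case: (i == j); first exact: continuous_dbump_scale.
exact: (smooth_bump_scale _ 0%N).
Qed.

Lemma L2_cutF j : L2 gam (F j).
Proof.
have [C C0 hC] := cut_bounded; apply: (L2_le _ (L2Z C (L2g j))).
  by apply: measurable_funM; [exact: measurable_cut|case: (L2g j)].
move=> x; rewrite /cutF !normrM ler_wpM2r// (ger0_norm C0).
by have [] := hC r x r0.
Qed.

Lemma L2_cutH i j : L2 gam (H i j).
Proof.
have [C C0 hC] := cut_bounded; apply: L2D.
  apply: (L2_le _ (L2Z C (L2h i j))).
    by apply: measurable_funM; [exact: measurable_cut|case: (L2h i j)].
  move=> x; rewrite !normrM ler_wpM2r// (ger0_norm C0).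
  by have [] := hC r x r0.
apply: (L2_le _ (L2Z (C / r) (L2g j))).
  by apply: measurable_funM; [exact: measurable_dcut|case: (L2g j)].
move=> x; rewrite !normrM ler_wpM2r// normfV (ger0_norm C0) (gtr0_norm r0).
by have [_] := hC r x r0; exact.
Qed.

Lemma L2_xmul i u : supported r u -> L2 gam u -> L2 gam (xmul i u).
Proof.
move=> su Lu; apply: (L2_le _ (L2Z r Lu)).
  by apply: measurable_funM; [exact: measurable_coord|case: Lu].
move=> x; rewrite !normrM (gtr0_norm r0); have [xr|rx] := leP `|x ord0 i| r.
  by rewrite ler_wpM2r.
by rewrite (su x i)// normr0 !mulr0.
Qed.

Lemma L2_cut_divg : L2 gam cut_divg.
Proof.
apply: L2_sum => i; apply: L2B; last exact: L2_cutH.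
by apply: L2_xmul; [exact: supported_cutF|exact: L2_cutF].
Qed.

(** The limit in [rho] needs each summand of [cut_divg] in L2, and this is where the fixed radius
    matters: [L2_xmul] bounds the coordinate by [r] on the support. The Kronecker factor collapses
    the first double sum to its diagonal. *)
Lemma cut_divergence :
  \int[gam]_x (cut_divg x ^+ 2) = \sum_(j < n) \int[gam]_x (F j x ^+ 2) +
  \sum_(i < n) \sum_(j < n) \int[gam]_x (H j i x * H i j x).
Proof.
have lh i j : box_integrable (h i j) by have [] := wh i j.
have iF j : Rintegrable lam (F j) by exact: integrable_cutF.
have iH i j : Rintegrable lam (H i j) by exact: integrable_cutH.
have E N : pairing (rho_ N) cut_divg cut_divg =
    rho_ N * (\sum_(j < n) pairing (rho_ N) (F j) (F j)) +
    rho_ N ^+ 2 * (\sum_(i < n) \sum_(j < n) pairing (rho_ N) (H j i) (H i j)).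
  rewrite pairing_sum2//; last 2 first.
  - exact: rho_01.
  - move=> i; apply: RintegrableB => //.
    by apply: (integrable_xmul (r := r)) => //; exact: supported_cutF.
  rewrite !mulr_sumr -big_split/=; apply: eq_bigr => i _.
  rewrite mulr_sumr.
  transitivity (\sum_(j < n) (rho_ N * ((i == j)%:R * pairing (rho_ N) (F i) (F j)) +
      rho_ N ^+ 2 * pairing (rho_ N) (H j i) (H i j))).
    by apply: eq_bigr => j _; apply: pairing_divergence => //; exact: rho_01.
  rewrite big_split/=; congr (_ + _); rewrite -mulr_sumr; congr (_ * _).
  rewrite (bigD1 i)//= eqxx mul1r big1 ?addr0// => j ji.
  by rewrite eq_sym (negbTE ji) mul0r.
have mc := (L2_cut_divg).1.
have c1 : pairing (rho_ N) cut_divg cut_divg @[N --> \oo] --> \int[gam]_x (cut_divg x * cut_divg x).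
  by apply: cvg_pairing_L2 => //; exact: (L2_cut_divg).2.
have cF : \sum_(j < n) pairing (rho_ N) (F j) (F j) @[N --> \oo] -->
    \sum_(j < n) \int[gam]_x (F j x * F j x).
  apply: cvg_sum_nat => j; have [mF LF] := L2_cutF j; exact: cvg_pairing_L2.
have cH : \sum_(i < n) \sum_(j < n) pairing (rho_ N) (H j i) (H i j) @[N --> \oo] -->
    \sum_(i < n) \sum_(j < n) \int[gam]_x (H j i x * H i j x).
  apply: cvg_sum_nat => i; apply: cvg_sum_nat => j.
  by have [? ?] := L2_cutH i j; have [? ?] := L2_cutH j i; exact: cvg_pairing_L2.
have cr := @cvg_rho_ R.
have cr2 : rho_ N ^+ 2 @[N --> \oo] --> (1 : R).
  rewrite (_ : (fun N => _) = fun N => rho_ N * rho_ N); last first.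
    by apply/funext => N; rewrite expr2.
  by rewrite -[X in _ --> X](mulr1 1); exact: (cvgM (@cvg_rho_ R) (@cvg_rho_ R)).
have c2 : pairing (rho_ N) cut_divg cut_divg @[N --> \oo] -->
   (\sum_(j < n) \int[gam]_x (F j x * F j x) +
    \sum_(i < n) \sum_(j < n) \int[gam]_x (H j i x * H i j x)).
  rewrite (_ : (fun N => _) = fun N =>
    rho_ N * (\sum_(j < n) pairing (rho_ N) (F j) (F j)) +
    rho_ N ^+ 2 * (\sum_(i < n) \sum_(j < n) pairing (rho_ N) (H j i) (H i j))); last exact/funext.
  rewrite -[X in _ --> X + _]mul1r -[X in _ --> _ + X]mul1r.
  by apply: cvgD; [exact: cvgM cr cF|exact: cvgM cr2 cH].
transitivity (\int[gam]_x (cut_divg x * cut_divg x)).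
  by apply: eq_Rintegral => x _; rewrite expr2.
by rewrite (cvg_unique _ c1 c2).
Qed.

End fixed_radius.

Lemma cut_divgE k x : cut_divg k x = cut k x * divg x - \sum_(i < n) dcut k i x * g i x.
Proof.
rewrite /cut_divg /divg mulr_sumr -sumrB; apply: eq_bigr => i _.
by rewrite /xmul /cutF /cutH; ring.
Qed.

Lemma cvg_cutF j x : cutF k.+1%:R (g j) x @[k --> \oo] --> g j x.
Proof.
rewrite -[X in _ --> X]mul1r; apply: cvgM; [exact: cvg_cut|exact: cvg_cst].
Qed.

Lemma cvg_cutH i j x : cutH k.+1%:R i (g j) (h i j) x @[k --> \oo] --> h i j x.
Proof.
rewrite -[X in _ --> X]addr0 -[X in _ --> X + _]mul1r -[X in _ --> _ + X](mul0r (g j x)).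
by apply: cvgD; apply: cvgM; [exact: cvg_cut|exact: cvg_cst|exact: cvg_dcut|exact: cvg_cst].
Qed.

Lemma cvg_cut_divg x : cut_divg k.+1%:R x @[k --> \oo] --> divg x.
Proof.
apply: cvg_sum_nat => i; apply: cvgB; last exact: cvg_cutH.
by apply: cvgM; [exact: cvg_cst|exact: cvg_cutF].
Qed.

Let rhs := \sum_(j < n) \int[gam]_x (g j x ^+ 2) +
  \sum_(i < n) \sum_(j < n) \int[gam]_x (h j i x * h i j x).

(** The limit is taken on the right-hand side of the truncated identity, where only [g] and [h]
    occur and domination is available; the integrand on the left still carries coordinate
    factors. *)
Lemma cvg_int_cut_divg : \int[gam]_x (cut_divg k.+1%:R x ^+ 2) @[k --> \oo] --> rhs.
Proof.
have [C C0 hC] := cut_bounded.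
rewrite (_ : (fun k => _) = fun k : nat => \sum_(j < n) \int[gam]_x (cutF k.+1%:R (g j) x ^+ 2) +
  \sum_(i < n) \sum_(j < n) \int[gam]_x (cutH k.+1%:R j (g i) (h j i) x * cutH k.+1%:R i (g j) (h i j) x)); last first.
  by apply/funext => k; rewrite cut_divergence.
(* The radii [k.+1] are at least 1, so [C / r <= C] and one majorant dominates all truncated
   derivatives. *)
pose M i j x := C * (`|h i j x| + `|g j x|).
have LM i j : L2 gam (M i j) by apply: L2Z; apply: L2D; exact: L2_norm.
have cutC k x : `|cut (k.+1%:R : R) x| <= C by have [] := hC k.+1%:R x (ltr0Sn _ _).
have dcutC k j x : `|dcut (k.+1%:R : R) j x| <= C.
  have [_ /(_ j) /le_trans] := hC k.+1%:R x (ltr0Sn _ _); apply.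
  by rewrite ler_pdivrMr// ler_peMr// ler1n.
have HM k i j x : `|cutH k.+1%:R i (g j) (h i j) x| <= M i j x.
  rewrite /cutH /M mulrDr (le_trans (ler_normD _ _))// !normrM.
  by apply: lerD; rewrite ler_wpM2r.
apply: cvgD.
  apply: cvg_sum_nat => j.
  apply: (@cvg_Rintegral _ _ _ _ _ _ (fun x => (C * g j x) ^+ 2)).
  - by move=> k; apply: measurable_funX; case: (L2_cutF (ltr0Sn R k) j).
  - by apply: measurable_funX; case: (L2g j).
  - by move=> x; rewrite expr2; under eq_fun do rewrite expr2; apply: cvgM; exact: cvg_cutF.
  - by case: (L2Z C (L2g j)).
  - move=> k x; rewrite normrX -(real_normK (num_real (C * _))) lerXn2r ?nnegrE//.
    by rewrite /cutF !normrM (ger0_norm C0) ler_wpM2r.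
apply: cvg_sum_nat => i; apply: cvg_sum_nat => j.
apply: (@cvg_Rintegral _ _ _ _ _ _ (fun x => M j i x * M i j x)).
- by move=> k; apply: measurable_funM; [case: (L2_cutH (ltr0Sn R k) j i)|case: (L2_cutH (ltr0Sn R k) i j)].
- by apply: measurable_funM; [case: (L2h j i)|case: (L2h i j)].
- by move=> x; apply: cvgM; exact: cvg_cutH.
- exact: L2_mul.
- by move=> k x; rewrite normrM ler_pM.
Qed.

Lemma measurable_divg : measurable_fun setT divg.
Proof.
apply: measurable_sum => i; apply: measurable_funB; last by case: (L2h i i).
by apply: measurable_funM; [exact: measurable_coord|case: (L2g i)].
Qed.

(* Fatou's lemma gives integrability first; only then is the sequence dominated. *)
Lemma L2_divg : L2 gam divg.
Proof.
have md := measurable_divg; split => //.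
apply: Rintegrable_lty; [exact: measurable_funX|by move=> x; exact: sqr_ge0|].
have mk k : measurable_fun setT (fun x => (cut_divg k.+1%:R x ^+ 2)%:E).
  by apply/measurable_EFinP; apply: measurable_funX; case: (L2_cut_divg (ltr0Sn R k)).
apply: (@le_lt_trans _ _ rhs%:E); last exact: ltry.
have ck x : (cut_divg k.+1%:R x ^+ 2)%:E @[k --> \oo] --> (divg x ^+ 2)%:E.
  apply: cvg_EFin; first exact: nearW.
  by rewrite expr2 /=; apply: (cvg_trans _ (cvgM (cvg_cut_divg (x := x)) (cvg_cut_divg (x := x)))); apply: near_eq_cvg; apply: nearW => k /=; rewrite expr2.
rewrite (eq_integral (fun x => limn_einf (fun k => (cut_divg k.+1%:R x ^+ 2)%:E))); last first.
  by move=> x _; rewrite (cvg_limn_einf_sup (ck x)).1.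
apply: (le_trans (fatou gam measurableT mk _)) => [k x _|].
  by rewrite lee_fin sqr_ge0.
rewrite (_ : (fun k => _) = EFin \o (fun k : nat => \int[gam]_x (cut_divg k.+1%:R x ^+ 2))); last first.
  by apply/funext => k /=; rewrite EFin_Rintegral//; case: (L2_cut_divg (ltr0Sn R k)).
rewrite (_ : limn_einf _ = rhs%:E)//; apply: (cvg_limn_einf_sup _).1.
by apply: cvg_EFin; [exact: nearW|exact: cvg_int_cut_divg].
Qed.

Lemma gauss_divergence : \int[gam]_x (divg x ^+ 2) = rhs.
Proof.
have [C C0 hC] := cut_bounded.
(* The majorant suggested by [cut_divgE]; it is square integrable thanks to [L2_divg]. *)
pose G x := C * `|divg x| + \sum_(i < n) C * `|g i x|.
have LG : L2 gam G.
  apply: L2D; first by apply: L2Z; apply: L2_norm; exact: L2_divg.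
  by apply: L2_sum => i; apply: L2Z; exact: L2_norm.
have := cvg_int_cut_divg.
have : \int[gam]_x (cut_divg k.+1%:R x ^+ 2) @[k --> \oo] --> \int[gam]_x (divg x ^+ 2).
  apply: (@cvg_Rintegral _ _ _ _ _ _ (fun x => G x ^+ 2)).
  - by move=> k; apply: measurable_funX; case: (L2_cut_divg (ltr0Sn R k)).
  - by apply: measurable_funX; exact: measurable_divg.
  - by move=> x; rewrite expr2; under eq_fun do rewrite expr2; apply: cvgM; exact: cvg_cut_divg.
  - by case: LG.
  - move=> k x; rewrite normrX lerXn2r ?nnegrE//.
      by rewrite addr_ge0 ?mulr_ge0 ?sumr_ge0// => i _; rewrite mulr_ge0.
    rewrite cut_divgE (le_trans (ler_normB _ _))// lerD//.
      by rewrite normrM ler_wpM2r//; have [] := hC k.+1%:R x (ltr0Sn _ _).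
    rewrite (le_trans (ler_norm_sum _ _ _))// ler_sum// => i _.
    rewrite normrM ler_wpM2r//; have [_ /(_ i) /le_trans] := hC k.+1%:R x (ltr0Sn _ _); apply.
    by rewrite ler_pdivrMr// ler_peMr// ler1n.
by move=> c1 c2; exact: (cvg_unique _ c1 c2).
Qed.

End divergence.

(** * Affine changes of variables and uniqueness of weak derivatives *)

Section affine.
Context {R : realType} (n : nat).
Notation lam := (@lebesgue_rV R n).
Implicit Types (x c : 'rV[R]_n) (s r : R) (f g h : 'rV[R]_n -> R).

Lemma Rintegral_affine s c f : 0 < s -> Rintegrable lam f ->
  Rintegrable lam (fun x => f (c + s *: x)) /\
  \int[lam]_x f x = s ^+ n * \int[lam]_x f (c + s *: x).
Proof.
move=> s0 iF; have mf := Rintegrable_measurable iF.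
have mfa := measurableT_comp mf (measurable_affine_rV c s).
have mfE : measurable_fun setT (EFin \o f) by exact/measurable_EFinP.
have sn0 : 0 < s ^+ n by exact: exprn_gt0.
have ifa : Rintegrable lam (fun x => f (c + s *: x)).
  apply/integrableP; split; first exact/measurable_EFinP.
  have /integrableP[_] := iF.
  rewrite (ge0_integral_lebesgue_rV_affine s0 c)//; last first.
    by apply/measurable_EFinP; exact: measurableT_comp.
  move=> foo; rewrite ltNge leye_eq; apply/negP => /eqP E; move: foo.
  by rewrite E gt0_muley ?ltxx// lte_fin.
split => //; apply: EFin_inj.
rewrite EFinM !EFin_Rintegral// [LHS]integralE [in RHS]integralE muleBr//; last first.
  exact: (integrable_add_def measurableT ifa).
rewrite (ge0_integral_lebesgue_rV_affine s0 c (measurable_funepos mfE))//.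
rewrite (ge0_integral_lebesgue_rV_affine s0 c (measurable_funeneg mfE))//.
by congr (_ * _ - _ * _)%E; apply: eq_integral => x _; rewrite ?funeposE ?funenegE.
Qed.

Lemma row_bounded c : exists2 C : R, 0 <= C & forall i, `|c ord0 i| <= C.
Proof.
exists (\sum_(i < n) `|c ord0 i|); first exact: sumr_ge0.
by move=> i; rewrite (bigD1 i)//= lerDl sumr_ge0.
Qed.

Lemma box_integrable_affine c s g : 0 < s -> box_integrable g ->
  box_integrable (fun x => g (c + s *: x)).
Proof.
move=> s0 [mg ig].
have mga : measurable_fun setT (fun x => g (c + s *: x)).
  exact: (measurableT_comp mg (measurable_affine_rV c s)).
split => // r; have [C C0 hC] := row_bounded c.
have [iF _] := Rintegral_affine c s0 (ig (C + s * r)).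
apply: (Rintegrable_le _ iF).
  apply: measurable_funM; first exact: measurableT_comp.
  by apply: measurable_indic; exact: measurable_box.
move=> x; rewrite !normrM !normr_id ler_wpM2l// !indicE.
have [/set_mem xr|_] := boolP (x \in box r); last by rewrite normr0.
rewrite (_ : (_ \in box _) = true) ?normr1//; apply: mem_set => i.
rewrite !mxE (le_trans (ler_normD _ _))// lerD//.
by rewrite normrM (gtr0_norm s0) ler_pM2l.
Qed.

(** The test function is pulled back by the inverse map, which acts coordinatewise and so preserves
    products. The Jacobians [s ^+ n] cancel and the chain rule leaves one factor [s]. *)
Lemma tensor_partial_affine c s i g h : 0 < s -> box_integrable g -> tensor_partial i g h ->
  tensor_partial i (fun x => g (c + s *: x)) (fun x => s * h (c + s *: x)).
Proof.
move=> s0 lg [lh wp]; have sn0 : s != 0 by rewrite gt_eqF.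
split.
  have [mh ih] := box_integrable_affine c s0 lh; split; first exact: measurable_funM.
  move=> r; have := RintegrableZ s (ih r); congr Rintegrable; apply/funext => x.
  by rewrite normrM (gtr0_norm s0) mulrA.
move=> r theta dtheta r0 st dt cdt t0 d0.
have [C C0 hC] := row_bounded c.
pose tau k (t : R) := theta k (- c ord0 k / s + s^-1 * t).
pose dtau (t : R) := dtheta (- c ord0 i / s + s^-1 * t) * s^-1.
have tauE k x : - c ord0 k / s + s^-1 * (c + s *: x) ord0 k = x ord0 k.
  by rewrite !mxE; field.
(* [C + s * r] bounds the coordinates of the image of the box of radius [r], so it is the support
   radius of the pulled-back test function. *)
have r'0 : 0 < C + s * r by rewrite ltr_wpDl// mulr_gt0.
have stau k : smooth (tau k) by move=> m; apply: C1_comp_affine; exact: st.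
have dt' (t : R) : is_derive t 1 (tau i) (dtau t).
  have := @is_derive1_comp _ (theta i) (fun t => - c ord0 i / s + s^-1 * t) t _ _ (dt _) (is_derive1_affine _ _ _).
  by [].
have cdt' : continuous dtau.
  move=> t; apply: cvgM; last exact: cvg_cst.
  apply: (@continuous_comp _ _ _ (fun t => - c ord0 i / s + s^-1 * t)); last exact: cdt.
  exact: (C1_continuous (C1_affine 0%N _ _)).
have aux k t : C + s * r <= `|t| -> r <= `|- c ord0 k / s + s^-1 * t|.
  move=> Ct; rewrite -(ler_pM2l s0).
  rewrite (_ : s * `|_| = `|t - c ord0 k|); last first.
    by rewrite -{1}(gtr0_norm s0) -normrM; congr `|_|; field.
  by apply: le_trans (lerB_dist _ _); rewrite lerBrDl (le_trans _ Ct)// lerD2r hC.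
have tau0 k t : C + s * r <= `|t| -> tau k t = 0.
  by move=> Ct; rewrite /tau t0//; exact: aux.
have dtau0 t : C + s * r <= `|t| -> dtau t = 0.
  by move=> Ct; rewrite /dtau d0 ?mul0r//; exact: aux.
have ctau k : continuous (if k == i then dtau else tau k).
  by case: eqP => // _; exact: (stau k 0%N).
have tau00 k t : C + s * r <= `|t| -> (if k == i then dtau else tau k) t = 0.
  by move=> Ct; case: eqP => _; [exact: dtau0|exact: tau0].
have iF := integrable_box_tensor r'0 lg ctau tau00.
have iH := integrable_box_tensor r'0 lh (fun k => stau k 0%N) tau0.
have [iF' EF] := Rintegral_affine c s0 iF.
have [iH' EH] := Rintegral_affine c s0 iH.
have := wp _ _ _ r'0 stau dt' cdt' tau0 dtau0.
rewrite EF EH -mulrN => /(mulfI (lt0r_neq0 (exprn_gt0 n s0))) E.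
have tE x : tensor tau (c + s *: x) = tensor theta x.
  by apply: eq_bigr => k _; rewrite /tau tauE.
transitivity (s * \int[lam]_x (g (c + s *: x) *
    tensor (fun k => if k == i then dtau else tau k) (c + s *: x))).
  rewrite -RintegralZl//.
  apply: eq_Rintegral => x _; rewrite mulrCA; congr (_ * _).
  rewrite !tensor_replace /dtau tauE.
  under [in RHS]eq_bigr do rewrite /tau tauE.
  by field.
rewrite E mulrN -RintegralZl//; congr (- _); apply: eq_Rintegral => x _.
by rewrite tE mulrA.
Qed.

Lemma box_integrable_cst (a : R) : box_integrable ((fun=> a) : 'rV[R]_n -> R).
Proof.
split => // r; apply: RintegrableZ.
apply: Rintegrable_lty => //.
  by apply: measurable_indic; exact: measurable_box.
rewrite integral_indic//; last exact: measurable_box.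
rewrite setIT.
have -> : box r = [set x : 'rV[R]_n | forall i, `[- r, r]%classic (x ord0 i)].
  by apply/seteqP; split => x /= h i; have := h i; rewrite /= in_itv/= ler_norml.
apply: (@le_lt_trans _ _ (\prod_(i < n) (lebesgue_measure `[(- r)%R, r]%classic : \bar R))%E).
  rewrite le_eqVlt; apply/orP; left; apply/eqP.
  exact: (@power_measureE R lebesgue_measure n (fun=> `[- r, r]%classic) (fun=> measurable_itv _)).
rewrite -ge0_fin_numE; last by apply: prode_ge0.
by apply: prode_fin_num => i _; rewrite lebesgue_measure_itv/=; case: ifP.
Qed.

(** The derivative of a compactly supported product has integral zero: its difference quotients do
    by translation invariance, and they converge dominatedly. It allows the constant [mu] to be
    subtracted from the estimator. *)
Lemma tensor_partial_cst i (a : R) : tensor_partial (n := n) i (fun=> a) (fun=> 0).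
Proof.
split; first exact: box_integrable_cst.
move=> r theta dtheta r0 st dt cdt t0 d0.
have ct k : continuous (theta k) by exact: (st k 0%N).
pose T := tensor theta.
have l1 := box_integrable_cst 1.
have iT : Rintegrable lam T.
  have := integrable_box_tensor r0 l1 ct t0; congr Rintegrable.
  by apply/funext => x; rewrite mul1r.
pose D := tensor (fun k => if k == i then dtheta else theta k).
have cD k : continuous (if k == i then dtheta else theta k) by case: eqP.
have mD : measurable_fun setT D by exact: measurable_tensor.
have mT : measurable_fun setT T by exact: measurable_tensor.
pose e (k : nat) : 'rV[R]_n := k.+1%:R^-1 *: delta_mx ord0 i.
pose u k x := k.+1%:R * (T (e k + 1 *: x) - T x).
have iTe k : Rintegrable lam (fun x => T (e k + 1 *: x)).
  by have [] := Rintegral_affine (e k) ltr01 iT.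
have u0 k : \int[lam]_x u k x = 0.
  rewrite RintegralZl//; last exact: RintegrableB.
  rewrite (RintegralB measurableT (iTe k) iT) (Rintegral_affine (e k) ltr01 iT).2.
  by rewrite expr1n mul1r subrr mulr0.
have uD x : u k x @[k --> \oo] --> D x.
  have [dT dE] := is_derive_tensor (dt (x ord0 i)); rewrite /D tensor_replace -dE.
  have /cvgr_dnbhsP := dT; move=> /(_ (fun k => k.+1%:R^-1)).
  rewrite (_ : (fun k => u k x) = fun k : nat => (k.+1%:R^-1 : R)^-1 *:
      (T ((k.+1%:R^-1 : R) *: delta_mx ord0 i + x) - T x)); last first.
    by apply/funext => k; rewrite /u scale1r invrK.
  by apply; split; [move=> k; rewrite invr_eq0 pnatr_eq0|exact: cvg_harmonic].
have [B B0 hB] : exists2 B, 0 <= B & forall x, `|D x| <= B.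
  apply: tensor_bounded => k; apply: (continuous_compact_bounded r0) => // t rt.
  by case: eqP => _; [exact: d0|exact: t0].
(* The increments are at most 1, so every difference quotient vanishes outside the box enlarged by
   1. *)
have uB k x : `|u k x| <= B * \1_(box (r + 1)) x.
  have [xr|xr] := pselect (box (r + 1) x).
    rewrite indicE mem_set// mulr1.
    have k0 : 0 < k.+1%:R^-1 :> R by rewrite invr_gt0.
    have ab : x ord0 i < x ord0 i + k.+1%:R^-1 by rewrite ltrDl.
    (* By the mean value theorem the quotient is the value of [D] at an intermediate point of the
       segment, hence bounded by [B]. *)
    have [c _ E] := MVT ab (fun t _ => dt t) (continuous_subspaceT (ct i)).
    rewrite (_ : u k x = D (x + (c - x ord0 i) *: delta_mx ord0 i))//.
    pose P := \prod_(j < n | j != i) theta j (x ord0 j).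
    have TE (z : 'rV[R]_n) : (forall j, j != i -> z ord0 j = x ord0 j) ->
        T z = theta i (z ord0 i) * P.
      by move=> zx; rewrite /T /tensor (bigD1 i)//=; congr (_ * _); apply: eq_bigr => j /zx ->.
    rewrite /u !TE//; last by move=> j /negbTE ji; rewrite !mxE ji andbF mulr0 add0r mul1r.
    rewrite /D tensor_replace -mulrBl !mxE !eqxx !mulr1 mul1r subrKC [_^-1 + _]addrC E.
    rewrite [x ord0 i + _]addrC addrK [dtheta c * _]mulrC !mulrA mulfV ?mul1r ?pnatr_eq0//.
    congr (_ * _); apply: eq_bigr => j /negbTE ji.
    by rewrite !mxE ji andbF mulr0 addr0.
  rewrite indicE memNset// mulr0.
  have [j xj] : exists j, r + 1 < `|x ord0 j|.
    by move/existsNP: xr => [j /negP]; rewrite -ltNge; exists j.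
  have T0 (z : 'rV[R]_n) : r <= `|z ord0 j| -> T z = 0.
    by move=> zr; rewrite /T /tensor (bigD1 j)//= t0 ?mul0r.
  rewrite /u !T0 ?subrr ?mulr0 ?normr0//.
    by rewrite (le_trans _ (ltW xj))// lerDl.
  rewrite !mxE mul1r addrC eqxx/= -[k.+1%:R^-1 * _]opprK (le_trans _ (lerB_dist _ _))//.
  rewrite lerBrDr (le_trans _ (ltW xj))// lerD2l normrN normrM.
  rewrite normfV !normr_nat; case: (j == i); rewrite ?mulr0// mulr1.
  by rewrite invf_le1// ler1n.
have iB : Rintegrable lam (fun x => B * \1_(box (r + 1)) x).
  apply: RintegrableZ; have [_ /(_ (r + 1))] := l1; congr Rintegrable.
  by apply/funext => x; rewrite normr1 mul1r.
have c1 : \int[lam]_x u k x @[k --> \oo] --> \int[lam]_x D x.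
  apply: (cvg_Rintegral _ mD uD iB uB) => // k; apply: measurable_funM => //.
  by apply: measurable_funB => //; exact: Rintegrable_measurable (iTe k).
have D0 : \int[lam]_x D x = 0.
  apply: (cvg_unique _ c1) => //; rewrite (_ : (fun k => _) = fun=> 0); first exact: cvg_cst.
  exact/funext.
have iD : Rintegrable lam D.
  have := integrable_box_tensor r0 l1 cD; rewrite -/D.
  have -> : (fun x => 1 * D x) = D by apply/funext => x; rewrite mul1r.
  by apply=> k t rt; case: eqP => _; [exact: d0|exact: t0].
rewrite RintegralZl// D0 mulr0.
under eq_Rintegral do rewrite mul0r.
by rewrite Rintegral_cst// ?mul0r ?oppr0.
Qed.

Lemma box_integrableB f1 f2 : box_integrable f1 -> box_integrable f2 ->
  box_integrable (fun x => f1 x - f2 x).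
Proof.
move=> [m1 i1] [m2 i2]; have m := measurable_funB m1 m2; split => // r.
apply: (Rintegrable_le _ (RintegrableD (i1 r) (i2 r))).
  apply: measurable_funM; first exact: measurableT_comp.
  by apply: measurable_indic; exact: measurable_box.
by move=> x; rewrite normrM normr_id -mulrDl [`|\1_ _ _|]ger0_norm// ler_wpM2r// ler_normB.
Qed.

Lemma tensor_partialB i g1 g2 h1 h2 : box_integrable g1 -> box_integrable g2 ->
  tensor_partial i g1 h1 -> tensor_partial i g2 h2 ->
  tensor_partial i (fun x => g1 x - g2 x) (fun x => h1 x - h2 x).
Proof.
move=> lg1 lg2 [lh1 w1] [lh2 w2].
split; first exact: box_integrableB.
move=> r theta dtheta r0 st dt cdt t0 d0.
have iT g (lg : box_integrable g) : Rintegrable lam (fun x => g x * tensor theta x).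
  exact: (integrable_box_tensor r0 lg (fun k => st k 0%N)).
have iD g (lg : box_integrable g) : Rintegrable lam
    (fun x => g x * tensor (fun k => if k == i then dtheta else theta k) x).
  apply: (integrable_box_tensor r0 lg) => [k|k t rt].
    by case: eqP => // _; exact: (st k 0%N).
  by case: eqP => _; [exact: d0|exact: t0].
rewrite (eq_Rintegral lam (g := fun x =>
    g1 x * tensor (fun k => if k == i then dtheta else theta k) x -
    g2 x * tensor (fun k => if k == i then dtheta else theta k) x)); last first.
  by move=> x _; rewrite mulrBl.
rewrite [in RHS](eq_Rintegral lam (g := fun x =>
    h1 x * tensor theta x - h2 x * tensor theta x)); last first.
  by move=> x _; rewrite mulrBl.
rewrite !RintegralB//; try by [exact: iD|exact: iT].
by rewrite (w1 r)// (w2 r)// opprB opprK addrC.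
Qed.

End affine.

Section uniqueness.
Context {R : realType} (n : nat).
Notation lam := (@lebesgue_rV R n).
Notation gam := (@gaussian_rV R n 1).
Implicit Types (d u : 'rV[R]_n -> R).

Lemma Rintegrable_gaussian u : Rintegrable lam u -> Rintegrable gam u.
Proof.
move=> iu; have mu := Rintegrable_measurable iu.
apply/(integrable_density (mu := lam) (measurable_gauss_pdf 0 1) (gauss_pdf_ge0 0 1)) => //.
  by move=> f mf f0; exact: ge0_integral_gaussian_rV.
apply: (Rintegrable_le _ (RintegrableZ (normal_peak 1 ^+ n) (Rintegrable_norm iu))).
  by apply: measurable_funM => //; exact: measurable_gauss_pdf.
move=> x; rewrite normrM mulrC ler_wpM2r// (ger0_norm (gauss_pdf_ge0 _ _ _)).
rewrite /gauss_pdf -[in leRHS](card_ord n) -prodr_const.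
by apply: ler_prod => i _; rewrite normal_pdf_ge0 normal_pdf_ub// oner_neq0.
Qed.

(** For fixed [y] the truncated kernel is itself a product test function, so [cutF r d] has zero
    pairing with everything integrable. Pairing it with its own sign and letting the correlation
    tend to 1 gives a zero L1 norm. *)
Lemma tensor_orthogonal_ae0 d : box_integrable d ->
  (forall r theta, 0 < r -> (forall k, smooth (theta k)) ->
     (forall k t, r <= `|t| -> theta k t = 0) -> \int[lam]_x (d x * tensor theta x) = 0) ->
  {ae gam, forall x, d x = 0}.
Proof.
move=> bd dT; have [md _] := bd.
have cut0 k : {ae gam, forall x, cut k.+1%:R x * d x = 0}.
  pose r : R := k.+1%:R; have r0 : 0 < r by exact: ltr0Sn.
  (* The sign of [u] is cut to the box in order to be Lebesgue integrable; [u] vanishes outside, so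
     [u * v] is still its absolute value. *)
  pose u := cutF r d; pose v x : R := (if 0 <= u x then 1 else -1) * \1_(box r) x.
  have iu : Rintegrable lam u by exact: integrable_cutF.
  have mu := Rintegrable_measurable iu.
  have mv : measurable_fun setT v.
    apply: measurable_funM; last by apply: measurable_indic; exact: measurable_box.
    by apply: measurable_fun_ifT => //; exact: measurable_fun_ler.
  have v1 x : `|v x| <= 1.
    rewrite normrM indicE; case: ifP => _; case: (x \in box r);
      by rewrite /= ?normrN ?normr0 ?normr1 ?mulr0 ?mulr1.
  have iv : Rintegrable lam v.
    have [_ /(_ r) i1] := @box_integrable_cst R n 1.
    apply: (Rintegrable_le mv i1) => x; rewrite /v normrM normr1 [`|\1_ _ _|]ger0_norm// ler_wpM2r//.
    by case: ifP; rewrite ?normrN normr1.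
  have p0 N : \int[mehler n (rho_ N)]_p (u p.1 * v p.2) = 0.
    have -> : \int[mehler n (rho_ N)]_p (u p.1 * v p.2) = pairing (rho_ N) u v by [].
    rewrite pairing_smear//; last exact: rho_01.
    rewrite (eq_Rintegral lam (g := fun=> 0)); first by rewrite Rintegral_cst// mul0r.
    move=> y _; rewrite (_ : smear _ _ _ = 0) ?mulr0//.
    pose theta (k : 'I_n) (t : R) := bump_scale r t * mehler_ker1 (rho_ N) t (y ord0 k).
    rewrite -[RHS](dT r theta r0).
    - apply: eq_Rintegral => x _.
      rewrite (_ : _ x _ = tensor (fun k t => mehler_ker1 (rho_ N) t (y ord0 k)) x)//.
      by rewrite /u /cutF /cut mulrAC tensorM mulrC.
    - move=> i m; apply: C1M; first exact: smooth_bump_scale.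
      by apply: smooth_mehler_ker1; exact: rho_01.
    - by move=> i t rt; rewrite /theta bump_scale_out ?mul0r.
  have iug := Rintegrable_gaussian iu.
  have c1 := cvg_pairing_L1 mu mv iug v1.
  have uv x : u x * v x = `|u x|.
    rewrite /v mulrA (_ : u x * _ = `|u x|); last first.
      by case: lerP => [/ger0_norm|/ltr0_norm] ->; rewrite ?mulr1 ?mulrN1.
    have [/mem_set xr|xr] := pselect (box r x).
      by rewrite indicE xr mulr1.
    have [i] : exists i, r < `|x ord0 i|.
      by move/existsNP: xr => [i /negP]; rewrite -ltNge; exists i.
    by move=> /supported_cutF => /(_ r0 d); rewrite /u => ->; rewrite normr0 mul0r.
  have i0 : \int[gam]_x `|u x| = 0.
    under eq_Rintegral do rewrite -uv.
    apply: (cvg_unique _ c1) => //; rewrite (_ : (fun k => _) = fun=> 0); first exact: cvg_cst.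
    exact/funext.
  have : (\int[gam]_x `|(u x)%:E| = 0)%E.
    rewrite -(EFin_Rintegral (Rintegrable_norm iug)) i0 //.
  move=> /(ae_eq_integral_abs gam measurableT ((measurable_EFinP _ _).2 mu)).
  apply: filterS => x /= /(_ I) []; done.
(* Countably many radii share one null set, and off it the cutoff tends to 1. *)
have := ae_foralln cut0; apply: filterS => x dx.
have : cut k.+1%:R x * d x @[k --> \oo] --> 1 * d x.
  by apply: cvgM; [exact: cvg_cut|exact: cvg_cst].
rewrite (_ : (fun k => _) = fun=> 0); last exact/funext.
move=> c; rewrite mul1r in c; apply/esym; apply: (cvg_unique _ _ c) => //; exact: cvg_cst.
Qed.

(** At a boundary point [f] is known to vanish on the outer side only, so the derivative is computed
    along increments with the sign of [t]. This supplies the support condition on the derivative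
    witness extracted from [smooth]. *)
Lemma is_derive_out (r : R) (f : R -> R) (t d : R) : 0 < r -> is_derive t 1 f d ->
  (forall z : R, r <= `|z| -> f z = 0) -> r <= `|t| -> d = 0.
Proof.
move=> r0 [dt <-] f0 rt.
pose u (k : nat) : R := Num.sg t * k.+1%:R^-1.
have tn0 : t != 0 by rewrite -normr_gt0 (lt_le_trans r0).
have un0 k : u k != 0 by rewrite mulf_neq0 ?sgr_eq0// invr_eq0 pnatr_eq0.
have cu : u k @[k --> \oo] --> (0 : R).
  by rewrite -[X in _ --> X](mulr0 (Num.sg t)); apply: cvgM; [exact: cvg_cst|exact: cvg_harmonic].
have /cvgr_dnbhsP/(_ u (conj un0 cu)) c := dt.
apply: (cvg_unique _ c) => //; rewrite (_ : (fun k => _) = fun=> 0); first exact: cvg_cst.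
apply/funext => k /=; rewrite (f0 t)// subr0 f0 ?scaler0//.
have -> : u k *: 1 + t = Num.sg t * (k.+1%:R^-1 + `|t|).
  by rewrite mulrDr -numEsg /GRing.scale/= mulr1.
rewrite normrM normr_sg tn0 mul1r ger0_norm ?addr_ge0 ?invr_ge0//.
by rewrite (le_trans rt)// lerDr invr_ge0.
Qed.

Lemma tensor_partial_unique i g h1 h2 : tensor_partial i g h1 -> tensor_partial i g h2 ->
  {ae gam, forall x, h1 x = h2 x}.
Proof.
move=> [lh1 w1] [lh2 w2].
have : {ae gam, forall x, h1 x - h2 x = 0}.
  apply: tensor_orthogonal_ae0; first exact: box_integrableB.
  move=> r theta r0 st t0.
  have [d [dd cd]] : C1 1 (theta i) by exact: st.
  have d0 t : r <= `|t| -> d t = 0 by exact: (is_derive_out r0 (dd t) (t0 i)).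
  have iT g' (lg : box_integrable g') : Rintegrable lam (fun x => g' x * tensor theta x).
    exact: (integrable_box_tensor r0 lg (fun k => st k 0%N)).
  rewrite (eq_Rintegral lam (g := fun x => h1 x * tensor theta x - h2 x * tensor theta x)); last first.
    by move=> x _; rewrite mulrBl.
  rewrite RintegralB//; try exact: iT.
  have := w2 r theta d r0 st dd cd t0 d0; rewrite (w1 r theta d r0 st dd cd t0 d0).
  by move=> /oppr_inj ->; rewrite subrr.
by apply: filterS => x /subr0_eq.
Qed.

End uniqueness.

(** * Unbiased risk estimation *)

Lemma L2_ae d (T : measurableType d) (R : realType) (m : {measure set T -> \bar R}) (u v : T -> R) :
  measurable_fun setT v -> {ae m, forall x, u x = v x} -> L2 m u -> L2 m v.
Proof.
move=> mv uv [mu iu]; split => //.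
apply: Rintegrable_lty; [exact: measurable_funX|by move=> x; exact: sqr_ge0|].
have [_] := integrableP _ _ _ iu.
rewrite (@ge0_ae_eq_integral _ _ _ m setT (fun x => `|(EFin \o (fun x => (u x ^+ 2)%R)) x|%E) (fun x => (v x ^+ 2)%:E)) //.
- apply/measurable_EFinP; apply: measurableT_comp => //; exact: measurable_funX.
- by apply/measurable_EFinP; exact: measurable_funX.
- by move=> x _; rewrite lee_fin sqr_ge0.
- by apply: filterS uv => x uvx _; rewrite /= uvx ger0_norm ?sqr_ge0.
Qed.

Section gaussian_deviation.
Context {R : realType} (n : nat).
Notation gam := (@gaussian_rV R n 1).
Implicit Types x z : 'rV[R]_n.

Lemma L2_gaussian_cst (a : R) : L2 gam (fun=> a).
Proof.
split => //; apply: Rintegrable_lty => // [x|]; first exact: sqr_ge0.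
by rewrite integral_cst// [X in (_ * X)%E]gaussian_rV_setT mule1 ltry.
Qed.

Lemma gauss_sobolev_L2 (f : 'rV[R]_n -> R) : gauss_sobolev f ->
  L2 gam f /\ exists h, forall i, tensor_partial i f (h i) /\ L2 gam (h i).
Proof.
move=> [[mf _] [h [wh fh]]].
have mh i : measurable_fun setT (h i) by have [[]] := wh i.
have L2le (u : 'rV[R]_n -> R) : measurable_fun setT u -> (forall x, u x ^+ 2 <= f x ^+ 2 + \sum_(i < n) h i x ^+ 2) ->
    L2 gam u.
  move=> mu ule; split => //; apply: Rintegrable_lty; [exact: measurable_funX|by move=> x; exact: sqr_ge0|].
  apply: le_lt_trans fh; apply: ge0_le_integral => //.
  - by move=> x _; rewrite lee_fin sqr_ge0.
  - by apply/measurable_EFinP; exact: measurable_funX.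
  - apply/measurable_EFinP; apply: measurable_funD; first exact: measurable_funX.
    by apply: measurable_sum => i; exact: measurable_funX.
  - by move=> x _; rewrite lee_fin.
split; first by apply: L2le => // x; rewrite lerDl sumr_ge0// => i _; exact: sqr_ge0.
exists h => i; split; first exact: weak_tensor_partial.
apply: L2le => // x; rewrite (bigD1 i)//= addrCA lerDl addr_ge0 ?sqr_ge0//.
by rewrite sumr_ge0// => j _; exact: sqr_ge0.
Qed.

Lemma enorm_sqr (x : 'rV[R]_n) : enorm x ^+ 2 = \sum_(i < n) x ord0 i ^+ 2.
Proof. by rewrite sqr_sqrtr// sumr_ge0// => i _; exact: sqr_ge0. Qed.

Lemma measurable_enorm_sqr : measurable_fun setT (fun x : 'rV[R]_n => enorm x ^+ 2).
Proof.
under eq_fun do rewrite enorm_sqr.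
by apply: measurable_sum => i; apply: measurable_funX; exact: measurable_coord.
Qed.

(** The whole space is covered by [C], [A] and the set where [u] exceeds [c]; Chebyshev's inequality
    bounds the last by [e]. Both confidence statements are instances, with [A] a chi-square tail. *)
Lemma gaussian_union_bound (u : 'rV[R]_n -> R) (A C : set 'rV[R]_n) (c a e : R) :
  0 < c -> L2 gam u -> measurable A -> measurable C ->
  (forall x, ~ A x -> `|u x| <= c -> C x) ->
  (\int[gam]_x u x ^+ 2 <= c ^+ 2 * e) -> gam A = a%:E ->
  ((1 - a - e)%:E <= gam C)%E.
Proof.
move=> c0 [mu iu] mA mC AuC ue Aa.
pose B := [set x | c < `|u x|].
have mB : measurable B.
  have mnu : measurable_fun setT (fun x => `|u x|) by exact: measurableT_comp.
  rewrite (_ : B = (fun x => `|u x|) @^-1` `]c, +oo[%classic); last first.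
    by apply/seteqP; split => x; rewrite /B /= in_itv/= andbT.
  by rewrite -[X in measurable X]setTI; exact: mnu.
have Be : (gam B <= e%:E)%E.
  have c2 : 0 < c ^+ 2 by exact: exprn_gt0.
  rewrite -(@lee_pmul2l _ (c ^+ 2)%:E)// -EFinM.
  apply: (@le_trans _ _ (\int[gam]_x u x ^+ 2)%:E); last by rewrite lee_fin.
  rewrite EFin_Rintegral//.
  rewrite -[B]setIT -integral_indic//.
  rewrite -ge0_integralZl//; last 2 first.
  - by apply/measurable_EFinP; exact: measurable_indic.
  - by rewrite lee_fin ltW.
  apply: ge0_le_integral => //.
  - by move=> x _; rewrite mule_ge0// lee_fin ltW.
  - by apply: emeasurable_funM => //; apply/measurable_EFinP; exact: measurable_indic.
  - by apply/measurable_EFinP; exact: measurable_funX.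
  move=> x _; rewrite -EFinM lee_fin indicE.
  have [/set_mem Bx|_] := boolP (x \in B); last by rewrite mulr0 sqr_ge0.
  by rewrite mulr1 -(real_normK (num_real (u x))) lerXn2r ?nnegrE// ltW.
have : (1%:E <= gam C + (a%:E + e%:E))%E.
  rewrite -(gaussian_rV_setT n 1).
  apply: (@le_trans _ _ (gam (C `|` (A `|` B)))).
    apply: le_measure; rewrite ?inE//; first by apply: measurableU => //; exact: measurableU.
    move=> x _; have [Ax|Ax] := pselect (A x); first by right; left.
    have [ux|ux] := leP `|u x| c; first by left; exact: AuC.
    by right; right.
  apply: (le_trans (measureU2 _ _ _)) => //; first exact: measurableU.
  rewrite leeD2l// (le_trans (measureU2 _ _ _))//.
  by apply: leeD => //; rewrite le_eqVlt; apply/orP; left; apply/eqP; exact: Aa.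
move=> H; rewrite -addrA -opprD EFinB leeBlDr//.
Qed.

End gaussian_deviation.

Section law.
Context d (Omega : measurableType d) (R : realType) (P : probability Omega R)
  (n : nat) (sigma : R) (eps : {RV P >-> 'rV[R]_n}).
Notation gam := (@gaussian_rV R n 1).
Hypothesis sigma0 : 0 < sigma.
Hypothesis eps_law : forall A : set 'rV[R]_n, measurable A ->
  distribution P eps A = gaussian_rV n sigma A.

Definition std_noise w : 'rV[R]_n := sigma^-1 *: eps w.

Lemma measurable_std_noise : measurable_fun setT std_noise.
Proof.
rewrite (_ : std_noise = (fun x => 0 + sigma^-1 *: x) \o eps); last first.
  by apply/funext => w; rewrite /= add0r.
by apply: measurableT_comp => //; exact: measurable_affine_rV.
Qed.

Lemma ge0_integral_std_noise (F : 'rV[R]_n -> \bar R) : measurable_fun setT F ->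
  (forall x, 0 <= F x)%E -> (\int[P]_w F (std_noise w) = \int[gam]_z F z)%E.
Proof.
move=> mF F0.
have mG : measurable_fun setT (fun x : 'rV[R]_n => F (sigma^-1 *: x)).
  apply: (measurableT_comp mF).
  by have := measurable_affine_rV (0 : 'rV[R]_n) sigma^-1; under eq_fun do rewrite add0r.
rewrite -(ge0_integral_distribution eps mG)//.
rewrite (eq_measure_integral (gaussian_rV n sigma)); last by move=> A mA _; exact: eps_law.
rewrite (ge0_integral_gaussian_rV_scale sigma0 mG)//.
by apply: eq_integral => z _; rewrite scalerA mulVf ?gt_eqF// scale1r.
Qed.

Lemma prob_std_noise (A : set 'rV[R]_n) : measurable A -> P (std_noise @^-1` A) = gam A.
Proof.
move=> mA; have mA' : measurable (std_noise @^-1` A).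
  by rewrite -[X in measurable X]setTI; exact: measurable_std_noise.
rewrite -[in LHS](setIT (_ @^-1` _)) -[in RHS](setIT A) -!integral_indic//.
rewrite -(@ge0_integral_std_noise (fun z => (\1_A z)%:E))//.
by apply/measurable_EFinP; exact: measurable_indic.
Qed.

Lemma expectation_std_noise (F : 'rV[R]_n -> R) : Rintegrable gam F ->
  'E_P[F \o std_noise]%E = (\int[gam]_z F z)%:E.
Proof.
move=> iF; rewrite unlock EFin_Rintegral//.
apply: (integral_transfer ge0_integral_std_noise).
by apply/measurable_EFinP; exact: Rintegrable_measurable iF.
Qed.

End law.

(** * The estimator in standardised coordinates *)

Section standardized.
Context {R : realType} (n : nat) (sigma : R) (mu : 'rV[R]_n)
  (muhat : 'rV[R]_n -> 'rV[R]_n) (J : 'rV[R]_n -> 'M[R]_n).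
Notation gam := (@gaussian_rV R n 1).
Hypothesis sigma0 : 0 < sigma.
Hypothesis muhat_W12 : forall j : 'I_n,
  gauss_sobolev (fun x : 'rV[R]_n => muhat (mu + sigma *: x) ord0 j).
Hypothesis J_grad : weak_gradient_mx muhat J.

Definition std_bias (j : 'I_n) (z : 'rV[R]_n) : R :=
  muhat (mu + sigma *: z) ord0 j - mu ord0 j.
(** The factor [sigma] is the chain rule for [z] to [mu + sigma *: z]. *)
Definition std_jac (i j : 'I_n) (z : 'rV[R]_n) : R := sigma * J (mu + sigma *: z) i j.

Let lf j : box_integrable (fun x : 'rV[R]_n => muhat (mu + sigma *: x) ord0 j).
Proof. by have [? _] := muhat_W12 j; exact: loc_box_integrable. Qed.

(** The Sobolev hypothesis concerns the rescaled estimator, while [J] differentiates [muhat] itself;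
    undoing the scaling gives the local integrability that the chain rule asks of [muhat]. *)
Lemma box_integrable_muhat j : box_integrable (fun y : 'rV[R]_n => muhat y ord0 j).
Proof.
have sV0 : 0 < sigma^-1 by rewrite invr_gt0.
have := box_integrable_affine (- (sigma^-1 *: mu)) sV0 (lf j).
congr box_integrable; apply/funext => y; congr (muhat _ _ _).
by rewrite scalerDr scalerN !scalerA mulfV ?gt_eqF// !scale1r addrA subrr add0r.
Qed.

Lemma tensor_partial_std_bias i j : tensor_partial i (std_bias j) (std_jac i j).
Proof.
have wJ := weak_tensor_partial (J_grad i j).
have := tensor_partialB (lf j) (@box_integrable_cst R n _)
  (tensor_partial_affine mu sigma0 (box_integrable_muhat j) wJ)
  (tensor_partial_cst i (mu ord0 j)).
by congr tensor_partial; apply/funext => z; rewrite subr0.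
Qed.

(** [J_grad] provides local integrability only. The derivative coming with the Sobolev hypothesis is
    square integrable, and uniqueness makes the two agree almost everywhere. *)
Lemma L2_std_jac i j : L2 gam (std_jac i j).
Proof.
have wJ := tensor_partial_affine mu sigma0 (box_integrable_muhat j)
  (weak_tensor_partial (J_grad i j)).
have [_ [h hh]] := gauss_sobolev_L2 (muhat_W12 j).
have [wh Lh] := hh i; have [[mJ _] _] := wJ.
exact: (L2_ae mJ (tensor_partial_unique wh wJ) Lh).
Qed.

Lemma L2_std_bias j : L2 gam (std_bias j).
Proof.
by apply: L2B; [case: (gauss_sobolev_L2 (muhat_W12 j))|exact: L2_gaussian_cst].
Qed.

Lemma box_integrable_std_bias j : box_integrable (std_bias j).
Proof. by apply: box_integrableB => //; exact: box_integrable_cst. Qed.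

Let D := divg std_bias std_jac.

Lemma L2_std_divg : L2 gam D.
Proof.
exact: (L2_divg box_integrable_std_bias tensor_partial_std_bias L2_std_bias L2_std_jac).
Qed.

Lemma integrable_tr :
  Rintegrable gam (fun z => \tr (J (mu + sigma *: z) *m J (mu + sigma *: z))).
Proof.
apply: Rintegrable_sum => i.
rewrite (_ : (fun z => _) = fun z => \sum_(j < n)
    sigma^-1 ^+ 2 * (std_jac i j z * std_jac j i z)); last first.
  apply/funext => z; rewrite mxE; apply: eq_bigr => j _.
  by rewrite /std_jac; field; rewrite gt_eqF.
by apply: Rintegrable_sum => j; apply: RintegrableZ; apply: L2_mul; exact: L2_std_jac.
Qed.

Lemma integrable_bias : Rintegrable gam (fun z => enorm (muhat (mu + sigma *: z) - mu) ^+ 2).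
Proof.
rewrite (_ : (fun z => _) = fun z => \sum_(j < n) std_bias j z ^+ 2).
  by apply: Rintegrable_sum => j; case: (L2_std_bias j).
by apply/funext => z; rewrite enorm_sqr; apply: eq_bigr => j _; rewrite !mxE.
Qed.

Lemma std_divergence : \int[gam]_z (D z ^+ 2) =
  \int[gam]_z (enorm (muhat (mu + sigma *: z) - mu) ^+ 2) +
  sigma ^+ 2 * \int[gam]_z (\tr (J (mu + sigma *: z) *m J (mu + sigma *: z))).
Proof.
rewrite (gauss_divergence box_integrable_std_bias tensor_partial_std_bias L2_std_bias L2_std_jac).
congr (_ + _).
  rewrite -Rintegral_sum => [|j]; last by case: (L2_std_bias j).
  apply: eq_Rintegral => z _; rewrite enorm_sqr; apply: eq_bigr => j _.
  by rewrite !mxE.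
transitivity (\int[gam]_z (\sum_(i < n) \sum_(j < n) std_jac j i z * std_jac i j z)).
  rewrite Rintegral_sum => [|i]; last by apply: Rintegrable_sum => j; apply: L2_mul; exact: L2_std_jac.
  by apply: eq_bigr => i _; rewrite Rintegral_sum// => j; apply: L2_mul; exact: L2_std_jac.
rewrite -RintegralZl//; last exact: integrable_tr.
apply: eq_Rintegral => z _; rewrite /mxtrace mulr_sumr; apply: eq_bigr => i _.
rewrite mxE mulr_sumr; apply: eq_bigr => j _.
by rewrite /std_jac; ring.
Qed.

(** Expanding the residual [sigma z - (muhat - mu)], the cross term and the divergence correction
    combine into the Stein term [D]; what remains is the centred chi-square fluctuation. *)
Lemma SURE_error z :
  let y := mu + sigma *: z in
  SURE sigma muhat J y - enorm (mu - muhat y) ^+ 2 =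
  - (2 * sigma * D z) + sigma ^+ 2 * (enorm z ^+ 2 - n%:R).
Proof.
move=> y; rewrite /SURE !enorm_sqr /D /divg big_split/= sumrN.
have -> : \sum_(i < n) (y - muhat y) ord0 i ^+ 2 = sigma ^+ 2 * (\sum_(i < n) z ord0 i ^+ 2) -
    2 * sigma * (\sum_(i < n) z ord0 i * std_bias i z) + \sum_(i < n) (mu - muhat y) ord0 i ^+ 2.
  rewrite !mulr_sumr -sumrB -big_split/=; apply: eq_bigr => i _.
  by rewrite !mxE /std_bias; ring.
by rewrite /std_jac -mulr_sumr; ring.
Qed.

End standardized.

Theorem theorem3p4 (R : realType) (d : measure_display)
    (Omega : measurableType d) (P : probability Omega R)
    (n : nat) (sigma : R) (mu : 'rV[R]_n)
    (eps : {RV P >-> 'rV[R]_n}) (y : Omega -> 'rV[R]_n)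
    (muhat : 'rV[R]_n -> 'rV[R]_n) (J : 'rV[R]_n -> 'M[R]_n)
    (sigma_gt0 : 0 < sigma)
    (eps_law : forall A : set 'rV[R]_n, measurable A ->
      distribution P eps A = gaussian_rV n sigma A)
    (yE : forall w, y w = mu + eps w)
    (muhat_W12 : forall j : 'I_n,
      gauss_sobolev (fun x : 'rV[R]_n => muhat (mu + sigma *: x) ord0 j))
    (J_grad : weak_gradient_mx muhat J) :
  'E_P[fun w => ((SURE sigma muhat J (y w) - enorm (mu - muhat (y w)) ^+ 2
                 - enorm (eps w) ^+ 2 + sigma ^+ 2 * n%:R) ^+ 2)%R]%E
  = ((4 * sigma ^+ 2)%:E * 'E_P[fun w => (enorm (muhat (y w) - mu) ^+ 2)%R]
     + (4 * sigma ^+ 4)%:E * 'E_P[fun w => \tr (J (y w) *m J (y w))%R])%E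
  /\
  forall v0 epsn : R, 0 < v0 -> 0 <= epsn ->
    ((4 * sigma ^+ 2)%:E * 'E_P[fun w => (enorm (muhat (y w) - mu) ^+ 2)%R]
     + (4 * sigma ^+ 4)%:E * 'E_P[fun w => \tr (J (y w) *m J (y w))%R]
     <= (2 * sigma ^+ 4 * v0 ^+ 2 * n%:R * epsn)%:E)%E ->
    forall alpha : R, 0 < alpha < 1 ->
      (forall v : R,
        chi_square n
          [set q | v < (Num.sqrt (2 * n%:R))^-1 * `|q - n%:R|] = alpha%:E ->
        ((1 - alpha - epsn)%:E <=
         P [set w | (`|SURE sigma muhat J (y w) - enorm (mu - muhat (y w)) ^+ 2|
                     <= sigma ^+ 2 * (v + v0) * Num.sqrt (2 * n%:R))%R])%E)
      /\
      (forall v : R,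
        chi_square n
          [set q | v < (Num.sqrt (2 * n%:R))^-1 * (n%:R - q)] = alpha%:E ->
        ((1 - alpha - epsn)%:E <=
         P [set w | (enorm (mu - muhat (y w)) ^+ 2
                     <= SURE sigma muhat J (y w)
                        + sigma ^+ 2 * (v + v0) * Num.sqrt (2 * n%:R))%R])%E).
Proof.
pose D := divg (std_bias sigma mu muhat) (std_jac sigma mu J).
have LD : L2 (gaussian_rV n 1) D by exact: L2_std_divg.
have iD2 : Rintegrable (gaussian_rV n 1) (fun z => D z ^+ 2) by case: LD.
pose X := std_noise sigma eps.
have yX w : y w = mu + sigma *: X w.
  by rewrite yE /X /std_noise scalerA mulfV ?gt_eqF// scale1r.
have EX F : Rintegrable (gaussian_rV n 1) F -> 'E_P[F \o X]%E = (\int[gaussian_rV n 1]_z F z)%:E.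
  by move=> iF; exact: expectation_std_noise.
have PX A : measurable A -> P (X @^-1` A) = gaussian_rV n 1 A.
  by move=> mA; exact: prob_std_noise.
have epsX w : eps w = sigma *: X w by rewrite /X /std_noise scalerA mulfV ?gt_eqF// scale1r.
have E1 : 'E_P[fun w => (enorm (muhat (y w) - mu) ^+ 2)%R]%E =
    (\int[gaussian_rV n 1]_z (enorm (muhat (mu + sigma *: z) - mu) ^+ 2))%:E.
  rewrite -EX; last exact: integrable_bias.
  by congr ('E_P[_])%E; apply/funext => w; rewrite /= yX.
have E2 : 'E_P[fun w => (\tr (J (y w) *m J (y w)))%R]%E =
    (\int[gaussian_rV n 1]_z (\tr (J (mu + sigma *: z) *m J (mu + sigma *: z))))%:E.
  rewrite -EX; last exact: integrable_tr muhat_W12 J_grad.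
  by congr ('E_P[_])%E; apply/funext => w; rewrite /= yX.
have divE : \int[gaussian_rV n 1]_z (D z ^+ 2) = _ := std_divergence sigma_gt0 muhat_W12 J_grad.
have SE := SURE_error sigma mu muhat J.
(* The right-hand side is the second moment of [2 * sigma * D]; the trace term reaches [sigma ^+ 4]
   through the [sigma ^+ 2] in [std_divergence]. *)
have rhsE : ((4 * sigma ^+ 2)%:E * 'E_P[fun w => (enorm (muhat (y w) - mu) ^+ 2)%R]
     + (4 * sigma ^+ 4)%:E * 'E_P[fun w => \tr (J (y w) *m J (y w))%R] =
    (4 * sigma ^+ 2 * \int[gaussian_rV n 1]_z (D z ^+ 2))%:E)%E.
  by rewrite E1 E2 -!EFinM -EFinD divE; congr EFin; ring.
rewrite rhsE; split.
  rewrite EFinM.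
  (* Subtracting the squared noise and adding [sigma ^+ 2 * n] cancels the chi-square part of
     [SURE_error], leaving the Stein term alone. *)
  rewrite (_ : (fun w => _) = (fun z => (2 * sigma * D z) ^+ 2) \o X); last first.
    apply/funext => w /=; rewrite yX SE epsX -/D.
    rewrite (_ : enorm (sigma *: X w) ^+ 2 = sigma ^+ 2 * enorm (X w) ^+ 2); last first.
      by rewrite !enorm_sqr mulr_sumr; apply: eq_bigr => i _; rewrite mxE exprMn.
    ring.
  rewrite EX; last by case: (L2Z (2 * sigma) LD).
  rewrite -EFinM -RintegralZl//; congr EFin; apply: eq_Rintegral => z _.
  by rewrite exprMn; ring.
move=> v0 epsn v00 epsn0; rewrite lee_fin => bound alpha /andP[a0 a1].
pose G z := - (2 * sigma * D z) + sigma ^+ 2 * (enorm z ^+ 2 - n%:R).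
have GE w : SURE sigma muhat J (y w) - enorm (mu - muhat (y w)) ^+ 2 = G (X w).
  by rewrite yX; exact: SE.
have mq : measurable_fun setT (fun z : 'rV[R]_n => enorm z ^+ 2) by exact: measurable_enorm_sqr.
have mG : measurable_fun setT G.
  apply: measurable_funD.
    by apply: measurableT_comp => //; apply: measurable_funM => //; case: LD.
  by apply: measurable_funM => //; exact: measurable_funB.
pose s : R := Num.sqrt (2 * n%:R).
have chi_proper (Q : set R) : chi_square n Q = alpha%:E -> Q <> setT /\ Q <> set0.
  move=> Qa; split => E; move: Qa; rewrite E /chi_square /pushforward.
    rewrite preimage_setT [X in X = _]gaussian_rV_setT => -[] aE; move: a1.
    by rewrite -aE ltxx.
  by rewrite preimage_set0 measure0 => -[] aE; move: a0; rewrite -aE ltxx.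
(* For [n = 0] the convention [0^-1 = 0] makes the event all or nothing, of probability 1 or 0; a
   level strictly between them rules this out. *)
have n_gt0 (v : R) (f : R -> R) : chi_square n [set q | v < s^-1 * f q] = alpha%:E -> 0 < s.
  move=> /chi_proper[QT Q0]; rewrite lt_neqAle sqrtr_ge0 andbT eq_sym; apply/eqP => s0.
  have [v_lt0|v_ge0] := ltP v 0.
    by apply: QT; apply/seteqP; split => // q _ /=; rewrite s0 invr0 mul0r.
  by apply: Q0; apply/seteqP; split => // q /=; rewrite s0 invr0 mul0r ltNge v_ge0.
have sq_s : s ^+ 2 = 2 * n%:R by rewrite sqr_sqrtr// mulr_ge0.
have tail (A C : set 'rV[R]_n) : 0 < s -> measurable A -> measurable C ->
    (forall z, ~ A z -> `|2 * sigma * D z| <= sigma ^+ 2 * v0 * s -> C z) ->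
    gaussian_rV n 1 A = alpha%:E -> ((1 - alpha - epsn)%:E <= P (X @^-1` C))%E.
  move=> s0 mA mC AC Aa; rewrite PX//.
  apply: (gaussian_union_bound (u := fun z => 2 * sigma * D z) (c := sigma ^+ 2 * v0 * s) _ _ mA mC AC) => //.
  - by rewrite !mulr_gt0.
  - exact: L2Z.
  (* With [s ^+ 2 = 2 * n] the squared Chebyshev level times [epsn] is exactly the assumed bound on
     the second moment. *)
  rewrite (_ : (sigma ^+ 2 * v0 * s) ^+ 2 * epsn = 2 * sigma ^+ 4 * v0 ^+ 2 * n%:R * epsn); last first.
    by rewrite !exprMn sq_s; ring.
  apply: le_trans bound; rewrite le_eqVlt; apply/orP; left; apply/eqP.
  rewrite -RintegralZl//; apply: eq_Rintegral => z _.
  by rewrite !exprMn; ring.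
have mlt (f : 'rV[R]_n -> R) v : measurable_fun setT f -> measurable [set z | v < f z].
  move=> mf; rewrite (_ : [set z | _] = f @^-1` `]v, +oo[%classic); last first.
    by apply/seteqP; split => x; rewrite /= in_itv/= andbT.
  by rewrite -[X in measurable X]setTI; exact: mf.
have mle (f : 'rV[R]_n -> R) v : measurable_fun setT f -> measurable [set z | f z <= v].
  move=> mf; rewrite (_ : [set z | _] = f @^-1` `]-oo, v]%classic); last first.
    by apply/seteqP; split => x; rewrite /= in_itv.
  by rewrite -[X in measurable X]setTI; exact: mf.
have s2 : 0 < sigma ^+ 2 by exact: exprn_gt0.
have RE v : sigma ^+ 2 * (v + v0) * s = sigma ^+ 2 * v0 * s + sigma ^+ 2 * (s * v) by ring.
split => v chi; have s0 := n_gt0 _ _ chi.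
  (* By definition of the pushforward, [chi] is the Gaussian mass of [A]. Off [A] the chi-square
     fluctuation is at most [s * v], and the triangle inequality adds the Stein term. *)
  pose A := [set z : 'rV[R]_n | v < s^-1 * `|enorm z ^+ 2 - n%:R|].
  pose C := [set z : 'rV[R]_n | `|G z| <= sigma ^+ 2 * (v + v0) * s].
  rewrite (_ : [set w | _] = X @^-1` C); last first.
    by apply/seteqP; split => w; rewrite /C /= GE.
  apply: (tail A C) => //.
  - apply: mlt; apply: measurable_funM => //; apply: measurableT_comp => //.
    exact: measurable_funB.
  - by apply: mle; exact: measurableT_comp.
  move=> z /negP; rewrite /C /= -leNgt ler_pdivrMl// => zv Dz.
  rewrite RE (le_trans (ler_normD _ _))// normrN lerD//.
  by rewrite normrM (gtr0_norm s2) ler_pM2l.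
(* Only an upper bound on [- G] is required, so the lower tail of the chi-square variable suffices;
   the Stein term is still controlled on both sides. *)
pose A := [set z : 'rV[R]_n | v < s^-1 * (n%:R - enorm z ^+ 2)].
pose C := [set z : 'rV[R]_n | - G z <= sigma ^+ 2 * (v + v0) * s].
rewrite (_ : [set w | _] = X @^-1` C); last first.
  apply/seteqP; split => w; rewrite /C /= -GE opprB lerBlDl; exact.
apply: (tail A C) => //.
- by apply: mlt; apply: measurable_funM => //; exact: measurable_funB.
- by apply: mle; exact: measurableT_comp.
move=> z /negP; rewrite /C /= -leNgt ler_pdivrMl// => zv Dz.
rewrite RE /G opprD opprK lerD//; first by rewrite (le_trans _ Dz)// ler_norm.
by rewrite -mulrN opprB ler_pM2l.
Qed.
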